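(* Suppose that, for each $n\in\mathbb N$, the recurrence coefficient $a_n(x)$ of the monic orthogonal polynomials of $\sigma(x,ds)$ is locally bounded in $x$, i.e. $\sup_{x\in\Lambda}a_n(x)<\infty$ for every bounded Borel set $\Lambda\subset\mathbb R^d$. Then $\mathcal K:=I\,\mathcal R$, with $\mathcal R:=\operatorname{Sym}\,J$, is a unitary isomorphism $$\mathcal K:\mathcal G=\bigoplus_{\alpha\in\mathbb Z_{+,0}^\infty}\mathcal G_\alpha\to L^2(\mathcal D',\mu).$$
   Context: Conventions. $\mathbb Z_+=\{0,1,2,\dots\}$. All spaces are real. For a Hilbert space $V$ and $c>0$, $V\,c$ denotes the same vector space with squared norm multiplied by $c$. $\odot$ is the symmetric tensor product, $\operatorname{Sym}_n$ is the orthogonal projection of $H^{\otimes n}$ onto $H^{\odot n}$ (so $\operatorname{Sym}_n(f_1\otimes\dots\otimes f_n)=f_1\odot\dots\odot f_n=\frac1{n!}\sum_{\pi\in S_n}f_{\pi(1)}\otimes\dots\otimes f_{\pi(n)}$), and zeroth tensor powers are $\mathbb R$. $\mathcal F(H)=\bigoplus_{n=0}^\infty H^{\odot n}n!$ is the symmetric Fock space with vacuum $\Omega=(1,0,0,\dots)$. $\mathbb Z_{+,0}^\infty$ is the set of sequences $\alpha=(\alpha_0,\alpha_1,\dots)$ with $\alpha_i\in\mathbb Z_+$ and $|\alpha|:=\sum_i\alpha_i<\infty$. Setting. For each $x\in\mathbb R^d$, $\sigma(x,ds)$ is a probability measure on $(\mathbb R,\mathcal B(\mathbb R))$, with $x\mapsto\sigma(x,\Delta)$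 measurable for each $\Delta\in\mathcal B(\mathbb R)$. For each bounded $\Lambda\in\mathcal B(\mathbb R^d)$ there is $C_\Lambda>0$ with $\int_{\mathbb R}|s|^n\sigma(x,ds)\le C_\Lambda^n n!$ for all $n\in\mathbb N$, $x\in\Lambda$. Put $H=L^2(\mathbb R^d\times\mathbb R,dx\,\sigma(x,ds))$. Let $\mathcal D=C_0^\infty(\mathbb R^d)$ and let $\mathcal D'$ be its dual (with respect to $L^2(\mathbb R^d,dx)$), with the cylinder $\sigma$-algebra and dual pairing $\langle\omega,\varphi\rangle$. The measure $\mu$ and the operator $I$ (known facts). Let $\mathfrak D\subset\mathcal F(H)$ be the set of finite vectors $(f^{(0)},\dots,f^{(n)},0,\dots)$ where each $f^{(k)}$ is the symmetrization of a finite sum of functions $\phi(x_1,\dots,x_k)s_1^{i_1}\cdots s_k^{i_k}$ with $\phi\in C_0^\infty((\mathbb R^d)^k)$, $i_j\in\mathbb Z_+$. For $\varphi\in\mathcal D$, let $(\varphi\otimes m_i)(x,s)=\varphi(x)s^i$ and define on $\mathfrak D$ $$A(\varphi)=a^+(\varphi\otimes m_0)+a^-(\varphi\otimes m_0)+a^0(\varphi\otimes m_1),$$ where, for $f^{(k)}\in H^{\odot k}$, $a^+(h)f^{(k)}=f^{(k)}\odot h$, $a^-(h)f^{(k)}=k\int dy\,\sigma(y,du)\,h(y,u)f^{(k)}(y,u,\cdot)$, and $a^0(h)$ is multiplication of $f^{(k)}(x_1,s_1,\dots,x_k,s_k)$ by $h(x_1,s_1)+\dots+h(x_k,s_k)$.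 It is known that each $A(\varphi)$ is essentially self-adjoint on $\mathfrak D$ and that there is a unique probability measure $\mu$ on $\mathcal D'$ such that the linear operator $I:\mathcal F(H)\to L^2(\mathcal D',\mu)$ given through $I\Omega=1$ and $I(A(\varphi_1)\cdots A(\varphi_n)\Omega)=\langle\omega,\varphi_1\rangle\cdots\langle\omega,\varphi_n\rangle$ is unitary. Its Fourier transform is $$\int_{\mathcal D'}e^{i\langle\omega,\varphi\rangle}\mu(d\omega)=\exp\Big[-\tfrac12\int_{\mathbb R^d}dx\,\sigma(x,\{0\})\varphi(x)^2+\int_{\mathbb R^d}dx\int_{\mathbb R\setminus\{0\}}\sigma(x,ds)\tfrac1{s^2}\big(e^{i\varphi(x)s}-i\varphi(x)s-1\big)\Big].$$ Orthogonal polynomials. $(q^{(n)}(x,\cdot))_{n\ge0}$ are the monic orthogonal polynomials of $\sigma(x,ds)$; they satisfy $sq^{(n)}(x,s)=q^{(n+1)}(x,s)+b_n(x)q^{(n)}(x,s)+a_n(x)q^{(n-1)}(x,s)$ for $n\ge1$ and $sq^{(0)}(x,s)=q^{(1)}(x,s)+b_0(x)$, with $b_n(x)\in\mathbb R$, $a_n(x)>0$. If the support of $\sigma(x,\cdot)$ consists of $k<\infty$ points, then for $n\ge k$ one sets $q^{(n)}(x,\cdot)=0$, $a_n(x)=0$, with $b_n(x)$ arbitrary. The spaces and operators. $\rho_n(dx)=\big(\int_{\mathbb R}q^{(n)}(x,s)^2\sigma(x,ds)\big)dx$ on $\mathbb R^d$. $H_n$ is the closure in $H$ of $\{f(x)q^{(n)}(x,s):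 f\in\mathcal D\}$. $J_n:L^2(\mathbb R^d,\rho_n)\to H_n$ is $(J_nf)(x,s)=f(x)q^{(n)}(x,s)$. For $\alpha\in\mathbb Z_{+,0}^\infty$, $$\mathcal G_\alpha=\big(L^2(\mathbb R^d,\rho_0)^{\odot\alpha_0}\otimes L^2(\mathbb R^d,\rho_1)^{\odot\alpha_1}\otimes\cdots\big)\,\alpha_0!\,\alpha_1!\cdots,$$ $J_\alpha=J_0^{\otimes\alpha_0}\otimes J_1^{\otimes\alpha_1}\otimes\cdots:\mathcal G_\alpha\to(H_0^{\odot\alpha_0}\otimes H_1^{\odot\alpha_1}\otimes\cdots)\alpha_0!\alpha_1!\cdots$, and $J=\bigoplus_\alpha J_\alpha$. Finally $$\operatorname{Sym}:\bigoplus_{\alpha\in\mathbb Z_{+,0}^\infty}(H_0^{\odot\alpha_0}\otimes H_1^{\odot\alpha_1}\otimes\cdots)\alpha_0!\alpha_1!\cdots\to\mathcal F(H)$$ is the operator whose restriction to the summand indexed by $\alpha$ is $\operatorname{Sym}_{|\alpha|}$. *)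

(* Defs.v *)
From HB Require Import structures.
From mathcomp Require Import all_boot all_order all_algebra all_fingroup finmap.
From mathcomp Require Import all_classical all_reals all_analysis.
From mathcomp Require Import measurable_realfun.

Set Implicit Arguments.
Unset Strict Implicit.
Unset Printing Implicit Defensive.
Import Order.TTheory GRing.Theory Num.Theory.
Import numFieldNormedType.Exports.
Local Open Scope classical_set_scope.
Local Open Scope ring_scope.

(* The vectors of the space are the elements of the ambient vector space that
   satisfy [hmem], two of them being identified when they are related by [heq]
   (for an L^2 space: square-integrable functions modulo equality a.e.). An
   operator is a map on representatives; a linear isometry in the sense of
   [unitary] preserves [heq]. *)
Record hspace (R : realType) := HSpace {
  hvec :> lmodType R ;
  hmem : hvec -> Prop ;
  hdot : hvec -> hvec -> R }.
Arguments hmem {R} h.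
Arguments hdot {R} h.

Section hilbert.
Context {R : realType}.
Implicit Types H K : hspace R.

Definition hnorm2 H (u : H) : R := hdot H u u.

Definition heq H (u v : H) : Prop :=
  [/\ hmem H u, hmem H v & hnorm2 (u - v) = 0].

Definition unitary H K (U : H -> K) : Prop :=
  [/\ forall u, hmem H u -> hmem K (U u),
      forall (c : R) u v, hmem H u -> hmem H v ->
        heq (U (c *: u + v)) (c *: U u + U v),
      forall u v, hmem H u -> hmem H v -> hdot K (U u) (U v) = hdot H u v
    & forall w, hmem K w -> exists2 u, hmem H u & heq (U u) w].

(* [V c]: same vectors, squared norm multiplied by [c]. *)
Definition hscale (c : R) H : hspace R :=
  @HSpace R H (hmem H) (fun u v => c * hdot H u v).

Definition hsub H (P : H -> Prop) : hspace R :=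
  @HSpace R H (fun u => hmem H u /\ P u) (hdot H).

(* Convergence along the finite subsets of [J], i.e. unconditional convergence. *)
Definition hsum_to H (J : choiceType) (v : J -> H) (s : H) : Prop :=
  [/\ hmem H s, forall j, hmem H (v j)
    & forall e : R, 0 < e -> exists A0 : {fset J}, forall A : {fset J},
        fsubset A0 A -> hnorm2 (s - \sum_(j <- A) v j) < e].

(* The value is a sum of the family if there is one, and [0] otherwise. *)
Definition hsum H (J : choiceType) (v : J -> H) : H :=
  xget 0 [set s | hsum_to v s].

Definition unordered_sum (J : choiceType) (c : J -> R) : R :=
  fine (\esum_(j in [set: J]) (Num.max (c j) 0)%:E) -
  fine (\esum_(j in [set: J]) (Num.max (- c j) 0)%:E).

End hilbert.

Definition dfam (R : realType) (J : Type) (V : J -> lmodType R) : Type :=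
  forall j, V j.

Section dfam_lmod.
Context {R : realType} {J : Type} (V : J -> lmodType R).
Implicit Types (f g h : dfam V).

HB.instance Definition _ := gen_eqMixin (dfam V).
HB.instance Definition _ := gen_choiceMixin (dfam V).

Definition dfam0 : dfam V := fun=> 0.
Definition dfam_opp f : dfam V := fun j => - f j.
Definition dfam_add f g : dfam V := fun j => f j + g j.
Definition dfam_scale (c : R) f : dfam V := fun j => c *: f j.

Let dfam_addA : associative dfam_add.
Proof. by move=> f g h; apply: functional_extensionality_dep => j; exact: addrA. Qed.
Let dfam_addC : commutative dfam_add.
Proof. by move=> f g; apply: functional_extensionality_dep => j; exact: addrC. Qed.
Let dfam_add0 : left_id dfam0 dfam_add.
Proof. by move=> f; apply: functional_extensionality_dep => j; exact: add0r. Qed.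
Let dfam_addN : left_inverse dfam0 dfam_opp dfam_add.
Proof. by move=> f; apply: functional_extensionality_dep => j; exact: addNr. Qed.

HB.instance Definition _ := GRing.isZmodule.Build (dfam V)
  dfam_addA dfam_addC dfam_add0 dfam_addN.

Let dfam_scaleA c b f : dfam_scale c (dfam_scale b f) = dfam_scale (c * b) f.
Proof. by apply: functional_extensionality_dep => j; exact: scalerA. Qed.
Let dfam_scale1 : left_id 1 dfam_scale.
Proof. by move=> f; apply: functional_extensionality_dep => j; exact: scale1r. Qed.
Let dfam_scaleDr : right_distributive dfam_scale +%R.
Proof. by move=> c f g; apply: functional_extensionality_dep => j; exact: scalerDr. Qed.
Let dfam_scaleDl f : {morph dfam_scale^~ f : c b / c + b}.
Proof. by move=> c b; apply: functional_extensionality_dep => j; exact: scalerDl. Qed.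

HB.instance Definition _ := GRing.Zmodule_isLmodule.Build R (dfam V)
  dfam_scaleA dfam_scale1 dfam_scaleDr dfam_scaleDl.

End dfam_lmod.

Definition hilbert_sum (R : realType) (J : choiceType) (H : J -> hspace R) : hspace R :=
  @HSpace R (dfam (fun j => hvec (H j)))
    (fun u => (forall j, hmem (H j) (u j)) /\
      (\esum_(j in [set: J]) (hnorm2 (u j))%:E < +oo)%E)
    (fun u v => unordered_sum (fun j => hdot (H j) (u j) (v j))).

Definition hin (R : realType) (J : choiceType) (H : J -> hspace R) (j : J)
    (u : H j) : hilbert_sum H :=
  dfwith (fun k => 0 : H k) j u.
Arguments hin {R J} H j u.

Definition hl2 d (T : measurableType d) (R : realType)
    (m : {measure set T -> \bar R}) : hspace R :=
  @HSpace R (T -> R) (fun f => f \in Lfun m 2%:E)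
    (fun f g => \int[m]_x (f x * g x)).

Section cons_measure.
Context {d} {T : measurableType d} {R : realType} (n : nat).
Variables (m1 : {sigma_finite_measure set T -> \bar R})
  (m2 : {sigma_finite_measure set (n.-tuple T) -> \bar R}).

Let consp (z : T * n.-tuple T) : n.+1.-tuple T := cons_tuple z.1 z.2.

Let measurable_consp : measurable_fun [set: T * n.-tuple T] consp.
Proof. by apply: measurable_cons. Qed.

Definition cons_measure : set (n.+1.-tuple T) -> \bar R :=
  pushforward (m1 \x m2)%E consp.

Let cons_measure0 : cons_measure set0 = 0.
Proof. by rewrite /cons_measure /pushforward preimage_set0 measure0. Qed.
Let cons_measure_ge0 A : (0 <= cons_measure A)%E.
Proof. exact: measure_ge0. Qed.
Let cons_measure_sigma_additive : semi_sigma_additive cons_measure.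
Proof.
have mcons (A : set (n.+1.-tuple T)) : measurable A -> measurable (consp @^-1` A).
  by move=> mA; rewrite -[X in measurable X]setTI; exact: measurable_consp.
move=> F mF tF mUF; rewrite /cons_measure /pushforward preimage_bigcup.
apply: measure_semi_sigma_additive => [k|/=|]; first exact: mcons.
- apply/trivIsetP => /= i j _ _ ij; rewrite -preimage_setI.
  by move/trivIsetP : tF => /(_ _ _ _ _ ij) ->//; rewrite preimage_set0.
- by rewrite -preimage_bigcup; exact: mcons.
Qed.

HB.instance Definition _ := isMeasure.Build _ _ _ cons_measure
  cons_measure0 cons_measure_ge0 cons_measure_sigma_additive.

Let cons_measure_sigma_finite : sigma_finite setT cons_measure.
Proof.
have /sigma_finiteP[F [FT ndF Foo]] := sigma_finiteT m1.
have /sigma_finiteP[G [GT ndG Goo]] := sigma_finiteT m2.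
pose g (t : n.+1.-tuple T) : T * n.-tuple T := (thead t, [tuple of behead t]).
have mg : measurable_fun setT g.
  by apply/measurable_fun_pairP; split; [exact: measurable_tnth|exact: measurable_behead].
have gK z : g (consp z) = z.
  by case: z => x t; rewrite /g /consp theadE; congr pair; exact: val_inj.
exists (fun k => g @^-1` (F k `*` G k)).
  rewrite -preimage_bigcup -[LHS](preimage_setT g); congr (_ @^-1` _).
  rewrite -setXTT FT GT predeqE => -[x y]; split=> [[/= [i _ Fix] [k _ Gky]]|[i _ [/= ? ?]]].
    exists (maxn i k) => //; split.
    - by move: x Fix; exact/subsetPset/ndF/leq_maxl.
    - by move: y Gky; exact/subsetPset/ndG/leq_maxr.
  by split; exists i.
move=> k; have [mF oF] := Foo k; have [mG oG] := Goo k; split.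
  by rewrite -[X in measurable X]setTI; apply: mg => //; exact: measurableX.
rewrite /cons_measure /pushforward -comp_preimage (_ : g \o consp = id); last first.
  exact/funext.
by rewrite preimage_id product_measure1E// lte_mul_pinfty// ge0_fin_numE.
Qed.

HB.instance Definition _ := Measure_isSigmaFinite.Build _ _ _ cons_measure
  cons_measure_sigma_finite.

End cons_measure.

Fixpoint prod_measure {d} {T : measurableType d} {R : realType} (n : nat)
    (m : nat -> {sigma_finite_measure set T -> \bar R}) :
    {sigma_finite_measure set (n.-tuple T) -> \bar R} :=
  match n with
  | 0 => dirac [tuple]
  | k.+1 => cons_measure (m 0) (prod_measure k (fun i => m i.+1))
  end.

Section kernel_measure.
Context {d1 d2} {X : measurableType d1} {Y : measurableType d2} {R : realType}.
Variables (m : {sigma_finite_measure set X -> \bar R}) (k : R.-pker X ~> Y).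

Definition kernel_measure (A : set (X * Y)) : \bar R :=
  (\int[m]_x k x (xsection A x))%E.

Let kernel_measure0 : kernel_measure set0 = 0.
Proof. by rewrite [LHS]integral0_eq// => x _; rewrite xsection0. Qed.
Let kernel_measure_ge0 A : (0 <= kernel_measure A)%E.
Proof. by apply: integral_ge0. Qed.
Let measurable_section (A : set (X * Y)) : measurable A ->
  measurable_fun [set: X] (fun x => k x (xsection A x)).
Proof. by move=> mA; apply: measurable_fun_xsection_finite_kernel; rewrite inE. Qed.
Let kernel_measure_sigma_additive : semi_sigma_additive kernel_measure.
Proof.
move=> F mF tF mUF.
rewrite [X in _ --> X](_ : _ = \sum_(n <oo) kernel_measure (F n))%E.
  by apply/cvg_closeP; split; [exact: is_cvg_nneseries|rewrite closeE].
rewrite -integral_nneseries//; last by move=> n; exact: measurable_section.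
apply: eq_integral => x _; apply/esym/cvg_lim => //=; rewrite xsection_bigcup.
apply: (measure_sigma_additive _ (trivIset_xsection tF)) => ?.
exact: measurable_xsection.
Qed.

HB.instance Definition _ := isMeasure.Build _ _ _ kernel_measure
  kernel_measure0 kernel_measure_ge0 kernel_measure_sigma_additive.

Let kernel_measure_sigma_finite : sigma_finite setT kernel_measure.
Proof.
have [F FT Ffin] := sigma_finiteT m.
exists (fun i => F i `*` setT); first by rewrite -setX_bigcupl -FT setXTT.
move=> i; have [mFi Fi] := Ffin i; split; first exact: measurableX.
rewrite /kernel_measure (_ : \int[m]_x _ = m (F i))%E//.
rewrite (eq_integral (EFin \o \1_(F i))); first by rewrite integral_indic// setIT.
move=> x _ /=; rewrite indicE; have [xF|xF] := boolP (x \in F i).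
  by rewrite in_xsectionX// prob_kernel.
by rewrite notin_xsectionX// measure0.
Qed.

HB.instance Definition _ := Measure_isSigmaFinite.Build _ _ _ kernel_measure
  kernel_measure_sigma_finite.

End kernel_measure.

Section density.
Context {d} {T : measurableType d} {R : realType}.
Variables (m : {sigma_finite_measure set T -> \bar R}) (g : T -> R).

Definition density_fun : T -> R :=
  if `[< measurable_fun setT g >] then (fun x => `|g x|) else (fun=> 0).

(* The measure [g(x) m(dx)]: [density_fun] is [g] when [g] is measurable and
   nonnegative, and it makes the definition a measure for every [g]. *)
Definition density_measure (A : set T) : \bar R :=
  (\int[m]_(x in A) (density_fun x)%:E)%E.

Let dens_ge0 x : 0 <= density_fun x.
Proof. by rewrite /density_fun; case: ifP. Qed.
Let measurable_dens : measurable_fun setT density_fun.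
Proof.
rewrite /density_fun; case: asboolP => [mg|_]; last exact: measurable_cst.
exact: measurableT_comp.
Qed.
Let density_measure0 : density_measure set0 = 0.
Proof. exact: integral_set0. Qed.
Let density_measure_ge0 A : (0 <= density_measure A)%E.
Proof. by apply: integral_ge0 => x _; rewrite lee_fin. Qed.
Let density_measure_sigma_additive : semi_sigma_additive density_measure.
Proof.
apply: semi_sigma_additive_nng_induced => [|x]; last by rewrite lee_fin.
exact/measurable_EFinP.
Qed.

HB.instance Definition _ := isMeasure.Build _ _ _ density_measure
  density_measure0 density_measure_ge0 density_measure_sigma_additive.

Let density_measure_sigma_finite : sigma_finite setT density_measure.
Proof.
have /sigma_finiteP[F [FT ndF Foo]] := sigma_finiteT m.
pose D (k : nat) := [set x | density_fun x <= k%:R].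
have mD k : measurable (D k).
  rewrite (_ : D k = setT `&` density_fun @^-1` `]-oo, k%:R]).
    by apply: measurable_dens.
  by rewrite setTI; apply/seteqP; split=> x /=; rewrite in_itv.
exists (fun k => F k `&` D k).
  apply/seteqP; split => // x _.
  have [i _ Fix] : (\bigcup_i F i) x by rewrite -FT.
  have [k kx] : exists k : nat, density_fun x <= k%:R.
    by exists (Num.truncn (density_fun x)).+1; exact/ltW/truncnS_gt.
  exists (maxn i k) => //; split.
    by move: x Fix {kx}; exact/subsetPset/ndF/leq_maxl.
  by rewrite /D /= (le_trans kx)// ler_nat leq_maxr.
move=> k; have [mF Fk] := Foo k; split; first exact: measurableI.
have mFD : measurable (F k `&` D k) by exact: measurableI.
apply: (@le_lt_trans _ _ (\int[m]_(x in F k `&` D k) (k%:R)%:E)%E).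
  apply: ge0_le_integral => //.
  - by move=> x _; rewrite lee_fin.
  - by apply/measurable_EFinP; exact: measurable_funTS.
  - by move=> x [_ Dx]; rewrite lee_fin.
rewrite integral_cst//.
have mFDoo : (m (F k `&` D k) < +oo)%E.
  by rewrite (le_lt_trans _ Fk)//; apply: le_measure; rewrite ?inE.
by rewrite lte_mul_pinfty.
Qed.

HB.instance Definition _ := Measure_isSigmaFinite.Build _ _ _ density_measure
  density_measure_sigma_finite.

End density.

Section test_functions.
Context {R : realType} {d : nat}.

Definition partials (s : seq 'I_d) (f : 'rV[R]_d -> R) : 'rV[R]_d -> R :=
  foldr (fun i g => 'D_(delta_mx 0 i) g) f s.

Definition smooth (f : 'rV[R]_d -> R) : Prop := forall s,
  continuous (partials s f) /\
  forall i x, derivable (partials s f) x (delta_mx 0 i).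

Definition supported (K : set 'rV[R]_d) (f : 'rV[R]_d -> R) : Prop :=
  forall x, ~ K x -> f x = 0.

Definition test_function : {pred 'rV[R]_d -> R} :=
  mem [set f | smooth f /\ exists2 K, compact K & supported K f].

Lemma partials_lin (c : R) f g s : smooth f -> smooth g ->
  partials s (c *: f + g) = c *: partials s f + partials s g.
Proof.
move=> sf sg; elim: s => [//|i s /= ->]; apply/funext => x.
have [_ df] := sf s; have [_ dg] := sg s.
rewrite deriveD//; last exact: derivableZ.
by rewrite deriveZ.
Qed.

Fact test_function_submod : submod_closed test_function.
Proof.
split=> [|c f g].
  rewrite inE /=; split; last by exists set0; [exact: compact0|].
  move=> s; have -> : partials s (0 : 'rV[R]_d -> R) = 0.
    by elim: s => //= i s ->; apply/funext => x; rewrite derive_cst.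
  by split=> [x|i x]; [exact: cst_continuous|exact: derivable_cst].
rewrite !inE /= => -[sf [K cK fK]] [sg [L cL gL]]; split.
  move=> s; rewrite partials_lin//.
  have [cf df] := sf s; have [cg dg] := sg s.
  split=> [x|i x].
    apply: continuousD; last exact: cg.
    by apply: (@continuousM _ _ (cst c)); [exact: cst_continuous|exact: cf].
  by apply: derivableD => //; exact: derivableZ.
exists (K `|` L); first exact: compactU.
move=> x /not_orP[Kx Lx].
have -> : (c *: f + g) x = c * f x + g x by [].
by rewrite fK// gL// mulr0 addr0.
Qed.

HB.instance Definition _ := GRing.isSubmodClosed.Build R ('rV[R]_d -> R)
  test_function test_function_submod.

End test_functions.

Record testfun (R : realType) (d : nat) := Testfun {
  testfun_val :> 'rV[R]_d -> R ;
  _ : testfun_val \in test_function }.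

HB.instance Definition _ R d := [isSub for @testfun_val R d].
HB.instance Definition _ R d := [Choice of testfun R d by <:].
HB.instance Definition _ R d := [SubChoice_isSubLmodule of testfun R d by <:].

(* Convergence to [0] in the usual (LF) topology of the space of test functions.
   A linear functional on that space is continuous if and only if it is
   sequentially continuous, which is the definition used in [schwartz_dist]. *)
Definition test_cvg0 (R : realType) (d : nat) (phi : nat -> testfun R d) : Prop :=
  (exists2 K, compact K & forall n, supported K (phi n)) /\
  forall (s : seq 'I_d) (e : R), 0 < e ->
    \forall n \near \oo, forall x, `|partials s (phi n) x| <= e.

Record schwartz_dist (R : realType) (d : nat) := SchwartzDist {
  pairing :> {scalar testfun R d} ;
  _ : forall phi, test_cvg0 phi -> (fun n => pairing (phi n)) @ \oo --> 0 }.

Section distribution_measurable.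
Context {R : realType} {d : nat}.

HB.instance Definition _ := gen_eqMixin (schwartz_dist R d).
HB.instance Definition _ := gen_choiceMixin (schwartz_dist R d).

Fact zero_distribution_subproof (phi : nat -> testfun R d) :
  test_cvg0 phi -> (fun n => (\0 : {scalar testfun R d}) (phi n)) @ \oo --> (0 : R).
Proof. by move=> _; exact: cvg_cst. Qed.

HB.instance Definition _ := isPointed.Build (schwartz_dist R d)
  (SchwartzDist zero_distribution_subproof).

Definition cylinders : set (set (schwartz_dist R d)) :=
  [set C | exists (phi : testfun R d) (B : set R),
    measurable B /\ C = [set w : schwartz_dist R d | B (w phi)]].

Let cylinder_algebra := <<s cylinders>>.

HB.instance Definition _ := @isMeasurable.Build (sigma_display cylinders)
  (schwartz_dist R d) cylinder_algebra
  (@sigma_algebra0 _ setT cylinders) (@sigma_algebraC _ cylinders)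
  (@sigma_algebra_bigcup _ setT cylinders).

End distribution_measurable.

Notation euclid R d := (d.-tuple (measurableTypeR R)).

Section setting.
Context {R : realType} {d : nat}.
Local Notation Rd := (euclid R d).
Local Notation X := (euclid R d * R)%type.

Definition row_of (x : Rd) : 'rV[R]_d := \row_i (tnth x i : R).

Definition lebesgue_euclid : {sigma_finite_measure set Rd -> \bar R} :=
  prod_measure d (fun=> @lebesgue_measure R).

Definition base_measure (sigma : R.-pker Rd ~> R) :
    {sigma_finite_measure set X -> \bar R} :=
  kernel_measure lebesgue_euclid sigma.

Definition rho (sigma : R.-pker Rd ~> R) (q : nat -> Rd -> {poly R}) (n : nat) :
    {sigma_finite_measure set Rd -> \bar R} :=
  density_measure lebesgue_euclid
    (fun x => \int[sigma x]_s ((q n x).[s] ^+ 2)).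

Definition bounded_borel (L : set Rd) : Prop :=
  measurable L /\ bounded_set (row_of @` L).

Definition moment_bound (sigma : R.-pker Rd ~> R) : Prop :=
  forall L, bounded_borel L -> exists2 C : R, 0 < C &
    forall (n : nat) x, (0 < n)%N -> L x ->
      (\int[sigma x]_s (`|s| ^+ n)%:E <= (C ^+ n * n`!%:R)%:E)%E.

Section permutations.
Context {d0} {T : measurableType d0}.

Definition permute n (t : n.-tuple T) (s : 'S_n) : n.-tuple T :=
  [tuple tnth t (s i) | i < n].

Definition symmetrize n (f : n.-tuple T -> R) : n.-tuple T -> R :=
  fun t => (n`!%:R)^-1 * \sum_(s : 'S_n) f (permute t s).

Definition ae_invariant n (m : {measure set (n.-tuple T) -> \bar R})
    (G : 'S_n -> Prop) (f : n.-tuple T -> R) : Prop :=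
  forall s, G s -> (fun t => f (permute t s)) = f %[ae m].

End permutations.

Variable nu : {sigma_finite_measure set X -> \bar R}.

(* [H^{(.) n}], with [H^{(x) n}] realized as L^2 of the [n]-th power of the
   measure [nu] of [H = L^2(nu)]. *)
Definition sym_power (n : nat) : hspace R :=
  let m := prod_measure n (fun=> nu) in
  hsub (H := hl2 m) (ae_invariant m (fun=> True)).

Definition fock_level (n : nat) : hspace R := hscale n`!%:R (sym_power n).

Definition fock : hspace R := hilbert_sum fock_level.

Definition vacuum : fock := hin fock_level 0%N (fun _ : 0.-tuple X => 1 : R).

(* The formulas for the three operators below are read on arbitrary families of
   functions; the operators only get applied to finite vectors of symmetric
   polynomially bounded functions with compact support in the [x] variables.
   In [creation], [f (.) h] is computed as the symmetrization of [h (x) f]. *)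
Definition creation (h : X -> R) (f : fock) : fock := fun n =>
  match n return n.-tuple X -> R with
  | 0 => fun=> 0
  | k.+1 => symmetrize (fun t : k.+1.-tuple X => h (thead t) * f k [tuple of behead t])
  end.

Definition annihilation (h : X -> R) (f : fock) : fock := fun n t =>
  n.+1%:R * \int[nu]_z (h z * f n.+1 [tuple of z :: t]).

Definition neutral (h : X -> R) (f : fock) : fock := fun n t =>
  (\sum_(i < n) h (tnth t i)) * f n t.

Definition tensor_monomial (phi : testfun R d) (i : nat) (z : X) : R :=
  phi (row_of z.1) * z.2 ^+ i.

Definition field_op (phi : testfun R d) (f : fock) : fock :=
  creation (tensor_monomial phi 0) f + annihilation (tensor_monomial phi 0) f +
  neutral (tensor_monomial phi 1) f.

(* [I] is a unitary operator with [I Omega = 1] (the case [s = [::]]) and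
   [I (A(phi_1) ... A(phi_n) Omega) = <., phi_1> ... <., phi_n>]. *)
Definition is_chaos_isomorphism (mu : probability (schwartz_dist R d) R)
    (I : fock -> hl2 mu) : Prop :=
  unitary I /\
  forall s : seq (testfun R d),
    heq (I (foldr field_op vacuum s)) (fun w => \prod_(phi <- s) w phi).

End setting.

Definition msupport (R : realType) (m : set R -> \bar R) : set R :=
  [set s | forall U, open U -> U s -> (0 < m U)%E].

Section orthogonal_polynomials.
Context {R : realType}.

(* [q n] is the [n]-th monic orthogonal polynomial of [m], with recurrence
   coefficients [a] and [b] ([a 0] plays no role). If the support of [m] has
   [k] points, [q n = 0] and [a n = 0] for [n >= k]; since the monic polynomial
   of degree [k] is then replaced by [0], the recurrence is an identity on the
   support only, whence the "almost everywhere". *)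
Record monic_orthogonal (m : {measure set R -> \bar R}) (q : nat -> {poly R})
    (a b : nat -> R) : Prop := MonicOrthogonal {
  mo_monic : forall n, (forall k, (msupport m #= `I_k)%card -> (n < k)%N) ->
    q n \is monic /\ size (q n) = n.+1 ;
  mo_orth : forall i j, i <> j -> \int[m]_s ((q i).[s] * (q j).[s]) = 0 ;
  mo_rec0 : {ae m, forall s, s * (q 0).[s] = (q 1).[s] + b 0%N * (q 0).[s]} ;
  mo_rec : forall n, (0 < n)%N ->
    {ae m, forall s, s * (q n).[s] =
      (q n.+1).[s] + b n * (q n).[s] + a n * (q n.-1).[s]} ;
  mo_pos : forall n, (0 < n)%N -> (forall k, (msupport m #= `I_k)%card -> (n < k)%N) ->
    0 < a n ;
  mo_fin : forall k, (msupport m #= `I_k)%card -> forall n, (k <= n)%N ->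
    q n = 0 /\ a n = 0 }.

End orthogonal_polynomials.

Notation multi_index := {fsfun nat -> nat with 0%N}.

Section extended_fock.
Context {R : realType} {d : nat}.
Local Notation Rd := (euclid R d).
Local Notation X := (euclid R d * R)%type.
Implicit Types alpha : multi_index.

Definition colors alpha : seq nat :=
  flatten [seq nseq (alpha i) i | i <- sort leq (finsupp alpha)].

Definition color alpha (j : nat) : nat := nth 0%N (colors alpha) j.

Definition deg alpha : nat := size (colors alpha).

Lemma degE alpha : deg alpha = (\sum_(i <- finsupp alpha) alpha i)%N.
Proof.
rewrite /deg /colors size_flatten sumnE big_map big_map.
rewrite (perm_big (finsupp alpha)) /=; last by rewrite perm_sort.
by apply: eq_bigr => i _; rewrite size_nseq.
Qed.

Lemma count_colors alpha i : count_mem i (colors alpha) = alpha i.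
Proof.
rewrite /colors count_flatten sumnE big_map big_map.
rewrite (perm_big (finsupp alpha)) /=; last by rewrite perm_sort.
under eq_bigr => j _ do rewrite count_nseq /=.
have [ia|ia] := boolP (i \in finsupp alpha); last first.
  rewrite (fsfun_dflt ia) big1_seq// => j /andP[_ ja].
  by case: eqP => // ji; move: ia; rewrite -ji ja.
rewrite (bigD1_seq i) ?fset_uniq//= eqxx mul1n big1 ?addn0// => j ji.
by rewrite (negbTE ji).
Qed.

Definition mfact alpha : nat := (\prod_(i <- finsupp alpha) (alpha i)`!)%N.

(* Permutations of the factors inside each block of equal colors. *)
Definition block_perm alpha (s : 'S_(deg alpha)) : Prop :=
  forall j, color alpha (s j) = color alpha j.

(* The factors [L^2(rho_i)] are tensored as L^2 of the product measure. *)
Definition Gspace_at (r : nat -> {sigma_finite_measure set Rd -> \bar R}) alpha :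
    hspace R :=
  let m := prod_measure (deg alpha) (fun j => r (color alpha j)) in
  hscale (mfact alpha)%:R
    (hsub (H := hl2 m) (ae_invariant m (@block_perm alpha))).

Definition Gspace r : hspace R := hilbert_sum (Gspace_at r).

Definition J_at (q : nat -> Rd -> {poly R}) alpha
    (f : (deg alpha).-tuple Rd -> R) : (deg alpha).-tuple X -> R :=
  fun t => f [tuple (tnth t j).1 | j < deg alpha] *
    \prod_(j < deg alpha) (q (color alpha j) (tnth t j).1).[(tnth t j).2].

Definition J_op (q : nat -> Rd -> {poly R}) r (f : Gspace r) :
    forall alpha, (deg alpha).-tuple X -> R :=
  fun alpha => J_at q (f alpha).

(* The operator whose restriction to the summand of index [alpha] is
   [Sym_|alpha|]. *)
Definition Sym_op (nu : {sigma_finite_measure set X -> \bar R})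
    (h : forall alpha, (deg alpha).-tuple X -> R) : fock nu :=
  hsum (fun alpha => hin (fock_level nu) (deg alpha) (symmetrize (h alpha))).

End extended_fock.

(* Main.v *)
(* The products f(x) q^(n)(x,s) span H = L^2(dx sigma(x,ds)) orthogonally in n:
   the moment bound makes exponentials small at infinity, so polynomials are
   dense in each L^2(sigma(x,.)), and q^(n) is jointly measurable because it is
   given by Gram-Schmidt formulas in the moments. Hence f |-> f q^(n) is an
   isometry of L^2(rho_n), and the tensor products of such functions, colored by
   the degrees n_1, ..., n_k, are total in the tensor powers of H.
   For block symmetric f, the permutations s for which J_alpha f and
   (J_alpha f) o s are not orthogonal are the alpha_0! alpha_1! ... block
   permutations, which fix J_alpha f; so |Sym J_alpha f|^2 |alpha|! equals
   |f|^2 alpha_0! alpha_1! ..., and distinct alpha give orthogonal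
   symmetrizations. Thus Sym J is an isometry; a symmetric function orthogonal to
   its range is orthogonal to all colored tensors, because any sequence of
   degrees is a permutation of a sorted one, so it vanishes. *)
Require Import Defs.
From HB Require Import structures.
From mathcomp Require Import all_boot all_order all_algebra all_fingroup finmap.
From mathcomp Require Import all_classical all_reals all_analysis.
From mathcomp Require Import measurable_realfun ring lra.

Set Implicit Arguments.
Unset Strict Implicit.
Unset Printing Implicit Defensive.
Import Order.TTheory GRing.Theory Num.Theory.
Import numFieldNormedType.Exports.
Local Open Scope classical_set_scope.
Local Open Scope ring_scope.

(** Vectors are representatives and inner products are only semi-definite, so the Hilbert space
    arguments work modulo vectors of norm zero. Totality means that the orthogonal complement is
    null, not that a span is dense: in this form it passes through product measures by Fubini, one
    variable at a time, and it is what surjectivity requires, because an isometry from a complete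
    space has closed range. Fibres of finite support shape the polynomial part. There the recurrence
    holds only almost everywhere, some q^(n) vanish, and the number of support points varies with x
    in a way not known in advance to be measurable. Hence q^(n) is written as the Gram-Schmidt
    polynomial where the norm of the latter is nonzero and as 0 elsewhere, a formula uniform in x.
    The products of measures rho_n with different n are not invariant under permutations.
    Permutations of their variables are therefore transported, through multiplication by the
    polynomials, to powers of dx sigma(x,ds), which are invariant. *)

Lemma big_fset_subset (V : nmodType) (J : choiceType) (A B : {fset J})
    (F : J -> V) : fsubset A B ->
  \sum_(j <- B) F j = \sum_(j <- A) F j + \sum_(j <- (B `\` A)%fset) F j.
Proof.
move=> AB; rewrite -big_cat; apply: perm_big; apply: uniq_perm => //.
  rewrite cat_uniq !fset_uniq andbT/=; apply/hasPn => j.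
  by rewrite in_fsetD => /andP[].
move=> j; rewrite mem_cat in_fsetD; have := fsubsetP AB j.
by case: (j \in A) => //= ->.
Qed.

(** * Hilbert spaces *)

Section hilbert_spaces.
Context {R : realType}.

(** The form is only semi-definite, since vectors are representatives identified by [heq]. Each law
    is restricted to members: for other functions the integral defining [hdot] may be a default
    value. *)
Record prehilbert (H : hspace R) : Prop := Prehilbert {
  hmem0 : hmem H 0 ;
  hmemP : forall c u v, hmem H u -> hmem H v -> hmem H (c *: u + v) ;
  hdotC : forall u v, hmem H u -> hmem H v -> hdot H u v = hdot H v u ;
  hdotP : forall c u v w, hmem H u -> hmem H v -> hmem H w ->
    hdot H (c *: u + v) w = c * hdot H u w + hdot H v w ;
  hdot_ge0 : forall u, hmem H u -> 0 <= hdot H u u }.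

Definition hcauchy (H : hspace R) (u : nat -> H) : Prop := forall e : R, 0 < e ->
  exists N, forall m n, (N <= m)%N -> (N <= n)%N -> hnorm2 (u m - u n) < e.

Definition hconv (H : hspace R) (u : nat -> H) (l : H) : Prop :=
  hmem H l /\ forall e : R, 0 < e ->
  exists N, forall n, (N <= n)%N -> hnorm2 (u n - l) < e.

Record hilbert (H : hspace R) : Prop := Hilbert {
  hilbert_pre :> prehilbert H ;
  hilbert_complete : forall u : nat -> H, (forall n, hmem H (u n)) ->
    hcauchy u -> exists l, hconv u l }.

Section prehilbert_theory.
Variables (H : hspace R) (pH : prehilbert H).
Implicit Types (u v w : H) (c : R).
Local Notation dot := (hdot H).
Let mP := hmemP pH.
Let m0 := hmem0 pH.

Lemma hmemZ c u : hmem H u -> hmem H (c *: u).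
Proof. by move=> mu; rewrite -[_ *: _]addr0; apply: mP. Qed.

Lemma hmemD u v : hmem H u -> hmem H v -> hmem H (u + v).
Proof. by move=> mu mv; rewrite -[u]scale1r; apply: mP. Qed.

Lemma hmemN u : hmem H u -> hmem H (- u).
Proof. by move=> mu; rewrite -scaleN1r; apply: hmemZ. Qed.

Lemma hmemB u v : hmem H u -> hmem H v -> hmem H (u - v).
Proof. by move=> mu mv; apply: hmemD => //; apply: hmemN. Qed.

Lemma hmem_sum (J : Type) (r : seq J) (P : pred J) (v : J -> H) :
  (forall j, hmem H (v j)) -> hmem H (\sum_(j <- r | P j) v j).
Proof. by move=> mv; elim/big_ind: _ => // *; apply: hmemD. Qed.

Lemma hdot0l w : hmem H w -> dot 0 w = 0.
Proof.
move=> mw; have := hdotP pH 1 m0 m0 mw; rewrite scaler0 addr0 mul1r.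
by move/eqP; rewrite -subr_eq subrr => /eqP <-.
Qed.

Lemma hdotZl c u w : hmem H u -> hmem H w -> dot (c *: u) w = c * dot u w.
Proof.
by move=> mu mw; have := hdotP pH c mu m0 mw; rewrite addr0 hdot0l// addr0.
Qed.

Lemma hdotDl u v w : hmem H u -> hmem H v -> hmem H w ->
  dot (u + v) w = dot u w + dot v w.
Proof. by move=> mu mv mw; have := hdotP pH 1 mu mv mw; rewrite scale1r mul1r. Qed.

Lemma hdotBl u v w : hmem H u -> hmem H v -> hmem H w ->
  dot (u - v) w = dot u w - dot v w.
Proof.
move=> mu mv mw; rewrite hdotDl//; last exact: hmemN.
by rewrite -scaleN1r hdotZl// mulN1r.
Qed.

Lemma hdotZr c u w : hmem H u -> hmem H w -> dot u (c *: w) = c * dot u w.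
Proof.
move=> mu mw; rewrite (hdotC pH)//; last exact: hmemZ.
by rewrite hdotZl// (hdotC pH).
Qed.

Lemma hdotDr u v w : hmem H u -> hmem H v -> hmem H w ->
  dot u (v + w) = dot u v + dot u w.
Proof.
move=> mu mv mw; rewrite (hdotC pH)//; last exact: hmemD.
by rewrite hdotDl// !(hdotC pH _ mu).
Qed.

Lemma hdot_suml (J : Type) (r : seq J) (P : pred J) (v : J -> H) w :
  (forall j, hmem H (v j)) -> hmem H w ->
  dot (\sum_(j <- r | P j) v j) w = \sum_(j <- r | P j) dot (v j) w.
Proof.
move=> mv mw.
suff [] : hmem H (\sum_(j <- r | P j) v j) /\
    dot (\sum_(j <- r | P j) v j) w = \sum_(j <- r | P j) dot (v j) w by [].
elim/big_ind2: _ => [||j _]; [by rewrite hdot0l| |by []].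
move=> x1 x2 y1 y2 [mx1 <-] [my1 <-]; rewrite hdotDl//; split=> //.
exact: hmemD.
Qed.

Lemma hnorm2D u v : hmem H u -> hmem H v ->
  hnorm2 (u + v) = hnorm2 u + 2 * dot u v + hnorm2 v.
Proof.
move=> mu mv; rewrite /hnorm2 hdotDl//; last exact: hmemD.
by rewrite !hdotDr// (hdotC pH mv mu); ring.
Qed.

Lemma hnorm2Z c u : hmem H u -> hnorm2 (c *: u) = c ^+ 2 * hnorm2 u.
Proof. by move=> mu; rewrite /hnorm2 hdotZl ?hdotZr//; [ring|exact: hmemZ]. Qed.

Lemma hnorm2N u : hmem H u -> hnorm2 (- u) = hnorm2 u.
Proof. by move=> mu; rewrite -scaleN1r hnorm2Z// sqrrN expr1n mul1r. Qed.

Lemma hnorm2B u v : hmem H u -> hmem H v ->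
  hnorm2 (u - v) = hnorm2 u - 2 * dot u v + hnorm2 v.
Proof.
move=> mu mv; rewrite hnorm2D//; last exact: hmemN.
by rewrite hnorm2N// -[in dot _ _]scaleN1r hdotZr//; ring.
Qed.

Lemma hnorm2_sym u v : hmem H u -> hmem H v -> hnorm2 (u - v) = hnorm2 (v - u).
Proof. by move=> mu mv; rewrite -hnorm2N ?opprB//; exact: hmemB. Qed.

Lemma hnorm2D_le u v : hmem H u -> hmem H v ->
  hnorm2 (u + v) <= 2 * hnorm2 u + 2 * hnorm2 v.
Proof.
move=> mu mv; have := hdot_ge0 pH (hmemB mu mv).
by rewrite -/(hnorm2 _) hnorm2B// hnorm2D//; lra.
Qed.

Lemma hnorm2_tri u v w : hmem H u -> hmem H v -> hmem H w ->
  hnorm2 (u - w) <= 2 * hnorm2 (u - v) + 2 * hnorm2 (v - w).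
Proof.
move=> mu mv mw; have -> : u - w = (u - v) + (v - w) by rewrite addrA subrK.
by apply: hnorm2D_le; exact: hmemB.
Qed.

Lemma hdot_CS u v : hmem H u -> hmem H v ->
  dot u v ^+ 2 <= hnorm2 u * hnorm2 v.
Proof.
move=> mu mv.
have key t : 0 <= hnorm2 u + 2 * t * dot u v + t ^+ 2 * hnorm2 v.
  have := hdot_ge0 pH (hmemD mu (hmemZ t mv)).
  rewrite -/(hnorm2 _) hnorm2D//; last exact: hmemZ.
  by rewrite hdotZr// hnorm2Z// mulrA.
have [nv0|nv0] := eqVneq (hnorm2 v) 0; last first.
  have nv : 0 < hnorm2 v by rewrite lt_neqAle eq_sym nv0 (hdot_ge0 pH).
  (* The minimizer of the quadratic polynomial in [key]. *)
  have := key (- dot u v / hnorm2 v); rewrite -(pmulr_lge0 _ nv) => h.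
  rewrite -subr_ge0; move: h; congr (0 <= _); field.
  by rewrite nv0.
rewrite nv0 mulr0; have := hdot_ge0 pH mu; rewrite -/(hnorm2 u) => nu.
have [d0|d0] := eqVneq (dot u v) 0; first by rewrite d0 expr0n.
(* With |v| = 0 the polynomial is affine in t; at this t it equals -|u|^2 - 2, which is negative. *)
have := key (- (hnorm2 u + 1) / (dot u v)); rewrite nv0 mulr0 addr0.
have -> : 2 * (- (hnorm2 u + 1) / dot u v) * dot u v = - 2 * (hnorm2 u + 1).
  by field; rewrite d0.
by move=> ?; exfalso; lra.
Qed.

Lemma hdot_null u v : hmem H u -> hmem H v -> hnorm2 u = 0 -> dot u v = 0.
Proof.
move=> mu mv u0; have := hdot_CS mu mv; rewrite u0 mul0r => h.
by apply/eqP; rewrite -sqrf_eq0 eq_le h sqr_ge0.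
Qed.

Lemma heq_sym u v : heq u v -> heq v u.
Proof. by move=> [mu mv h]; split => //; rewrite hnorm2_sym. Qed.

Lemma heq_trans u v w : heq u v -> heq v w -> heq u w.
Proof.
move=> [mu mv h1] [_ mw h2]; split => //; apply/eqP.
rewrite eq_le (hdot_ge0 pH (hmemB mu mw)) andbT.
by rewrite (le_trans (hnorm2_tri mu mv mw))// h1 h2; lra.
Qed.

Lemma heq_dotl u u' v : heq u u' -> hmem H v -> dot u v = dot u' v.
Proof.
move=> [mu mu' h] mv; apply/eqP; rewrite -subr_eq0 -hdotBl//.
by rewrite hdot_null//; exact: hmemB.
Qed.

Lemma heq_dotr u u' v : heq u u' -> hmem H v -> dot v u = dot v u'.
Proof.
move=> e mv; case: (e) => mu mu' _.
by rewrite !(hdotC pH mv)//; exact: heq_dotl.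
Qed.

Lemma hnorm2_sum_orthogonal (J : choiceType) (A : {fset J}) (v : J -> H) :
  (forall j, hmem H (v j)) -> (forall i j, i != j -> dot (v i) (v j) = 0) ->
  hnorm2 (\sum_(j <- A) v j) = \sum_(j <- A) hnorm2 (v j).
Proof.
move=> mv ov; rewrite /hnorm2 hdot_suml//; last exact: hmem_sum.
apply: eq_big_seq => i iA; rewrite (hdotC pH)//; last exact: hmem_sum.
rewrite hdot_suml// (bigD1_seq i)//= big1 ?addr0// => j ji.
exact: ov.
Qed.

Lemma hsum_to_unique (J : choiceType) (v : J -> H) s t :
  hsum_to v s -> hsum_to v t -> heq s t.
Proof.
move=> [ms mv hs] [mt _ ht]; split => //; apply/eqP.
rewrite eq_le (hdot_ge0 pH (hmemB ms mt)) andbT; apply/ler_addgt0Pr => e e0.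
have e4 : 0 < e / 4 by rewrite divr_gt0.
have [A1 h1] := hs _ e4; have [A2 h2] := ht _ e4.
have := h1 _ (fsubsetUl A1 A2); have := h2 _ (fsubsetUr A1 A2).
have mS : hmem H (\sum_(j <- (A1 `|` A2)%fset) v j) by exact: hmem_sum.
rewrite (hnorm2_sym mt mS) => k2 k1; have := hnorm2_tri ms mS mt; lra.
Qed.

Lemma hsum_toP (J : choiceType) c (v w : J -> H) s t :
  hsum_to v s -> hsum_to w t -> hsum_to (fun j => c *: v j + w j) (c *: s + t).
Proof.
move=> [ms mv hs] [mt mw ht]; split => [|j|e e0]; [exact: mP|exact: mP|].
have e4 : 0 < e / 4 by rewrite divr_gt0.
(* The scalar may be zero, so the tolerance is divided by c^2 + 1 instead of c^2. *)
have c0 : 0 < c ^+ 2 + 1 by rewrite ltr_wpDl ?sqr_ge0.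
have ec4 : 0 < (e / 4) / (c ^+ 2 + 1) by rewrite divr_gt0.
have [A1 h1] := hs _ ec4; have [A2 h2] := ht _ e4.
exists (A1 `|` A2)%fset => A; rewrite fsubUset => /andP[/h1 k1 /h2 k2].
rewrite big_split/= -scaler_sumr.
have mv' := hmem_sum A xpredT mv; have mw' := hmem_sum A xpredT mw.
have -> : c *: s + t - (c *: (\sum_(j <- A) v j) + \sum_(j <- A) w j) =
   c *: (s - \sum_(j <- A) v j) + (t - \sum_(j <- A) w j).
  by rewrite scalerBr opprD addrACA.
rewrite (le_lt_trans (hnorm2D_le _ _))//; [exact/hmemZ/hmemB|exact: hmemB|].
rewrite hnorm2Z; last exact: hmemB.
have := hdot_ge0 pH (hmemB ms mv'); rewrite -/(hnorm2 _) => n0.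
move: k1; rewrite ltr_pdivlMr// => k1.
have : c ^+ 2 * hnorm2 (s - \sum_(j <- A) v j) < e / 4 by lra.
lra.
Qed.

End prehilbert_theory.

(** Continuity of the inner product, from Cauchy-Schwarz, for partial sums whose products with [w]
    are eventually constant. This covers orthogonal families and families with a single term that
    matters. *)
Lemma hdot_sum_to (H : hspace R) (pH : prehilbert H) (J : choiceType)
    (v : J -> H) s w r : hsum_to v s -> hmem H w ->
  (exists A1 : {fset J}, forall A : {fset J}, fsubset A1 A ->
     \sum_(j <- A) hdot H (v j) w = r) -> hdot H s w = r.
Proof.
move=> [ms mv hs] mw [A1 v0].
have hr A : fsubset A1 A ->
    hdot H (s - \sum_(j <- A) v j) w = hdot H s w - r.
  move=> A1A; rewrite (hdotBl pH)//; last exact: (hmem_sum pH).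
  by rewrite (hdot_suml pH)// v0.
have mB (A : {fset J}) : hmem H (s - \sum_(j <- A) v j).
  by apply: (hmemB pH) => //; exact: (hmem_sum pH).
apply/eqP; rewrite -subr_eq0; have [w0|w0] := eqVneq (hnorm2 w) 0.
  by rewrite -(hr A1)// (hdotC pH)// (hdot_null pH).
have wp : 0 < hnorm2 w by rewrite lt_neqAle eq_sym w0 (hdot_ge0 pH).
rewrite -sqrf_eq0 eq_le sqr_ge0 andbT; apply/ler_addgt0Pr => e e0.
have [A hA] := hs _ (divr_gt0 e0 wp); have {hA} := hA _ (fsubsetUr A1 A).
rewrite ltr_pdivlMr// => /ltW h; rewrite add0r (le_trans _ h)//.
by rewrite -(hr (A1 `|` A)%fset) ?fsubsetUl//; exact: (hdot_CS pH).
Qed.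

Section real_esum.
Variables (J : choiceType) (c : J -> R).
Hypothesis c0 : forall j, 0 <= c j.

Lemma esum_fset_le (A : {fset J}) :
  ((\sum_(j <- A) c j)%:E <= \esum_(j in [set: J]) (c j)%:E)%E.
Proof.
apply: esum_ge; exists [set` A]; first by split.
by rewrite fsbig_finite//= set_fsetK sumEFin.
Qed.

Lemma esum_le_bound (M : R) : (forall A : {fset J}, \sum_(j <- A) c j <= M) ->
  (\esum_(j in [set: J]) (c j)%:E <= M%:E)%E.
Proof.
move=> h; apply: ge_ereal_sup => _ [A [finA _] <-].
by rewrite fsbig_finite//= sumEFin lee_fin.
Qed.

Lemma esum_fset_approx (e : R) : (\esum_(j in [set: J]) (c j)%:E < +oo)%E ->
  0 < e -> exists A0 : {fset J}, forall A : {fset J}, fsubset A0 A ->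
    fine (\esum_(j in [set: J]) (c j)%:E) - \sum_(j <- A) c j < e.
Proof.
move=> fin e0; set S := esum _ _ in fin *.
have S0 : (0 <= S)%E by apply: esum_ge0 => *; rewrite lee_fin.
have fS : S \is a fin_num by rewrite ge0_fin_numE.
have : (S - e%:E < S)%E by rewrite lteBlDr// lteDl ?lte_fin.
move=> /ereal_sup_gt [_ [A [finA _] <-]]; rewrite fsbig_finite//= sumEFin => h.
exists (fset_set A) => B AB; rewrite ltrBlDr addrC -ltrBlDr.
apply: (@lt_le_trans _ _ (\sum_(j <- fset_set A) c j)).
  by rewrite -lte_fin EFinB fineK.
by rewrite (big_fset_subset _ AB) lerDl sumr_ge0.
Qed.

End real_esum.

Section hilbert_theory.
Variables (H : hspace R) (hH : hilbert H).
Let pH : prehilbert H := hH.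

Lemma hsum_to_exists (J : choiceType) (v : J -> H) :
  (forall j, hmem H (v j)) -> (forall i j, i != j -> hdot H (v i) (v j) = 0) ->
  (\esum_(j in [set: J]) (hnorm2 (v j))%:E < +oo)%E ->
  exists s, hsum_to v s.
Proof.
move=> mv ov fin.
have n0 j : 0 <= hnorm2 (v j) by exact: (hdot_ge0 pH).
pose S := fine (\esum_(j in [set: J]) (hnorm2 (v j))%:E).
have small (n : nat) : 0 < n.+1%:R^-1 :> R by rewrite invr_gt0.
(* [A n] carries all but 1/(n+1) of the sum of the squared norms. The partial sums over [A m] and
   [A n] are both close to the one over the union, so they form a Cauchy sequence. *)
have /choice[A hA] (n : nat) := esum_fset_approx n0 fin (small n).
have leS (B : {fset J}) : \sum_(j <- B) hnorm2 (v j) <= S.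
  rewrite -lee_fin fineK; first exact: esum_fset_le.
  rewrite ge0_fin_numE//.
  by apply: esum_ge0 => *; rewrite lee_fin.
pose s n := \sum_(j <- A n) v j.
have ms n : hmem H (s n) by exact: (hmem_sum pH).
have close n (B : {fset J}) : fsubset (A n) B ->
    hnorm2 (s n - \sum_(j <- B) v j) < n.+1%:R^-1.
  move=> AB; rewrite (hnorm2_sym pH)//; last exact: (hmem_sum pH).
  rewrite (big_fset_subset _ AB) addrC addKr.
  rewrite (hnorm2_sum_orthogonal pH)//.
  have := hA n _ (fsubset_refl _); have := leS B.
  rewrite (big_fset_subset _ AB) /S; move: (n.+1%:R^-1) => *; lra.
have cs : hcauchy s.
  move=> e e0; have [N] := ltr_add_invr (divr_gt0 e0 (ltr0n _ 4)).
  rewrite add0r => hN.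
  exists N => m n Nm Nn.
  have h k : (N <= k)%N -> k.+1%:R^-1 < e / 4.
    by move=> Nk; rewrite (le_lt_trans _ hN)// lef_pV2 ?posrE// ler_nat.
  have h1 := close m _ (fsubsetUl (A m) (A n)).
  have h2 := close n _ (fsubsetUr (A m) (A n)).
  set t := \sum_(j <- _) _ in h1 h2; have mt : hmem H t by exact: (hmem_sum pH).
  rewrite (hnorm2_sym pH)// in h2.
  have := hnorm2_tri pH (ms m) mt (ms n); have := h _ Nm; have := h _ Nn.
  by move: (n.+1%:R^-1) (m.+1%:R^-1) h1 h2 => *; lra.
have [l [ml hl]] := hilbert_complete hH ms cs.
exists l; split => // e e0.
have [N hN] := ltr_add_invr (divr_gt0 e0 (ltr0n _ 4)).
rewrite add0r in hN.
have [M hM] := hl _ (divr_gt0 e0 (ltr0n _ 4)).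
exists (A (maxn M N)) => B /close h1.
have := hM _ (leq_maxl M N); rewrite (hnorm2_sym pH)// => h2.
have h3 : (maxn M N).+1%:R^-1 < e / 4.
  by rewrite (le_lt_trans _ hN)// lef_pV2 ?posrE// ler_nat ltnS leq_maxr.
have mB := hmem_sum pH B xpredT mv.
have := hnorm2_tri pH ml (ms (maxn M N)) mB.
by move: (_.+1%:R^-1) h1 h3 => *; lra.
Qed.

(** Orthogonality turns the squared error of a partial sum into |s|^2 minus the sum of the squared
    norms. Its sign gives Bessel's inequality, its smallness the equality. *)
Lemma hnorm2_hsum_to (J : choiceType) (v : J -> H) s :
  (forall j, hmem H (v j)) -> (forall i j, i != j -> hdot H (v i) (v j) = 0) ->
  (\esum_(j in [set: J]) (hnorm2 (v j))%:E < +oo)%E -> hsum_to v s ->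
  hnorm2 s = fine (\esum_(j in [set: J]) (hnorm2 (v j))%:E).
Proof.
move=> mv ov fin hs; have [ms _ cs] := hs.
have n0 j : 0 <= hnorm2 (v j) by exact: (hdot_ge0 pH).
have dsv j : hdot H s (v j) = hnorm2 (v j).
  apply: (hdot_sum_to pH hs) => //; exists [fset j]%fset => A.
  rewrite fsub1set => jA; rewrite (bigD1_seq j)//= big1 ?addr0// => i ij.
  exact: ov.
have key (A : {fset J}) :
    hnorm2 (s - \sum_(j <- A) v j) = hnorm2 s - \sum_(j <- A) hnorm2 (v j).
  have mS := hmem_sum pH A xpredT mv.
  rewrite (hnorm2B pH)// (hnorm2_sum_orthogonal pH)//.
  rewrite (hdotC pH)// (hdot_suml pH)//.
  by under eq_bigr => j _ do rewrite (hdotC pH)// dsv; lra.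
have hge (A : {fset J}) : \sum_(j <- A) hnorm2 (v j) <= hnorm2 s.
  rewrite -subr_ge0 -key; apply: (hdot_ge0 pH); apply: (hmemB pH) => //.
  exact: (hmem_sum pH).
have fS : (\esum_(j in [set: J]) (hnorm2 (v j))%:E)%E \is a fin_num.
  by rewrite ge0_fin_numE//; apply: esum_ge0 => *; rewrite lee_fin.
apply/eqP; rewrite eq_le -![_ <= _]lee_fin fineK// esum_le_bound// andbT.
rewrite -[X in (_ <= X)%E]fineK// lee_fin; apply/ler_addgt0Pr => e e0.
have [_ _ /(_ e e0)[A0 /(_ A0 (fsubset_refl _))]] := hs.
rewrite key => h.
have := esum_fset_le (fun j => hnorm2 (v j)) A0; rewrite -[X in (_ <=
  X)%E]fineK// lee_fin; lra.
Qed.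

(** The representing vector minimizes |u|^2 - 2 phi(u). The parallelogram identity makes a
    minimizing sequence Cauchy, and the first variation vanishes at its limit. *)
Lemma riesz_representation (phi : H -> R) (B : R) :
  (forall c u v, hmem H u -> hmem H v -> phi (c *: u + v) = c * phi u + phi v) ->
  (forall u, hmem H u -> phi u ^+ 2 <= B * hnorm2 u) ->
  exists2 u0, hmem H u0 & forall u, hmem H u -> phi u = hdot H u0 u.
Proof.
move=> phiP phiB.
have m0 := hmem0 pH.
have phi0 : phi 0 = 0.
  by have := phiP 1 0 0 m0 m0; rewrite scaler0 addr0 mul1r; lra.
have phiZ c u : hmem H u -> phi (c *: u) = c * phi u.
  by move=> mu; have := phiP c u 0 mu m0; rewrite !addr0 phi0 addr0.
have phiD u v : hmem H u -> hmem H v -> phi (u + v) = phi u + phi v.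
  by move=> mu mv; have := phiP 1 u v mu mv; rewrite scale1r mul1r.
pose Q u := hnorm2 u - 2 * phi u.
(* The sign of [B] is unknown, hence the absolute value. By the inequality of the means, 2 phi(u) is
   at most [|B|] + |u|^2. *)
have Qge u : hmem H u -> - `|B| <= Q u.
  move=> mu; have := phiB u mu; have := ler_norm B.
  have := hdot_ge0 pH mu; rewrite -/(hnorm2 u) /Q => n0 BB h.
  have h' : phi u ^+ 2 <= `|B| * hnorm2 u.
    by rewrite (le_trans h)// ler_wpM2r.
  set x := phi u in h' *; set y := hnorm2 u in n0 h' *.
  set b := `|B| in BB h' *; have b0 : 0 <= b by exact: normr_ge0.
  case: (lerP x 0) => x0; first lra.
  rewrite leNgt; apply/negP => hh.
  have : (b + y) ^+ 2 < (2 * x) ^+ 2 by rewrite ltr_pXn2r ?nnegrE//; lra.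
  by have := sqr_ge0 (b - y); nra.
pose E := [set r | exists2 u, hmem H u & r = Q u].
have hE : has_inf E.
  split; first by exists (Q 0), 0.
  by exists (- `|B|) => _ [u mu ->]; exact: Qge.
pose del := inf E.
have del_le u : hmem H u -> del <= Q u.
  by move=> mu; apply: ge_inf; [case: hE|exists u].
have small (n : nat) : 0 < n.+1%:R^-1 :> R by rewrite invr_gt0.
have /choice[u hu] (n : nat) : exists u, hmem H u /\ Q u < del + n.+1%:R^-1.
  by have [_ [u mu ->] h] := inf_adherent (small n) hE; exists u.
have mu n : hmem H (u n) by case: (hu n).
(* The infimum is compared with the value of [Q] at the midpoint of [u n] and [u m]. *)
have Qmid n m : hnorm2 (u n - u m) <= 2 * n.+1%:R^-1 + 2 * m.+1%:R^-1.
  have := del_le _ (hmemZ pH (2^-1) (hmemD pH (mu n) (mu m))).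
  have mD := hmemD pH (mu n) (mu m).
  rewrite (hnorm2B pH)// /Q (hnorm2Z pH)// phiZ// phiD// (hnorm2D pH)//.
  rewrite exprVn.
  case: (hu n) (hu m) => _ + [_]; rewrite /Q.
  set x := n.+1%:R^-1; set y := m.+1%:R^-1 => *; lra.
have cu : hcauchy u.
  move=> e e0; have [N] := ltr_add_invr (divr_gt0 e0 (ltr0n _ 4)).
  rewrite add0r => hN; exists N => m n Nm Nn.
  have h k : (N <= k)%N -> k.+1%:R^-1 < e / 4.
    by move=> Nk; rewrite (le_lt_trans _ hN)// lef_pV2 ?posrE// ler_nat.
  have := Qmid m n; have := h _ Nm; have := h _ Nn.
  by move: (n.+1%:R^-1) (m.+1%:R^-1) => *; lra.
have [l [ml hl]] := hilbert_complete hH mu cu.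
exists l => // v mv.
(* This is Q(l + t v) >= Q(l). It is reached through [u k], whose value is within 1/(k+1) of the
   infimum; Cauchy-Schwarz bounds the error of replacing <u_k, v> by <l, v>. *)
have key t : 0 <= 2 * t * (hdot H l v - phi v) + t ^+ 2 * hnorm2 v.
  apply/ler_addgt0Pr => e e0.
  have nv : 0 <= hnorm2 v by exact: (hdot_ge0 pH).
  have t0 : 0 <= 4 * t ^+ 2 by rewrite mulr_ge0 ?sqr_ge0.
  have ty : 0 <= 4 * t ^+ 2 * hnorm2 v by rewrite mulr_ge0.
  have cp : 0 < 4 * t ^+ 2 * hnorm2 v + 1.
    by rewrite ltr_wpDl.
  have e4 : 0 < e / 4 by rewrite divr_gt0.
  have [N hN] := hl _ (divr_gt0 (exprn_gt0 2 e4) cp).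
  have [M] := ltr_add_invr e4; rewrite add0r => hM.
  pose k := maxn N M.
  have h1 := hN k (leq_maxl _ _).
  have h2 : k.+1%:R^-1 < e / 4.
    by rewrite (le_lt_trans _ hM)// lef_pV2 ?posrE// ler_nat ltnS leq_maxr.
  have := del_le _ (hmemD pH (mu k) (hmemZ pH t mv)).
  rewrite /Q (hnorm2D pH)// ?phiD ?phiZ ?(hnorm2Z pH) ?(hdotZr pH)//;
    try exact: (hmemZ pH).
  have := hdot_CS pH (hmemB pH (mu k) ml) mv.
  rewrite (hdotBl pH)//; case: (hu k) => _; rewrite /Q.
  move: h1 h2 cp nv e4 ty; set a := k.+1%:R^-1; set x := hnorm2 (_ - _).
  set y := hnorm2 v; set p := hdot H _ v; set p' := hdot H l v.
  move=> h1 h2 cp nv e4 ty hQ hcs hd.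
  have h3 : 4 * t ^+ 2 * (p - p') ^+ 2 <= (e / 4) ^+ 2.
    apply: (@le_trans _ _ (4 * t ^+ 2 * (x * y))).
      by rewrite ler_wpM2l.
    apply: (@le_trans _ _ (((e / 4) ^+ 2 / (4 * t ^+ 2 * y + 1)) *
        (4 * t ^+ 2 * y))); last first.
      rewrite mulrAC ler_pdivrMr// ler_wpM2l ?sqr_ge0//; lra.
    have -> : 4 * t ^+ 2 * (x * y) = x * (4 * t ^+ 2 * y) by ring.
    by rewrite ler_wpM2r ?(ltW h1).
  have h4 : 2 * t * (p - p') <= e / 4.
    case: (lerP (2 * t * (p - p')) 0) => hs; first by lra.
    rewrite -(@ler_pXn2r _ 2)// ?nnegrE ?(ltW hs) ?(ltW e4)//.
    by rewrite (le_trans _ h3)//; lra.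
  lra.
have nv : 0 <= hnorm2 v by exact: (hdot_ge0 pH).
set D := hdot H l v - phi v in key; apply/eqP; rewrite eq_sym -subr_eq0 -/D.
apply/negPn/negP => D0.
have D2 : 0 < D ^+ 2 by rewrite lt_neqAle eq_sym sqrf_eq0 D0 sqr_ge0.
have c1 : 0 < hnorm2 v + 1 by lra.
(* Near the minimizer in t; the added 1 also covers |v| = 0. *)
have := key (- D / (hnorm2 v + 1)).
rewrite -(pmulr_lge0 _ (exprn_gt0 2 c1)).
have -> : (2 * (- D / (hnorm2 v + 1)) * D + (- D / (hnorm2 v + 1)) ^+ 2 *
   hnorm2 v) * (hnorm2 v + 1) ^+ 2 = - D ^+ 2 * (hnorm2 v + 2).
  by field; rewrite gt_eqF.
by rewrite mulNr oppr_ge0 leNgt mulr_gt0//; lra.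
Qed.

End hilbert_theory.

(* The range of an isometry from a complete space is closed: Riesz's theorem
   yields the preimage of the orthogonal projection of a vector on the range. *)
Lemma isometry_surjective (H K : hspace R) (U : H -> K) :
  hilbert H -> prehilbert K ->
  (forall u, hmem H u -> hmem K (U u)) ->
  (forall (c : R) u v, hmem H u -> hmem H v ->
     heq (U (c *: u + v)) (c *: U u + U v)) ->
  (forall u v, hmem H u -> hmem H v -> hdot K (U u) (U v) = hdot H u v) ->
  (forall w, hmem K w -> (forall u, hmem H u -> hdot K w (U u) = 0) ->
     hnorm2 w = 0) ->
  forall w, hmem K w -> exists2 u, hmem H u & heq (U u) w.
Proof.
move=> hH pK mU linU isoU totU w mw.
have [||u0 mu0 hu0] := @riesz_representation H hH (fun u => hdot K w (U u))
    (hnorm2 w).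
- move=> c u v mu mv.
  rewrite (heq_dotr pK (linU c u v mu mv) mw).
  have := mU _ mu; have := mU _ mv => mUv mUu.
  by rewrite (hdotDr pK)// ?(hdotZr pK)//; exact: (hmemZ pK).
- move=> u mu; rewrite /(hnorm2 u) -isoU//; apply: (hdot_CS pK) => //.
  exact: mU.
have mU0 := mU _ mu0.
exists u0 => //; apply: (heq_sym pK); split => //.
apply: totU => [|u mu]; first exact: (hmemB pK).
by rewrite (hdotBl pK)// ?isoU ?hu0 ?subrr//; exact: mU.
Qed.

End hilbert_spaces.

(** * Sums of real families through positive and negative parts *)

Section unordered_sums.
Context {R : realType} {J : choiceType}.
Implicit Types (c p n : J -> R).
Local Notation fsum c := (\esum_(j in [set: J]) (c j)%:E)%E.

Lemma fsum_ge0 c : (forall j, 0 <= c j) -> (0 <= fsum c)%E.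
Proof. by move=> c0; apply: esum_ge0 => j _; rewrite lee_fin. Qed.

Lemma fsum_fin c : (forall j, 0 <= c j) -> (fsum c < +oo)%E ->
  fsum c \is a fin_num.
Proof. by move=> c0 h; rewrite ge0_fin_numE//; exact: fsum_ge0. Qed.

Lemma fsumD c p : (forall j, 0 <= c j) -> (forall j, 0 <= p j) ->
  fsum (fun j => c j + p j) = (fsum c + fsum p)%E.
Proof.
by move=> c0 p0; rewrite -esumD// => *; rewrite lee_fin.
Qed.

Lemma fsumD_fin c p : (forall j, 0 <= c j) -> (forall j, 0 <= p j) ->
  (fsum c < +oo)%E -> (fsum p < +oo)%E ->
  (fsum (fun j => c j + p j)%R < +oo)%E.
Proof. by move=> c0 p0 cf pf; rewrite fsumD// lte_add_pinfty. Qed.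

Lemma fsumZ a c : 0 <= a -> (forall j, 0 <= c j) ->
  fsum (fun j => a * c j) = (a%:E * fsum c)%E.
Proof.
(* One inequality suffices: used for [a] and for its inverse, it gives both. *)
move=> a0 c0; have h (b : R) (d : J -> R) : 0 <= b -> (forall j, 0 <= d j) ->
    (fsum (fun j => (b * d j)%R) <= b%:E * fsum d)%E.
  move=> b0 d0; apply: ge_ereal_sup => _ [A [finA _] <-].
  rewrite fsbig_finite//= sumEFin -mulr_sumr EFinM lee_wpmul2l ?lee_fin//.
  exact: esum_fset_le.
apply/eqP; rewrite eq_le h//=; have [->|an] := eqVneq a 0.
  by rewrite mul0e; apply: esum_ge0 => j _; rewrite mul0r.
have ap : 0 < a by rewrite lt_neqAle eq_sym an.
rewrite -lee_pdivlMl//.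
have := h a^-1 (fun j => a * c j); under eq_esum => j _ do rewrite mulKf//.
by apply; [rewrite invr_ge0|move=> j; rewrite mulr_ge0].
Qed.

Lemma le_fsum_fin c p : (forall j, 0 <= c j <= p j) -> (fsum p < +oo)%E ->
  (fsum c < +oo)%E.
Proof.
move=> cp; apply: le_lt_trans; apply: le_esum => j _.
by rewrite lee_fin; case/andP: (cp j).
Qed.

(** Any decomposition into a difference of nonnegative summable families computes the sum, not only
    the one into positive and negative parts: the identity c^+ + n = c^- + p holds termwise and can
    be summed without subtraction. Linearity rests on this freedom. *)
Lemma unordered_sum_sub c p n : (forall j, 0 <= p j) -> (forall j, 0 <= n j) ->
  (fsum p < +oo)%E -> (fsum n < +oo)%E -> (forall j, c j = p j - n j) ->
  unordered_sum c = fine (fsum p) - fine (fsum n).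
Proof.
move=> p0 n0 pf nf cE; rewrite /unordered_sum.
have P0 j : 0 <= Num.max (c j) 0 by rewrite le_max lexx orbT.
have N0 j : 0 <= Num.max (- c j) 0 by rewrite le_max lexx orbT.
have Pf : (fsum (fun j => Num.max (c j) 0) < +oo)%E.
  apply: le_fsum_fin pf => j; rewrite P0/= ge_max p0 cE andbT.
  by rewrite gerBl.
have Nf : (fsum (fun j => Num.max (- c j) 0) < +oo)%E.
  apply: le_fsum_fin nf => j; rewrite N0/= ge_max n0 cE andbT.
  by rewrite opprB gerBl.
suff : fine (fsum (fun j => Num.max (c j) 0)) + fine (fsum n) =
  fine (fsum (fun j => Num.max (- c j) 0)) + fine (fsum p) by lra.
rewrite -!fineD ?fsum_fin// -!fsumD//; congr fine; apply: eq_esum => j _.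
by congr EFin; rewrite cE opprB /Num.max; do 2 case: ifP => /=; lra.
Qed.

Definition us_summable c :=
  (fsum (fun j => Num.max (c j) 0) < +oo)%E /\
  (fsum (fun j => Num.max (- c j) 0) < +oo)%E.

Lemma us_summable_le c p : (forall j, `|c j| <= p j) -> (fsum p < +oo)%E ->
  us_summable c.
Proof.
move=> cp pf; split; apply: le_fsum_fin pf => j; have := cp j;
  by rewrite ler_norml => /andP[h1 h2]; rewrite le_max lexx orbT/= ge_max;
  lra.
Qed.

Lemma unordered_sum_lin a c d : us_summable c -> us_summable d ->
  unordered_sum (fun j => a * c j + d j) = a * unordered_sum c + unordered_sum d.
Proof.
move=> [cP cN] [dP dN].
have m0 (x : R) : 0 <= Num.max x 0 by rewrite le_max lexx orbT.
have xE (x : R) : x = Num.max x 0 - Num.max (- x) 0.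
  by rewrite /Num.max; do 2 case: ifP => /=; lra.
have fin b p n : 0 <= b -> (forall j, 0 <= p j) -> (forall j, 0 <= n j) ->
    (fsum p < +oo)%E -> (fsum n < +oo)%E ->
    (fsum (fun j => (b * p j + n j)%R) = (b * fine (fsum p) + fine (fsum n))%:E)%E.
  move=> b0 p0 n0 pf nf; rewrite fsumD// => [|j]; last by rewrite mulr_ge0.
  by rewrite fsumZ// EFinD EFinM !fineK// fsum_fin.
have lin0 b p n (b0 : 0 <= b) (p0 : forall j, 0 <= p j)
    (n0 : forall j, 0 <= n j) j : 0 <= b * p j + n j.
  by rewrite addr_ge0// mulr_ge0.
pose cp j := Num.max (c j) 0; pose cn j := Num.max (- c j) 0.
pose dp j := Num.max (d j) 0; pose dn j := Num.max (- d j) 0.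
have cp0 j : 0 <= cp j by exact: m0.
have cn0 j : 0 <= cn j by exact: m0.
have dp0 j : 0 <= dp j by exact: m0.
have dn0 j : 0 <= dn j by exact: m0.
have -> : unordered_sum c = fine (fsum cp) - fine (fsum cn) by [].
have -> : unordered_sum d = fine (fsum dp) - fine (fsum dn) by [].
(* A negative scalar exchanges the positive and negative parts of [c]. *)
case: (leP 0 a) => a0.
  rewrite (@unordered_sum_sub _ (fun j => a * cp j + dp j)
    (fun j => a * cn j + dn j)); first by rewrite fin// fin//=; ring.
  - exact: lin0.
  - exact: lin0.
  - by rewrite fin// ltry.
  - by rewrite fin// ltry.
  - move=> j; rewrite (xE (c j)) (xE (d j)) -/(cp j) -/(cn j) -/(dp j) -/(dn j).
    ring.
have na0 : 0 <= - a by rewrite oppr_ge0 ltW.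
rewrite (@unordered_sum_sub _ (fun j => - a * cn j + dp j)
  (fun j => - a * cp j + dn j)); first by rewrite fin// fin//=; ring.
- exact: lin0.
- exact: lin0.
- by rewrite fin// ltry.
- by rewrite fin// ltry.
- move=> j; rewrite (xE (c j)) (xE (d j)) -/(cp j) -/(cn j) -/(dp j) -/(dn j).
  ring.
Qed.

Lemma unordered_sum_ge0 c : (forall j, 0 <= c j) ->
  unordered_sum c = fine (fsum c).
Proof.
move=> c0; rewrite /unordered_sum [X in fine X - _](_ : _ = fsum c).
  rewrite [X in _ - fine X](_ : _ = 0%E) ?subr0// esum1// => j _.
  by rewrite (max_idPr _)// oppr_le0.
by apply: eq_esum => j _; rewrite (max_idPl _).
Qed.

Lemma fsum_single c j : (0 <= c j) -> (forall i, i != j -> c i = 0) ->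
  fsum c = (c j)%:E.
Proof.
move=> cj ci; rewrite (_ : fsum c = \esum_(i in [set j]) (c i)%:E)%E.
  by rewrite esum_set1.
rewrite [RHS]esum_mkcond; apply: eq_esum => i _.
have [->|ij] := eqVneq i j; first by rewrite mem_set.
by rewrite memNset ?ci// => /eqP; rewrite (negbTE ij).
Qed.

Lemma unordered_sum_single c j : (forall i, i != j -> c i = 0) ->
  unordered_sum c = c j.
Proof.
move=> ci; rewrite /unordered_sum !(@fsum_single _ j)/=.
- by rewrite /Num.max; do 2 case: ifP => /=; lra.
- by rewrite le_max lexx orbT.
- by move=> i /ci ->; rewrite oppr0 maxxx.
- by rewrite le_max lexx orbT.
- by move=> i /ci ->; rewrite maxxx.
Qed.

End unordered_sums.

(** * Rescalings, closed subspaces and orthogonal sums of Hilbert spaces *)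

Section hilbert_constructions.
Context {R : realType}.

Lemma hscale_hilbert (c : R) (H : hspace R) : 0 < c -> hilbert H ->
  hilbert (hscale c H).
Proof.
move=> c0 hH; have pH : prehilbert H := hH.
split; first split => /=.
- exact: (hmem0 pH).
- exact: (hmemP pH).
- by move=> u v mu mv; rewrite (hdotC pH).
- by move=> a u v w mu mv mw; rewrite (hdotP pH)//; ring.
- by move=> u mu; rewrite mulr_ge0// ?(ltW c0)// (hdot_ge0 pH).
move=> u mu cu.
have [|l [ml hl]] := @hilbert_complete _ H hH u mu.
  move=> e e0; have [N hN] := cu _ (mulr_gt0 c0 e0).
  by exists N => m n Nm Nn; have := hN m n Nm Nn; rewrite /hnorm2 ltr_pM2l.
exists l; split => // e e0.
have [N hN] := hl _ (divr_gt0 e0 c0); exists N => n /hN.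
by rewrite /hnorm2 /= ltr_pdivlMr// mulrC.
Qed.

Lemma hsub_hilbert (H : hspace R) (P : H -> Prop) : hilbert H -> P 0 ->
  (forall c u v, hmem H u -> hmem H v -> P u -> P v -> P (c *: u + v)) ->
  (forall (u : nat -> H) l, (forall n, hmem H (u n)) -> (forall n, P (u n)) ->
    hconv u l -> P l) ->
  hilbert (hsub P).
Proof.
move=> hH P0 PP Plim; have pH : prehilbert H := hH.
split; first split => /=.
- by split => //; exact: (hmem0 pH).
- by move=> c u v [mu Pu] [mv Pv]; split; [exact: (hmemP pH)|exact: PP].
- by move=> u v [mu _] [mv _]; rewrite (hdotC pH).
- by move=> c u v w [mu _] [mv _] [mw _]; rewrite (hdotP pH).
- by move=> u [mu _]; exact: (hdot_ge0 pH).
move=> u mPu cu.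
have mu n : hmem H (u n) by case: (mPu n).
have Pu n : P (u n) by case: (mPu n).
have [l hl] := @hilbert_complete _ H hH u mu cu.
by exists l; split; [split; [case: hl|exact: Plim hl]|case: hl].
Qed.

Section sum.
Variables (J : choiceType) (H : J -> hspace R).
Hypothesis hH : forall j, hilbert (H j).
Let pH j : prehilbert (H j) := hH j.
Local Notation S := (hilbert_sum H).
Implicit Types u v w : S.

Lemma hilbert_sum_n0 u : hmem S u -> forall j, 0 <= hnorm2 (u j).
Proof. by move=> [mu _] j; exact: (hdot_ge0 (pH j)). Qed.

Lemma hilbert_sum_memP (c : R) u v : hmem S u -> hmem S v -> hmem S (c *: u + v).
Proof.
move=> su sv; have [mu fu] := su; have [mv fv] := sv.
split=> [j|]; first exact: (hmemP (pH j)).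
have u0 := hilbert_sum_n0 su; have v0 := hilbert_sum_n0 sv.
have c0 : 0 <= 2 * c ^+ 2 by rewrite mulr_ge0 ?sqr_ge0.
apply: (@le_fsum_fin _ _ _ (fun j => (2 * c ^+ 2) * hnorm2 (u j) + 2 * hnorm2 (v j))).
  move=> j; rewrite (hdot_ge0 (pH j))/=; last exact: (hmemP (pH j)).
  have mZ := hmemZ (pH j) c (mu j).
  rewrite (le_trans (hnorm2D_le (pH j) mZ (mv j)))//.
  by rewrite (hnorm2Z (pH j))// mulrA.
have Zfin (b : R) (p : J -> R) : 0 <= b -> (forall j, 0 <= p j) ->
    (\esum_(j in [set: J]) (p j)%:E < +oo)%E ->
    (\esum_(j in [set: J]) (b * p j)%:E < +oo)%E.
  by move=> b0 p0 pf; rewrite fsumZ// -[esum _ _]fineK ?fsum_fin// ltry.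
apply: fsumD_fin; [|by move=> j; rewrite mulr_ge0|exact: Zfin|exact: Zfin].
by move=> j; rewrite mulr_ge0.
Qed.

Lemma hilbert_sum_summable u v : hmem S u -> hmem S v ->
  us_summable (fun j => hdot (H j) (u j) (v j)).
Proof.
move=> su sv; have [mu fu] := su; have [mv fv] := sv.
have u0 := hilbert_sum_n0 su; have v0 := hilbert_sum_n0 sv.
(* The majorant of |<u_j, v_j>| comes from the nonnegativity of |u_j + v_j|^2 and |u_j - v_j|^2. *)
apply: (@us_summable_le _ _ _ (fun j => hnorm2 (u j) + hnorm2 (v j))).
  move=> j; rewrite ler_norml.
  have := hdot_ge0 (pH j) (hmemD (pH j) (mu j) (mv j)).
  have := hdot_ge0 (pH j) (hmemB (pH j) (mu j) (mv j)).
  rewrite -!/(hnorm2 _) (hnorm2B (pH j))// (hnorm2D (pH j))//.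
  by have := u0 j; have := v0 j; lra.
exact: fsumD_fin.
Qed.

Lemma hilbert_sum_norm u : hmem S u ->
  hnorm2 u = fine (\esum_(j in [set: J]) (hnorm2 (u j))%:E).
Proof. by move=> su; apply: unordered_sum_ge0; exact: hilbert_sum_n0. Qed.

Lemma hilbert_sum_prehilbert : prehilbert S.
Proof.
split.
- split=> [j|]; first exact: (hmem0 (pH j)).
  rewrite esum1// => j _; rewrite /hnorm2 (hdot0l (pH j))//.
  exact: (hmem0 (pH j)).
- exact: hilbert_sum_memP.
- move=> u v [mu _] [mv _]; rewrite /=; congr unordered_sum.
  by apply/funext => j; rewrite (hdotC (pH j)).
- move=> c u v w su sv sw; rewrite /= -unordered_sum_lin;
    try exact: hilbert_sum_summable.
  congr unordered_sum; apply/funext => j.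
  by case: su sv sw => [mu _] [mv _] [mw _]; rewrite (hdotP (pH j)).
- move=> u su; rewrite -/(hnorm2 u) hilbert_sum_norm// fine_ge0//.
  by apply: fsum_ge0; exact: hilbert_sum_n0.
Qed.

Lemma hilbert_sum_norm_ge u (A : {fset J}) : hmem S u ->
  \sum_(j <- A) hnorm2 (u j) <= hnorm2 u.
Proof.
move=> su; rewrite hilbert_sum_norm// -lee_fin fineK; first exact: esum_fset_le.
by apply: fsum_fin; [exact: hilbert_sum_n0|case: su].
Qed.

Lemma hilbert_sum_hilbert : hilbert S.
Proof.
have pS := hilbert_sum_prehilbert; split => // u su cu.
have mu n j : hmem (H j) (u n j) by case: (su n).
have suB m n := hmemB pS (su m) (su n).
have cuj j : hcauchy (fun n => u n j).
  move=> e /cu[N hN]; exists N => m n Nm Nn; rewrite (le_lt_trans _ (hN m n Nm Nn))//.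
  by have := hilbert_sum_norm_ge [fset j]%fset (suB m n); rewrite big_seq_fset1.
have exl j : exists l, hconv (fun n => u n j) l.
  by apply: (hilbert_complete (hH j)) => //; exact: mu.
pose l j := projT1 (cid (exl j)).
have hl j : hconv (fun n => u n j) (l j) := projT2 (cid (exl j)).
have ml j : hmem (H j) (l j) by case: (hl j).
(* The index [N] must not depend on [A]. For a given [A], a late [u m] is close to the componentwise
   limit on all of [A], and the Cauchy property compares [u n] with [u m]. *)
have key e : 0 < e -> exists N, forall n, (N <= n)%N -> forall A : {fset J},
    \sum_(j <- A) hnorm2 (u n j - l j) <= e.
  move=> e0; have e2 : 0 < e / 2 by rewrite divr_gt0.
  have e4 : 0 < e / 4 by rewrite divr_gt0.
  have [N hN] := cu _ e4.
  exists N => n Nn A.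
  have [M hM] : exists M, forall m, (M <= m)%N ->
      \sum_(j <- A) hnorm2 (u m j - l j) < e / 4.
    (* The successor avoids a division by zero for empty [A] and makes the total strictly smaller
       than e/4. *)
    have k0 : 0 < (e / 4) / (size A).+1%:R by rewrite divr_gt0.
    have /choice[M hM] : forall j, exists M, forall m, (M <= m)%N ->
        hnorm2 (u m j - l j) < (e / 4) / (size A).+1%:R.
      by move=> j; have [_] := hl j; apply.
    exists (\max_(j <- A) M j)%N => m Mm.
    apply: (@le_lt_trans _ _ (\sum_(j <- A) (e / 4) / (size A).+1%:R)).
      rewrite !big_seq; apply: ler_sum => j jA; apply/ltW/hM.
      by apply: leq_trans Mm; apply: leq_bigmax_seq.
    rewrite big_const_seq count_predT iter_addr_0 -[_ *+ size _]mulr_natr.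
    rewrite -mulrA gtr_pMr//.
    by rewrite mulrC ltr_pdivrMr// mul1r ltr_nat.
  pose m := maxn M N.
  have h1 := hM m (leq_maxl _ _).
  have h2 := hN n m Nn (leq_maxr _ _).
  have h3 := hilbert_sum_norm_ge A (suB n m).
  apply: (@le_trans _ _ (\sum_(j <- A) (2 * hnorm2 (u n j - u m j) +
      2 * hnorm2 (u m j - l j)))).
    by apply: ler_sum => j _; exact: (hnorm2_tri (pH j)).
  rewrite big_split/= -!mulr_sumr.
  move: h1 h3 h2; move: (\sum_(j <- A) _) (\sum_(j <- A) _) => *; lra.
have sum_le (v : S) e : (forall j, hmem (H j) (v j)) -> (forall A : {fset J},
    \sum_(j <- A) hnorm2 (v j) <= e) -> hmem S v /\ hnorm2 v <= e.
  move=> mv h.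
  have v0 j : 0 <= hnorm2 (v j) by exact: (hdot_ge0 (pH j)).
  have hf := esum_le_bound h.
  have sv : hmem S v by split => //; rewrite (le_lt_trans hf)// ltry.
  split => //; rewrite hilbert_sum_norm// -lee_fin fineK//.
  by apply: fsum_fin => //; case: sv.
have mB n : forall j, hmem (H j) ((u n - (l : S)) j).
  by move=> j; exact: (hmemB (pH j)).
have sl : hmem S l.
  have [N /(_ N (leqnn _)) h] := key 1 ltr01.
  have [sB _] := sum_le _ _ (mB N) h.
  have -> : (l : S) = u N - (u N - (l : S)) by rewrite opprB addrC subrK.
  exact: (hmemB pS).
exists l; split => // e e0; have [N hN] := key _ (divr_gt0 e0 (ltr0n _ 2)).
exists N => n /hN h; have [_] := sum_le _ _ (mB n) h; lra.
Qed.

Lemma hin_same j (x : H j) : hin H j x j = x.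
Proof. exact: dfwithin. Qed.

Lemma hin_other j i (x : H j) : i != j -> hin H j x i = 0.
Proof. by move=> ij; rewrite /hin dfwithout// eq_sym. Qed.

Lemma hin_mem j (x : H j) : hmem (H j) x -> hmem S (hin H j x).
Proof.
move=> mx; split=> [i|].
  have [->|ij] := eqVneq i j; first by rewrite hin_same.
  by rewrite hin_other//; exact: (hmem0 (pH i)).
rewrite (@fsum_single _ _ _ j) ?ltry//.
  by rewrite hin_same (hdot_ge0 (pH j)).
move=> i ij; rewrite hin_other// /hnorm2 (hdot0l (pH i))//.
exact: (hmem0 (pH i)).
Qed.

Lemma hdot_hin u j (x : H j) : (forall i, hmem (H i) (u i)) ->
  hdot S u (hin H j x) = hdot (H j) (u j) x.
Proof.
move=> mu; rewrite /= (@unordered_sum_single _ _ _ j) ?hin_same// => i ij.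
rewrite hin_other// (hdotC (pH i))// ?(hdot0l (pH i))//.
exact: (hmem0 (pH i)).
Qed.

Lemma hnorm2_hin j (x : H j) : hmem (H j) x -> hnorm2 (hin H j x) = hnorm2 x.
Proof.
by move=> mx; rewrite /hnorm2 hdot_hin ?hin_same//; case: (hin_mem mx).
Qed.

Lemma hin_lin j (c : R) (x y : H j) :
  hin H j (c *: x + y) = c *: hin H j x + hin H j y.
Proof.
apply: functional_extensionality_dep => i.
have -> : (c *: hin H j x + hin H j y) i = c *: hin H j x i + hin H j y i by [].
have [->|ij] := eqVneq i j; first by rewrite !hin_same.
by rewrite !hin_other// scaler0 addr0.
Qed.

End sum.
End hilbert_constructions.

(** Replaces a square root when a bound on squares must yield a summable majorant. *)
Lemma le_add1_of_sqr (R : realFieldType) (x y : R) :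
  0 <= x -> x ^+ 2 <= y -> x <= y + 1.
Proof. by move=> x0 h; rewrite leNgt; apply/negP => h'; nra. Qed.

(** * L^2 spaces *)

Section L2.
Context {d} {T : measurableType d} {R : realType}.
Variable m : {measure set T -> \bar R}.
Implicit Types f g h : T -> R.

Lemma L2P f : f \in Lfun m 2%:E <->
  measurable_fun [set: T] f /\ (\int[m]_x (f x ^+ 2)%:E < +oo)%E.
Proof.
split=> [l2f|[mf f2]].
  split; first by move: l2f; rewrite inE => /andP[]; rewrite inE.
  have /integrableP[_] := Lfun2_integrable_sqr l2f; apply: le_lt_trans.
  apply: ge0_le_integral => //=.
  - by move=> x _; rewrite lee_fin sqr_ge0.
  - apply/measurable_EFinP/measurable_funX.
    by move: l2f; rewrite inE => /andP[]; rewrite inE.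
  - apply/measurable_EFinP/measurableT_comp => //; apply/measurable_funX.
    by move: l2f; rewrite inE => /andP[]; rewrite inE.
  - by move=> x _; rewrite lee_fin ler_norm.
apply/andP; split; rewrite inE//= /finite_norm unlock /Lnorm.
apply: poweR_lty; under eq_integral => x _ do rewrite /= powR_mulrn ?real_normK
  ?num_real//.
exact: f2.
Qed.

Lemma L2_measurable f : f \in Lfun m 2%:E -> measurable_fun [set: T] f.
Proof. by case/L2P. Qed.

Lemma L2_integrable_mul f g : f \in Lfun m 2%:E -> g \in Lfun m 2%:E ->
  m.-integrable [set: T] (EFin \o (fun x => f x * g x)).
Proof. by move=> l2f l2g; apply/Lfun1_integrable; exact: Lfun2_mul_Lfun1. Qed.

Lemma Rintegral_sqrE f : \int[m]_x (f x * f x) = fine (\int[m]_x (f x ^+ 2)%:E).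
Proof. by rewrite /Rintegral; under eq_integral do rewrite -expr2. Qed.

Lemma L2_hnorm2 (f : hl2 m) : hnorm2 f = fine (\int[m]_x (f x ^+ 2)%:E).
Proof. exact: Rintegral_sqrE. Qed.

Lemma L2_hnorm2E (f : hl2 m) : hmem (hl2 m) f ->
  (hnorm2 f)%:E = (\int[m]_x (f x ^+ 2)%:E)%E.
Proof.
move=> /L2P[mf f2]; rewrite L2_hnorm2 fineK// ge0_fin_numE//.
by apply: integral_ge0 => x _; rewrite lee_fin sqr_ge0.
Qed.

Lemma L2_hnorm2_eq0 (f : hl2 m) : hmem (hl2 m) f ->
  hnorm2 f = 0 <-> f = (fun=> 0) %[ae m].
Proof.
move=> /[dup] l2f /L2P[mf f2].
have mf2 : measurable_fun [set: T] (fun x => (f x ^+ 2)%:E).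
  by apply/measurable_EFinP; exact: measurable_funX.
have h := @ae_eq_integral_abs _ _ _ m _ measurableT _ mf2.
have E : (\int[m]_x `|(f x ^+ 2)%:E| = (hnorm2 f)%:E)%E.
  rewrite L2_hnorm2E//; apply: eq_integral => x _.
  by rewrite gee0_abs// lee_fin sqr_ge0.
split=> [f0|f0].
  have /h : (\int[m]_x `|(f x ^+ 2)%:E| = 0)%E by rewrite E f0.
  by apply: filterS => x /(_ I)/= [] /eqP; rewrite sqrf_eq0 => /eqP + _.
apply/eqP; rewrite -eqe -E; apply/eqP/h.
by move: f0; apply: filterS => x /= /(_ I) -> _; rewrite expr0n.
Qed.

Lemma integrable_RZ c f : m.-integrable [set: T] (EFin \o f) ->
  m.-integrable [set: T] (EFin \o (fun x => c * f x)).
Proof. by move=> /(integrableZl measurableT c). Qed.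

Lemma integrable_RD f g : m.-integrable [set: T] (EFin \o f) ->
  m.-integrable [set: T] (EFin \o g) ->
  m.-integrable [set: T] (EFin \o (fun x => f x + g x)).
Proof. by move=> mf mg; have := integrableD measurableT mf mg. Qed.

Lemma hl2_prehilbert : prehilbert (hl2 m).
Proof.
have [l0 lP] : submod_closed (Lfun m 2%:E).
  by apply: Lfun_submod_closed; rewrite lee1n.
split.
- exact: l0.
- by move=> c f g; exact: lP.
- by move=> f g _ _; apply: eq_Rintegral => x _; rewrite mulrC.
- move=> c f g h lf lg lh /=.
  have ifh := L2_integrable_mul lf lh; have igh := L2_integrable_mul lg lh.
  rewrite -RintegralZl// -RintegralD//.
    by apply: eq_Rintegral => x _; rewrite /= mulrDl -mulrA.
  exact: integrable_RZ.
- by move=> f _; apply: Rintegral_ge0 => x _; rewrite /= -expr2 sqr_ge0.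
Qed.

Lemma L2_ae_eq (f g : hl2 m) : hmem (hl2 m) f -> hmem (hl2 m) g ->
  hnorm2 (f - g) = 0 <-> f = g %[ae m].
Proof.
move=> lf lg; rewrite L2_hnorm2_eq0; last exact: (hmemB hl2_prehilbert).
split; apply: filterS => x /(_ I) h _.
  by apply/eqP; rewrite -subr_eq0; apply/eqP.
by rewrite fctE h subrr.
Qed.

Lemma subsequence_gap (u : nat -> hl2 m) (e : nat -> R) : hcauchy u ->
  (forall k, 0 < e k) ->
  exists s : nat -> nat, (forall k, (k <= s k)%N) /\
    (forall k, (s k <= s k.+1)%N) /\
    forall k, hnorm2 (u (s k.+1) - u (s k)) < e k.
Proof.
move=> cu e0.
have /choice[N hN] k := cu _ (e0 k).
pose s := fix s k := if k is k'.+1 then maxn (maxn (s k') k) (N k) else N 0%N.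
have sN k : (N k <= s k)%N by case: k => //= k; rewrite leq_maxr.
have ss k : (s k <= s k.+1)%N by rewrite /= -maxnA leq_maxl.
exists s; split; last split => // k.
  by case=> //= k; rewrite !leq_max leqnn orbT.
by apply: hN => //; rewrite (leq_trans (sN k)).
Qed.

Lemma riesz_fischer (u : nat -> hl2 m) : (forall n, hmem (hl2 m) (u n)) ->
  hcauchy u -> exists l, hconv u l.
Proof.
move=> lu cu; have pH := hl2_prehilbert.
(* With squared gaps below 8^-k, the weighted sum [g] of 4^k |v_{k+1} - v_k|^2 has integral at most
   the sum of 2^-k. Where [g] is finite, |v_{k+1} - v_k| is at most (g + 1) 2^-k, so the sequence
   converges there. *)
have e0 k : 0 < (8 ^+ k)^-1 :> R by rewrite invr_gt0 exprn_gt0.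
have [s [ks [ss hs]]] := subsequence_gap cu e0.
pose v k := u (s k); have lv k : hmem (hl2 m) (v k) by exact: lu.
have mv k : measurable_fun setT (v k) by exact: L2_measurable (lv k).
pose dv k : hl2 m := v k.+1 - v k.
have ldv k : hmem (hl2 m) (dv k) by exact: (hmemB pH).
have mdv k : measurable_fun setT (dv k) by exact: L2_measurable (ldv k).
pose g x := (\sum_(0 <= k <oo) (4 ^+ k * dv k x ^+ 2)%:E)%E.
have t0 k x : (0 <= (4 ^+ k * dv k x ^+ 2)%:E)%E.
  by rewrite lee_fin mulr_ge0 ?sqr_ge0 ?exprn_ge0//.
have mt k : measurable_fun setT (fun x => (4 ^+ k * dv k x ^+ 2)%:E).
  by apply/measurable_EFinP/measurable_funM => //; exact: measurable_funX.
have mg : measurable_fun setT g.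
  by apply: (@ge0_emeasurable_sum _ _ _ _ _ predT) => // k x _ _; exact: t0.
have gfin : (\int[m]_x g x < +oo)%E.
  rewrite /g integral_nneseries//.
  apply: (@le_lt_trans _ _ (\sum_(0 <= k <oo) (2 / (2 ^ (k + 1))%:R)%:E)%E).
    apply: lee_nneseries => [k _ _|k _].
      by apply: integral_ge0 => x _; exact: t0.
    under eq_integral do rewrite EFinM.
    rewrite ge0_integralZl//.
    - rewrite -L2_hnorm2E// -EFinM lee_fin -ler_pdivlMl ?exprn_gt0//.
      rewrite (le_trans (ltW (hs k)))// addn1 expnS natrM invfM mulVKf//.
      rewrite natrX -invfM -exprMn lef_pV2 ?posrE ?exprn_gt0//.
      by apply: lerXn2r; rewrite ?nnegrE// -natrM ler_nat.
    - by apply/measurable_EFinP; exact: measurable_funX.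
    - by move=> x _; rewrite lee_fin sqr_ge0.
  by have /cvg_lim -> := @cvg_geometric_eseries_half R 2 0; rewrite ?ltry.
have g0 x : (0 <= g x)%E by apply: nneseries_ge0 => k _ _; exact: t0.
pose A := [set x | (g x < +oo)%E].
have mA : measurable A.
  by rewrite -[A]setTI; exact: emeasurable_fun_infty_o.
(* Cutting off outside [A], whose complement is null, makes the sequence converge at every point, so
   the limit is measurable. *)
pose w k x := v k x * \1_A x.
have mw k : measurable_fun setT (w k).
  by apply: measurable_funM => //; exact: measurable_indic.
have cw x : cvgn (w ^~ x).
  have [xA|xA] := pselect (A x); last first.
    rewrite (_ : w ^~ x = fun=> 0); first exact: is_cvg_cst.
    by apply/funext => k; rewrite /w indicE memNset// mulr0.
  have -> : w ^~ x = fun k => v 0%N x + series (fun j => dv j x) k.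
    apply/funext => k; rewrite /w indicE mem_set// mulr1 /series/=.
    by rewrite telescope_sumr// subrKC.
  apply: is_cvgD; first exact: is_cvg_cst.
  apply: normed_cvg.
  set G := fine (g x) + 1.
  apply: (@series_le_cvg _ _ (geometric G (2^-1))) => [k|k|k|].
  - exact: normr_ge0.
  - by rewrite /geometric/= mulr_ge0// ?exprn_ge0// addr_ge0// fine_ge0.
  - rewrite /geometric/= exprVn ler_pdivlMr ?exprn_gt0//.
    have hG : 4 ^+ k * dv k x ^+ 2 <= fine (g x).
      rewrite -lee_fin fineK ?ge0_fin_numE//.
      apply: le_trans (nneseries_lim_ge k.+1 (fun i _ _ => t0 i x)).
      by rewrite big_nat_recr//= leeDr// sume_ge0.
    have : (`|dv k x| * 2 ^+ k) ^+ 2 <= fine (g x).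
      rewrite (le_trans _ hG)// exprMn real_normK ?num_real// mulrC.
      by rewrite -exprM mulnC exprM -(natrX _ 2 2).
    by apply: le_add1_of_sqr; rewrite mulr_ge0.
  - by apply: is_cvg_geometric_series; rewrite ger0_norm ?invf_lt1//; lra.
pose F x := limn (w ^~ x).
have wF x : w ^~ x @ \oo --> F x by exact: cw.
have mF : measurable_fun setT F by apply: (measurable_fun_cvg mw) => x _; exact: wF.
have aeA : {ae m, forall x, A x}.
  have ig : m.-integrable setT g.
    apply/integrableP; split => //; apply: le_lt_trans gfin.
    by apply: ge0_le_integral => //= [|x _]; [exact: measurableT_comp|rewrite gee0_abs].
  have := integrable_ae measurableT ig.
  by apply: filterS => x /(_ I); rewrite ge0_fin_numE.
have key e : 0 < e -> exists N, forall n, (N <= n)%N ->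
    (\int[m]_x ((u n x - F x) ^+ 2)%:E <= e%:E)%E.
  move=> ep; have [N hN] := cu e ep; exists N => n Nn.
  pose h k x := (((u n x - w k x) ^+ 2)%:E)%E.
  have mun : measurable_fun setT (u n) by exact: L2_measurable (lu n).
  have mh k : measurable_fun setT (h k).
    by apply/measurable_EFinP/measurable_funX/measurable_funB.
  have h0 k x : (0 <= h k x)%E by rewrite lee_fin sqr_ge0.
  (* Fatou's lemma in [k] with [n] fixed: the integrals of |u_n - w_k|^2 are controlled by the
     Cauchy property once [k] is large. *)
  rewrite [leLHS](_ : _ = \int[m]_x limn_einf (h ^~ x))%E; last first.
    apply: eq_integral => x _; apply/esym; apply: (cvg_limn_einf_sup _).1.
    apply/cvg_EFin; first exact: nearW.
    pose dw k := u n x - w k x.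
    have cdw : dw k @[k --> \oo] --> u n x - F x.
      by apply: cvgB => //; exact: cvg_cst.
    have := cvgM cdw cdw; exact.
  apply: (le_trans (fatou _ _ _ _)) => //.
  rewrite limn_einf_lim; apply: lime_le; first exact: is_cvg_einfs.
  apply: nearW => k.
  apply: (@le_trans _ _ (\int[m]_x h (maxn N k) x)%E).
    by apply: ereal_inf_lbound; exists (maxn N k) => //=; exact: leq_maxr.
  have -> : (\int[m]_x h (maxn N k) x = (hnorm2 (u n - v (maxn N k)))%:E)%E.
    have lB := hmemB pH (lu n) (lv (maxn N k)).
    rewrite L2_hnorm2E//; apply: ge0_ae_eq_integral => //.
    - by apply/measurable_EFinP/measurable_funX; exact: L2_measurable lB.
    - by move=> x _; rewrite lee_fin sqr_ge0.
    - move: aeA; apply: filterS => x xA _.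
      by rewrite /h /w indicE mem_set// mulr1.
  rewrite lee_fin ltW// hN// (leq_trans _ (ks _))// leq_maxl//.
have lB n e : (\int[m]_x ((u n x - F x) ^+ 2)%:E <= e%:E)%E ->
    hmem (hl2 m) (u n - F).
  move=> h; apply/L2P; split; last by rewrite (le_lt_trans h)// ltry.
  by apply: measurable_funB => //; exact: L2_measurable (lu n).
exists F; split => [|e ep].
  have [N /(_ N (leqnn _)) /lB hN] := key 1 ltr01.
  have -> : F = u N - (u N - F) :> hl2 m by rewrite opprB addrC subrK.
  exact: (hmemB pH).
have [N hN] := key _ (divr_gt0 ep (ltr0n _ 2)).
exists N => n /hN h; rewrite -lte_fin L2_hnorm2E; last exact: lB h.
by rewrite (le_lt_trans h)// lte_fin; lra.
Qed.

Lemma hl2_hilbert : hilbert (hl2 m).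
Proof. by split; [exact: hl2_prehilbert|exact: riesz_fischer]. Qed.

End L2.

(** * Integrals against kernels and product measures *)

Section integral_extension.
Context {d} {T : measurableType d} {R : realType}.
Variables (m : {measure set T -> \bar R}) (I : (T -> \bar R) -> \bar R).
Import HBNNSimple.
Local Open Scope ereal_scope.

(** The standard extension from indicators through simple functions to monotone limits. It
    identifies iterated integrals, and integrals against [rho], with integrals against the measures
    they define. *)
Lemma ge0_integral_ext (f : T -> \bar R) :
  (forall A, measurable A -> I (fun x => (\1_A x)%:E) = m A) ->
  (forall c g, (0 <= c)%R -> measurable_fun [set: T] g -> (forall x, 0 <= g x) ->
    I (fun x => c%:E * g x) = c%:E * I g) ->
  (forall g h, measurable_fun [set: T] g -> measurable_fun [set: T] h ->
    (forall x, 0 <= g x) -> (forall x, 0 <= h x) ->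
    I (fun x => g x + h x) = I g + I h) ->
  (forall (g : nat -> T -> \bar R), (forall n, measurable_fun [set: T] (g n)) ->
    (forall n x, 0 <= g n x) -> (forall x, {homo g ^~ x : p n / (p <= n)%N >-> p <= n}) ->
    I (fun x => limn (g ^~ x)) = limn (fun n => I (g n))) ->
  measurable_fun [set: T] f -> (forall x, 0 <= f x) -> I f = \int[m]_x f x.
Proof.
move=> I1 IZ ID Ilim mf f0.
have I0 : I (fun=> 0) = 0.
  transitivity (I (fun x => (\1_set0 x)%:E)); last by rewrite I1// measure0.
  congr I; apply/funext => x.
  by rewrite indicE in_set0.
have Isum (J : Type) (s : seq J) (g : J -> T -> \bar R) :
    (forall j, measurable_fun [set: T] (g j)) -> (forall j x, 0 <= g j x) ->
    I (fun x => \sum_(j <- s) g j x) = \sum_(j <- s) I (g j).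
  move=> mg g0; elim: s => [|j s ih].
    by rewrite big_nil -[RHS]I0; congr I; apply/funext => x; rewrite big_nil.
  rewrite big_cons -ih -ID//.
  - by congr I; apply/funext => x; rewrite big_cons.
  - exact: emeasurable_sum.
  - by move=> x; apply: sume_ge0.
have Is (h : {nnsfun T >-> R}) : I (EFin \o h) = integral m [set: T] (EFin \o h).
  (* The maximum with 0 changes no value of a nonnegative simple function, but makes every
     coefficient nonnegative without a condition on [y]. *)
  have -> : EFin \o h = fun x => \sum_(y <- fset_set (range h))
     (Num.max y 0)%:E * (\1_(h @^-1` [set y]) x)%:E.
    apply/funext => x /=; rewrite fimfunE fsbig_finite//= -sumEFin.
    rewrite big_seq [RHS]big_seq; apply: eq_bigr => y.
    rewrite in_fset_set// => /set_mem[z _ <-].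
    by rewrite EFinM (max_idPl _).
  have m1 y : measurable_fun [set: T] (fun x => (\1_(h @^-1` [set y]) x)%:E : \bar R).
    by apply/measurable_EFinP; exact: measurable_indic.
  have p0 (y : R) : (0 <= Num.max y 0)%R by rewrite le_max lexx orbT.
  rewrite Isum; last 2 first.
  - by move=> y; exact: measurable_funeM.
  - by move=> y x; rewrite -EFinM lee_fin mulr_ge0.
  rewrite ge0_integral_sum//; last 2 first.
  - by move=> y; exact: measurable_funeM.
  - by move=> y x _; rewrite -EFinM lee_fin mulr_ge0.
  apply: eq_bigr => y _; rewrite IZ//.
  by rewrite I1// ge0_integralZl// ?lee_fin// integral_indic// setIT.
pose h := nnsfun_approx measurableT mf.
have hf x : limn (fun n => (h n x)%:E) = f x.
  by apply/cvg_lim => //; apply: cvg_nnsfun_approx.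
have -> : f = fun x => limn (fun n => (h n x)%:E) by apply/funext => x.
rewrite (Ilim (fun n => EFin \o h n)); last 3 first.
- by move=> n; exact/measurable_EFinP.
- by move=> n x; rewrite lee_fin.
- by move=> x p n pn; rewrite lee_fin; exact/lefP/nd_nnsfun_approx.
rewrite monotone_convergence//; last 3 first.
- by move=> n; exact/measurable_EFinP.
- by move=> n x _; rewrite lee_fin.
- by move=> x _ p n pn; rewrite lee_fin; exact/lefP/nd_nnsfun_approx.
by congr (limn _); apply/funext => n; exact: Is.
Qed.

End integral_extension.

Section kernel_measure_integral.
Context {d1 d2} {X : measurableType d1} {Y : measurableType d2} {R : realType}.
Variables (m : {sigma_finite_measure set X -> \bar R}) (k : R.-pker X ~> Y).
Local Notation nu := (kernel_measure m k).
Local Open Scope ereal_scope.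

Lemma measurable_kernel_section (f : X * Y -> \bar R) x :
  measurable_fun [set: X * Y] f -> measurable_fun [set: Y] (fun y => f (x, y)).
Proof. by move=> mf; apply: measurableT_comp => //; exact: measurable_pair1. Qed.

Lemma ge0_integral_kernel (f : X * Y -> \bar R) :
  measurable_fun [set: X * Y] f -> (forall z, 0 <= f z) ->
  \int[nu]_z f z = \int[m]_x \int[k x]_y f (x, y).
Proof.
move=> mf f0.
have mi (g : X * Y -> \bar R) : measurable_fun [set: X * Y] g ->
    (forall z, 0 <= g z) -> measurable_fun [set: X] (fun x => \int[k x]_y g (x, y)).
  by move=> mg g0; exact: measurable_fun_integral_finite_kernel.
have ms (g : X * Y -> \bar R) x : measurable_fun [set: X * Y] g ->
   measurable_fun [set: Y] (fun y => g (x, y)).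
  exact: measurable_kernel_section.
symmetry; apply: (@ge0_integral_ext _ _ _ _
  (fun f => \int[m]_x \int[k x]_y f (x, y))) => //.
- move=> A mA; apply: eq_integral => x _.
  rewrite -[RHS]mul1e -integral_cst; last exact: measurable_xsection.
  rewrite [RHS]integral_mkcond; apply: eq_integral => y _.
  by rewrite patchE indicE mem_xsection; case: ifP.
- move=> c g c0 mg g0; rewrite -ge0_integralZl//; last 2 first.
  + exact: mi.
  + by move=> x _; exact: integral_ge0.
  apply: eq_integral => x _; rewrite ge0_integralZl//.
  exact: ms.
- move=> g h mg mh g0 h0; rewrite -ge0_integralD//; try exact: mi;
    try by move=> x _; exact: integral_ge0.
  by apply: eq_integral => x _; rewrite ge0_integralD//; exact: ms.
- move=> g mg g0 ndg; rewrite -monotone_convergence//; last 3 first.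
  + by move=> n; exact: mi.
  + by move=> n x _; exact: integral_ge0.
  + move=> x _ p n pn; apply: ge0_le_integral => //; try exact: ms.
    by move=> y _; exact: ndg.
  apply: eq_integral => x _; rewrite -monotone_convergence//.
  by move=> n; exact: ms.
Qed.

Lemma measurable_integral_kernel (f : X * Y -> \bar R) :
  measurable_fun [set: X * Y] f ->
  measurable_fun [set: X] (fun x => \int[k x]_y f (x, y)).
Proof.
move=> mf.
have mip := @measurable_fun_integral_finite_kernel _ _ _ _ _ _ k
  (fun z => funepos_ge0 f z) (measurable_funepos mf).
have min := @measurable_fun_integral_finite_kernel _ _ _ _ _ _ k
  (fun z => funeneg_ge0 f z) (measurable_funeneg mf).
have := emeasurable_funB mip min.
congr measurable_fun; apply/funext => x; rewrite [RHS]integralE.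
by congr (_ - _); apply: eq_integral => y _; rewrite !unlock.
Qed.

Lemma integral_kernel (f : X * Y -> \bar R) : nu.-integrable [set: X * Y] f ->
  \int[nu]_z f z = \int[m]_x \int[k x]_y f (x, y).
Proof.
move=> /[dup] inf /integrableP[mf _]; rewrite integralE.
have mp : measurable_fun [set: X * Y] f^\+ by exact: measurable_funepos.
have mn : measurable_fun [set: X * Y] f^\- by exact: measurable_funeneg.
have integrable_fiber g : measurable_fun [set: X * Y] g -> (forall z, 0 <= g z) ->
    nu.-integrable [set: X * Y] g ->
    m.-integrable [set: X] (fun x => \int[k x]_y g (x, y)).
  move=> mg g0 /integrable_lty ig; apply/integrableP; split.
    exact: measurable_integral_kernel.
  under eq_integral => x _ do rewrite gee0_abs ?integral_ge0//.
  by rewrite -ge0_integral_kernel// ig.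
rewrite !ge0_integral_kernel// -integralB//.
- apply: eq_integral => x _; rewrite [RHS]integralE.
  by congr (_ - _); apply: eq_integral => y _; rewrite !unlock.
- by apply: integrable_fiber => //; exact: integrable_funepos.
- by apply: integrable_fiber => //; exact: integrable_funeneg.
Qed.

End kernel_measure_integral.

Section cons_measure_integral.
Context {d} {T : measurableType d} {R : realType} (n : nat).
Variables (m1 : {sigma_finite_measure set T -> \bar R})
  (m2 : {sigma_finite_measure set (n.-tuple T) -> \bar R}).
Local Notation cm := (cons_measure m1 m2).
Local Open Scope ereal_scope.
Implicit Type f : n.+1.-tuple T -> \bar R.

Definition tcons (z : T * n.-tuple T) : n.+1.-tuple T := cons_tuple z.1 z.2.

Lemma measurable_tcons : measurable_fun [set: T * n.-tuple T] tcons.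
Proof. by apply: measurable_cons. Qed.

Lemma cons_integral_pushforward f :
  \int[cm]_t f t = \int[pushforward (m1 \x m2) tcons]_t f t.
Proof. by []. Qed.

Lemma ge0_integral_cons f : measurable_fun [set: n.+1.-tuple T] f ->
  (forall t, 0 <= f t) -> \int[cm]_t f t = \int[m1]_x \int[m2]_t f (tcons (x, t)).
Proof.
move=> mf f0; have mt := measurable_tcons.
rewrite cons_integral_pushforward ge0_integral_pushforward//=.
by rewrite preimage_setT fubini_tonelli1//; exact: measurableT_comp.
Qed.

Lemma integrable_cons f : cm.-integrable [set: n.+1.-tuple T] f ->
  (m1 \x m2).-integrable [set: T * n.-tuple T] (f \o tcons).
Proof.
move=> /integrableP[mf finf]; have mt := measurable_tcons.
apply/integrableP; split; first exact: measurableT_comp.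
apply: le_lt_trans finf; rewrite cons_integral_pushforward.
by rewrite ge0_integral_pushforward//=; exact: measurableT_comp.
Qed.

Lemma integral_cons f : cm.-integrable [set: n.+1.-tuple T] f ->
  \int[cm]_t f t = \int[m1 \x m2]_z f (tcons z).
Proof.
move=> /[dup] /integrable_cons inf /integrableP[mf _].
have mt := measurable_tcons.
by rewrite cons_integral_pushforward integral_pushforward//= preimage_setT.
Qed.

(** Splitting off the head is a measurable inverse of [tcons], so a null set of pairs is carried to
    a null set of tuples. *)
Lemma ae_cons (P : n.+1.-tuple T -> Prop) :
  {ae m1 \x m2, forall z, P (tcons z)} -> {ae cm, forall t, P t}.
Proof.
move=> [N [mN N0 NP]].
pose g (t : n.+1.-tuple T) : T * n.-tuple T := (thead t, [tuple of behead t]).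
have mg : measurable_fun setT g.
  by apply/measurable_fun_pairP; split; [exact: measurable_tnth|exact: measurable_behead].
have gK z : g (tcons z) = z.
  by case: z => x t; rewrite /g /tcons/= theadE; congr pair; exact: val_inj.
have tK t : tcons (g t) = t by rewrite /tcons/= [RHS]tuple_eta; exact: val_inj.
exists (g @^-1` N); split.
- by rewrite -[X in measurable X]setTI; exact: mg.
- rewrite -[LHS]/((m1 \x m2)%E (tcons @^-1` (g @^-1` N))).
  suff -> : tcons @^-1` (g @^-1` N) = N by [].
  by apply/seteqP; split => z /=; rewrite gK.
- by move=> t /= Pt; apply: NP => /=; rewrite tK.
Qed.

End cons_measure_integral.

Section weighted_measure.
Context {d} {T : measurableType d} {R : realType}.
Variables (m : {measure set T -> \bar R}) (p : T -> R).
Hypotheses (mp : measurable_fun [set: T] p) (p0 : forall x, 0 <= p x).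

Definition weighted (A : set T) : \bar R := (\int[m]_(x in A) (p x)%:E)%E.

Let weighted0 : weighted set0 = 0. Proof. exact: integral_set0. Qed.
Let weighted_ge0 A : (0 <= weighted A)%E.
Proof. by apply: integral_ge0 => x _; rewrite lee_fin. Qed.
Let weighted_sigma_additive : semi_sigma_additive weighted.
Proof.
apply: semi_sigma_additive_nng_induced => [|x]; last by rewrite lee_fin.
exact/measurable_EFinP.
Qed.

(** The structure depends on the proofs [mp] and [p0], so it is packed by hand for each density. *)
Definition weighted_mixin := isMeasure.Build _ _ _ weighted
  weighted0 weighted_ge0 weighted_sigma_additive.

Definition weighted_measure : {measure set T -> \bar R} :=
  HB.pack weighted weighted_mixin.

End weighted_measure.

(** * Total families in L^2 *)

Section pi_system_null.
Context {d} {T : measurableType d} {R : realType}.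
Variable m : {measure set T -> \bar R}.
Local Open Scope ereal_scope.

(** The measures with densities f^+ and f^- are finite on the pi-system and agree there, hence agree
    on all measurable sets, so f has zero integral over each of them. *)
Lemma ae_eq0_pi_system (G : set (set T)) (g : nat -> set T) (f : T -> R) :
  measurable = <<s G >> -> setI_closed G -> (forall i, G (g i)) ->
  \bigcup_k (g k) = [set: T] ->
  m.-integrable [set: T] (EFin \o f) ->
  (forall A, G A -> \int[m]_(x in A) (f x)%:E = 0) ->
  f = (fun=> 0%R) %[ae m].
Proof.
move=> mG IG Gg gT /[dup] intf /integrableP[mf _] f0.
have mfr : measurable_fun [set: T] f by exact/measurable_EFinP.
pose p x := Num.max (f x) 0%R; pose n x := Num.max (- f x)%R 0%R.
have mp : measurable_fun [set: T] p by exact: measurable_maxr.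
have mn : measurable_fun [set: T] n.
  by apply: measurable_maxr => //; exact: measurableT_comp.
have p0 x : (0 <= p x)%R by rewrite le_max lexx orbT.
have n0 x : (0 <= n x)%R by rewrite le_max lexx orbT.
have posE A : \int[m]_(x in A) (EFin \o f)^\+ x = weighted m p A.
  apply: eq_integral => x _.
  by rewrite funeposE /= -EFin_max.
have negE A : \int[m]_(x in A) (EFin \o f)^\- x = weighted m n A.
  apply: eq_integral => x _.
  by rewrite funenegE /= -EFin_max.
have mGm A : G A -> measurable A by move=> GA; rewrite mG; exact: sub_sigma_algebra.
have finp A : measurable A -> weighted m p A \is a fin_num.
  move=> mA; rewrite -posE; apply: integrable_fin_num => //.
  by apply: integrable_funepos => //; exact: integrableS intf.
have finn A : measurable A -> weighted m n A \is a fin_num.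
  move=> mA; rewrite -negE; apply: integrable_fin_num => //.
  by apply: integrable_funeneg => //; exact: integrableS intf.
have key A : measurable A -> weighted m p A = weighted m n A.
  apply: (@measure_unique _ _ _ G g mG IG Gg gT (weighted_measure m mp p0)
    (weighted_measure m mn n0)) => [B GB|k].
    have := f0 B GB; rewrite integralE posE negE.
    have Hp := finp B (mGm B GB); have Hn := finn B (mGm B GB).
    rewrite -(fineK Hp) -(fineK Hn) -EFinB => -[/subr0_eq E].
    by rewrite -[LHS](fineK Hp) E (fineK Hn).
  by rewrite -ge0_fin_numE; [exact/finp/mGm|]; apply: integral_ge0 => x _;
    rewrite lee_fin.
have : ae_eq m [set: T] (EFin \o f) (fun=> 0).
  apply: integral_ae_eq => // E _ mE; rewrite integral0 integralE posE negE.
  by rewrite key// subee// finn.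
by apply: filterS => x /(_ I) [->].
Qed.

End pi_system_null.

Section totality.
Context {R : realType}.
Local Open Scope ereal_scope.

(** Formulated with the orthogonal complement because this version can be applied in one variable
    while the others are frozen. *)
Definition total {d} {T : measurableType d} (m : {measure set T -> \bar R})
    (E : set (T -> R)) : Prop :=
  forall F, F \in Lfun m 2%:E -> (forall e, E e -> \int[m]_x (F x * e x) = 0)%R ->
    F = (fun=> 0%R) %[ae m].

Section swap.
Context {d1 d2} {T1 : measurableType d1} {T2 : measurableType d2}.
Variables (m1 : {sigma_finite_measure set T1 -> \bar R})
  (m2 : {sigma_finite_measure set T2 -> \bar R}).

Lemma integrable_swap (f : T1 * T2 -> \bar R) :
  (m1 \x m2).-integrable [set: T1 * T2] f ->
  (m2 \x m1).-integrable [set: T2 * T1] (f \o swap_pair).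
Proof.
move=> /[dup] intf /integrableP[mf finf].
have mfs : measurable_fun [set: T2 * T1] (f \o swap_pair).
  by apply: measurableT_comp => //; exact: measurable_swap.
by apply/integrable12ltyP => //=; apply/integrable21ltyP.
Qed.

Lemma integral_swap (f : T1 * T2 -> \bar R) :
  (m1 \x m2).-integrable [set: T1 * T2] f ->
  \int[m2 \x m1]_z (f (swap_pair z)) = \int[m1 \x m2]_z f z.
Proof.
move=> /[dup] /integrable_swap intfs intf.
by rewrite -(integral12_prod_meas1 intfs) -(integral21_prod_meas1 intf).
Qed.

Lemma L2_swap (f : T1 * T2 -> R) : f \in Lfun (m1 \x m2) 2%:E ->
  f \o swap_pair \in Lfun (m2 \x m1) 2%:E.
Proof.
move=> l2f; have [mf f2] := (L2P _ _).1 l2f.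
apply/L2P; split.
  by apply: measurableT_comp => //; exact: measurable_swap.
by rewrite (integral_swap (Lfun2_integrable_sqr l2f)).
Qed.

Lemma L2_tensor (a : T1 -> R) (b : T2 -> R) :
  a \in Lfun m1 2%:E -> b \in Lfun m2 2%:E ->
  (fun z => a z.1 * b z.2)%R \in Lfun (m1 \x m2) 2%:E.
Proof.
move=> la lb.
have [ma a2] := (L2P _ _).1 la; have [mb b2] := (L2P _ _).1 lb.
have ma2 : measurable_fun setT (fun x => (a x ^+ 2)%:E).
  by apply/measurable_EFinP; exact: measurable_funX.
have mb2 : measurable_fun setT (fun x => (b x ^+ 2)%:E).
  by apply/measurable_EFinP; exact: measurable_funX.
have mab : measurable_fun [set: T1 * T2] (fun z => a z.1 * b z.2)%R.
  by apply: measurable_funM; exact: measurableT_comp.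
apply/L2P; split => //; rewrite fubini_tonelli1//; last 2 first.
- by apply/measurable_EFinP; exact: measurable_funX.
- by move=> z; rewrite lee_fin sqr_ge0.
rewrite (eq_integral (fun x => (a x ^+ 2)%:E * \int[m2]_y (b y ^+ 2)%:E)); last first.
  move=> x _; rewrite /fubini_F -ge0_integralZl//; last 2 first.
  - by move=> y _; rewrite lee_fin sqr_ge0.
  - by rewrite lee_fin sqr_ge0.
  by apply: eq_integral => y _; rewrite /= exprMn EFinM.
rewrite ge0_integralZr//; last 2 first.
- by move=> x _; rewrite lee_fin sqr_ge0.
- by apply: integral_ge0 => *; rewrite lee_fin sqr_ge0.
have h0 : 0 <= \int[m1]_x (a x ^+ 2)%:E.
  by apply: integral_ge0 => *; rewrite lee_fin sqr_ge0.
rewrite -[X in X * _]fineK ?ge0_fin_numE//.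
rewrite -[X in _ * X]fineK ?ltry// ge0_fin_numE//.
by apply: integral_ge0 => *; rewrite lee_fin sqr_ge0.
Qed.

End swap.

Section partial.
Context {d1 d2} {T1 : measurableType d1} {T2 : measurableType d2}.
Variables (m1 : {sigma_finite_measure set T1 -> \bar R})
  (m2 : {sigma_finite_measure set T2 -> \bar R}).

(** Pairing with [b] in the second variable is the adjoint of a |-> a (x) b. It reduces
    orthogonality to a product to orthogonality in the first factor. *)
Lemma L2_partial (f : T1 * T2 -> R) (b : T2 -> R) :
  f \in Lfun (m1 \x m2) 2%:E -> b \in Lfun m2 2%:E ->
  let g x := (\int[m2]_y (f (x, y) * b y))%R in
  g \in Lfun m1 2%:E /\
  forall a, a \in Lfun m1 2%:E ->
    (\int[m1]_x (g x * a x) = \int[m1 \x m2]_z (f z * (a z.1 * b z.2)))%R.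
Proof.
move=> lf lb g.
have [mf f2] := (L2P _ _).1 lf; have [mb b2] := (L2P _ _).1 lb.
have mf2 : measurable_fun setT (fun z => (f z ^+ 2)%:E).
  by apply/measurable_EFinP; exact: measurable_funX.
have f20 z : 0 <= (f z ^+ 2)%:E by rewrite lee_fin sqr_ge0.
have mfb : measurable_fun setT (fun z : T1 * T2 => (f z * b z.2)%:E).
  by apply/measurable_EFinP/measurable_funM => //; exact: measurableT_comp.
have mg : measurable_fun setT g.
  have mi : measurable_fun setT (fun x => \int[m2]_y (f (x, y) * b y)%:E).
    have mip := @measurable_fun_fubini_tonelli_F _ _ _ _ _ m2 _
      (measurable_funepos mfb) (fun z => funepos_ge0 _ z).
    have min := @measurable_fun_fubini_tonelli_F _ _ _ _ _ m2 _
      (measurable_funeneg mfb) (fun z => funeneg_ge0 _ z).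
    have := emeasurable_funB mip min.
    congr measurable_fun; apply/funext => x; rewrite /fubini_F [RHS]integralE.
    by congr (_ - _); apply: eq_integral => y _; rewrite !unlock.
  exact: measurableT_comp mi.
have mfx x : measurable_fun setT (fun y => f (x, y)).
  by apply: measurableT_comp => //; exact: measurable_pair1.
pose S x := \int[m2]_y (f (x, y) ^+ 2)%:E.
have S0 x : 0 <= S x by exact: integral_ge0.
have mS : measurable_fun setT S by exact: (@measurable_fun_fubini_tonelli_F _ _
  _ _ _ m2 _ mf2 f20).
pose B := fine (\int[m2]_y (b y ^+ 2)%:E).
have B0 : (0 <= B)%R.
  by apply: fine_ge0; apply: integral_ge0 => *; rewrite lee_fin sqr_ge0.
(* Where [S x] is infinite the bound must be infinite too; [B] could be 0, and 0 times infinity is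
   0, so [B + 1] is used. *)
have CS x : (g x ^+ 2)%:E <= (B + 1)%:E * S x.
  have [Sx|Sx] := ltP (S x) +oo; last first.
    move: Sx; rewrite leye_eq => /eqP ->.
    by rewrite gt0_muley ?leey// lte_fin; lra.
  have lx : (fun y => f (x, y)) \in Lfun m2 2%:E by apply/L2P.
  have := hdot_CS (hl2_prehilbert m2) lx lb; rewrite !L2_hnorm2 -/B -/(S x) /= => h.
  rewrite -[S x]fineK ?ge0_fin_numE// -EFinM lee_fin (le_trans h)// mulrC.
  by rewrite ler_wpM2r ?fine_ge0//; lra.
have lg : g \in Lfun m1 2%:E.
  apply/L2P; split => //.
  apply: (@le_lt_trans _ _ (\int[m1]_x ((B + 1)%:E * S x))).
    apply: ge0_le_integral => //.
    - by move=> x _; rewrite lee_fin sqr_ge0.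
    - by apply/measurable_EFinP; exact: measurable_funX.
    - exact: measurable_funeM.
  rewrite ge0_integralZl//; last by rewrite lee_fin addr_ge0.
  move: f2; rewrite fubini_tonelli1//= -/S => f2.
  rewrite -[X in _ * X]fineK ?ltry// ge0_fin_numE//.
  by apply: integral_ge0 => x _; exact: S0.
split => // a la.
have intf : (m1 \x m2).-integrable setT
    (EFin \o (fun z => f z * (a z.1 * b z.2))%R).
  by apply: L2_integrable_mul => //; exact: L2_tensor.
rewrite /Rintegral -(integral12_prod_meas1 intf) /fubini_F; congr fine.
have aeS : {ae m1, forall x, S x < +oo}.
  have iS : m1.-integrable setT S.
    apply/integrableP; split => //.
    under eq_integral do rewrite gee0_abs//.
    by move: f2; rewrite fubini_tonelli1.
  have := integrable_ae measurableT iS.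
  by apply: filterS => x /(_ I); rewrite ge0_fin_numE.
apply: ae_eq_integral => //.
- by apply/measurable_EFinP/measurable_funM => //; exact: L2_measurable la.
- exact: (measurable_fubini_F intf).
- move: aeS; apply: filterS => x Sx _ /=.
  have lx : (fun y => f (x, y)) \in Lfun m2 2%:E by apply/L2P.
  have ifb := L2_integrable_mul lx lb.
  rewrite /g /Rintegral EFinM fineK; last exact: integrable_fin_num.
  rewrite muleC -integralZl//; apply: eq_integral => y _ /=.
  by rewrite -EFinM mulrCA.
Qed.

End partial.

Section tensor.
Context {d1 d2} {T1 : measurableType d1} {T2 : measurableType d2}.
Variables (m1 : {sigma_finite_measure set T1 -> \bar R})
  (m2 : {sigma_finite_measure set T2 -> \bar R}).
Variables (E1 : set (T1 -> R)) (E2 : set (T2 -> R)).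
Hypotheses (LE1 : forall e, E1 e -> e \in Lfun m1 2%:E)
  (LE2 : forall e, E2 e -> e \in Lfun m2 2%:E)
  (tE1 : total m1 E1) (tE2 : total m2 E2).

(** The factors are generalized one at a time: with e1 fixed, the partial pairing of f with e1 is
    orthogonal to [E2], hence null, so e2 may be any b; then the same is done in the first
    variable. *)
Lemma orthogonal_tensor (f : T1 * T2 -> R) : f \in Lfun (m1 \x m2) 2%:E ->
  (forall e1 e2, E1 e1 -> E2 e2 ->
    \int[m1 \x m2]_z (f z * (e1 z.1 * e2 z.2)) = 0)%R ->
  forall a b, a \in Lfun m1 2%:E -> b \in Lfun m2 2%:E ->
    (\int[m1 \x m2]_z (f z * (a z.1 * b z.2)) = 0)%R.
Proof.
move=> lf h.
have vanish d (T : measurableType d) (m : {measure set T -> \bar R}) (u v : T -> R) :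
    u = (fun=> 0%R) %[ae m] -> measurable_fun setT u -> measurable_fun setT v ->
    (\int[m]_x (u x * v x) = 0)%R.
  move=> u0 mu mv; rewrite /Rintegral (ae_eq_integral (cst 0))//.
  - by rewrite integral0.
  - by apply/measurable_EFinP; exact: measurable_funM.
  - by move: u0; apply: filterS => x /(_ I) -> _; rewrite mul0r.
have step e1 b : E1 e1 -> b \in Lfun m2 2%:E ->
    (\int[m1 \x m2]_z (f z * (e1 z.1 * b z.2)) = 0)%R.
  move=> Ee1 lb; have le1 := LE1 Ee1.
  have swapE b' : b' \in Lfun m2 2%:E ->
      (\int[m2 \x m1]_z ((f \o swap_pair) z * (b' z.1 * e1 z.2)) =
      \int[m1 \x m2]_z (f z * (e1 z.1 * b' z.2)))%R.
    move=> lb'; have i : (m1 \x m2).-integrable setT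
        (EFin \o (fun z => f z * (e1 z.1 * b' z.2))%R).
      by apply: L2_integrable_mul => //; exact: L2_tensor.
    rewrite /Rintegral -(integral_swap i); congr fine; apply: eq_integral => z _.
    by rewrite /= [(b' _ * _)%R]mulrC.
  have [lg hg] := L2_partial (L2_swap lf) le1.
  rewrite -swapE// -hg//; apply: vanish; [|exact: L2_measurable lg|exact:
    L2_measurable lb].
  apply: tE2 => // e2 Ee2; rewrite hg; last exact: LE2.
  by rewrite swapE; [exact: h|exact: LE2].
move=> a b la lb; have [lg hg] := L2_partial lf lb.
rewrite -hg//; apply: vanish; [|exact: L2_measurable lg|exact: L2_measurable la].
by apply: tE1 => // e1 Ee1; rewrite hg ?step//; exact: LE1.
Qed.

Lemma L2_indic d (T : measurableType d) (m : {measure set T -> \bar R}) A :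
  measurable A -> m A < +oo -> (\1_A : T -> R) \in Lfun m 2%:E.
Proof.
move=> mA Aoo; apply/L2P; split; first exact: measurable_indic.
under eq_integral => x _.
  rewrite (_ : (\1_A x ^+ 2)%R = \1_A x); first over.
  by rewrite indicE; case: (x \in A); rewrite ?expr1n ?expr0n.
by rewrite integral_indic// setIT.
Qed.

(** Products of indicators of sets of finite measure are among the tensors that f is orthogonal to.
    On a block of finite measure f is integrable with zero integral over every rectangle, and
    rectangles form a generating pi-system. *)
Lemma total_tensor : total (m1 \x m2)
  [set e | exists e1 e2, [/\ E1 e1, E2 e2 & e = (fun z => e1 z.1 * e2 z.2)%R]].
Proof.
move=> f lf h.
have {}h := @orthogonal_tensor f lf (fun e1 e2 E1e E2e =>
  h _ (ex_intro _ e1 (ex_intro _ e2 (And3 E1e E2e erefl)))).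
have [F F1 Foo] := sigma_finiteT m1; have [K K1 Koo] := sigma_finiteT m2.
have block i j : {ae m1 \x m2, forall z, F i z.1 -> K j z.2 -> f z = 0%R}.
  have [mF Fi] := Foo i; have [mK Kj] := Koo j.
  have mFK : measurable (F i `*` K j) by exact: measurableX.
  have l1 : (fun z => \1_(F i) z.1 * \1_(K j) z.2)%R \in Lfun (m1 \x m2) 2%:E.
    by apply: L2_tensor; exact: L2_indic.
  have intf := L2_integrable_mul lf l1.
  have : (fun z => f z * (\1_(F i) z.1 * \1_(K j) z.2))%R = (fun=> 0%R) %[ae m1 \x m2].
    apply: (@ae_eq0_pi_system _ _ _ _
      [set A1 `*` A2 | A1 in measurable & A2 in measurable] (fun=> setT)) => //.
    - exact: measurable_prod_measurableType.
    - move=> _ _ [A1 mA1 [A2 mA2 <-]] [B1 mB1 [B2 mB2 <-]].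
      exists (A1 `&` B1); first exact: measurableI.
      by exists (A2 `&` B2); [exact: measurableI|rewrite setXI].
    - by move=> _; exists setT => //; exists setT; rewrite ?setXTT.
    - by rewrite bigcup_const.
    - move=> _ [A1 mA1 [A2 mA2 <-]].
      have mA : measurable (A1 `*` A2) by exact: measurableX.
      rewrite integral_mkcond.
      have la : (\1_(F i `&` A1) : T1 -> R) \in Lfun m1 2%:E.
        apply: L2_indic; first exact: measurableI.
        by rewrite (le_lt_trans _ Fi)// le_measure ?inE//; exact: measurableI.
      have lb : (\1_(K j `&` A2) : T2 -> R) \in Lfun m2 2%:E.
        apply: L2_indic; first exact: measurableI.
        by rewrite (le_lt_trans _ Kj)// le_measure ?inE//; exact: measurableI.
      have i0 := L2_integrable_mul lf (L2_tensor la lb).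
      rewrite [LHS](_ : _ = \int[m1 \x m2]_z
          (f z * (\1_(F i `&` A1) z.1 * \1_(K j `&` A2) z.2))%:E).
        by rewrite -[LHS]fineK ?(integrable_fin_num _ i0)// [fine _]h.
      apply: eq_integral => -[x y] _; rewrite patchE classical_sets.in_setX !indicE.
      rewrite !classical_sets.in_setI /=.
      by do 4 case: (_ \in _); rewrite /= ?mulr1 ?mulr0 ?mul0r.
  apply: filterS => z /(_ I) + Fz Kz.
  by rewrite !indicE !mem_set// !mulr1.
have : {ae m1 \x m2, forall z, forall i j, F i z.1 -> K j z.2 -> f z = 0%R}.
  by apply: ae_foralln => i; exact: ae_foralln.
apply: filterS => z fz _.
have [i _ Fi] : (\bigcup_i F i) z.1 by rewrite -F1.
have [j _ Kj] : (\bigcup_j K j) z.2 by rewrite -K1.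
exact: fz Fi Kj.
Qed.

End tensor.
End totality.

Section cons_L2.
Context {d} {T : measurableType d} {R : realType} (n : nat).
Variables (m1 : {sigma_finite_measure set T -> \bar R})
  (m2 : {sigma_finite_measure set (n.-tuple T) -> \bar R}).
Local Notation cm := (cons_measure m1 m2).

Lemma L2_cons (F : n.+1.-tuple T -> R) : F \in Lfun cm 2%:E ->
  F \o @tcons _ T n \in Lfun (m1 \x m2)%E 2%:E.
Proof.
move=> /[dup] lF /L2P[mF F2]; have mt := @measurable_tcons _ T n.
apply/L2P; split; first exact: measurableT_comp.
have iF := Lfun2_integrable_sqr lF.
by rewrite (integral_cons iF) in F2.
Qed.

Lemma Rintegral_cons (F : n.+1.-tuple T -> R) :
  cm.-integrable [set: n.+1.-tuple T] (EFin \o F) ->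
  \int[cm]_t F t = \int[(m1 \x m2)%E]_z F (tcons z).
Proof. by move=> iF; rewrite /Rintegral (integral_cons iF). Qed.

Lemma L2_tensor_cons (a : T -> R) (b : n.-tuple T -> R) :
  a \in Lfun m1 2%:E -> b \in Lfun m2 2%:E ->
  (fun t => a (thead t) * b [tuple of behead t]) \in Lfun cm 2%:E.
Proof.
move=> la lb; have [mab ab2] := (L2P _ _).1 (L2_tensor la lb).
have tK (z : T * n.-tuple T) : [tuple of behead (tcons z)] = z.2 by exact: val_inj.
have mF : measurable_fun [set: n.+1.-tuple T]
    (fun t => a (thead t) * b [tuple of behead t]).
  apply: measurable_funM; apply: measurableT_comp.
  - exact: L2_measurable la.
  - exact: measurable_tnth.
  - exact: L2_measurable lb.
  - exact: measurable_behead.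
apply/L2P; split => //.
rewrite cons_integral_pushforward ge0_integral_pushforward//; last 3 first.
- exact: measurable_tcons.
- by apply/measurable_EFinP; exact: measurable_funX.
- by move=> t _; rewrite lee_fin sqr_ge0.
rewrite preimage_setT; apply: le_lt_trans ab2; rewrite le_eqVlt; apply/orP; left.
by apply/eqP; apply: eq_integral => z _ /=; rewrite tK theadE.
Qed.

Lemma total_cons (E1 : set (T -> R)) (E2 : set (n.-tuple T -> R)) :
  (forall e, E1 e -> e \in Lfun m1 2%:E) ->
  (forall e, E2 e -> e \in Lfun m2 2%:E) ->
  total m1 E1 -> total m2 E2 ->
  total cm [set e | exists e1 e2, [/\ E1 e1, E2 e2 &
    e = fun t => e1 (thead t) * e2 [tuple of behead t]]].
Proof.
move=> LE1 LE2 t1 t2 F lF h.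
have tK (z : T * n.-tuple T) : [tuple of behead (tcons z)] = z.2 by exact: val_inj.
suff H : F \o @tcons _ T n = (fun=> 0) %[ae (m1 \x m2)%E].
  by apply: ae_cons; move: H; apply: filterS => z.
apply: (total_tensor LE1 LE2 t1 t2); first exact: L2_cons.
move=> _ [e1 [e2 [Ee1 Ee2 ->]]].
have := h _ (ex_intro _ e1 (ex_intro _ e2 (And3 Ee1 Ee2 erefl))).
rewrite Rintegral_cons; last first.
  by apply: L2_integrable_mul => //; apply: L2_tensor_cons; [exact: LE1|exact: LE2].
by under eq_Rintegral => z _ do rewrite tK theadE.
Qed.

End cons_L2.

(** * Invariance of power measures under permutations of the coordinates *)

Section permutation_invariance.
Context {d} {T : measurableType d} {R : realType}.
Variable m : {sigma_finite_measure set T -> \bar R}.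
Local Notation pm n := (prod_measure n (fun=> m)).

Definition box n (B : 'I_n -> set T) : set (n.-tuple T) :=
  [set t | forall i, B i (tnth t i)].

Definition boxes n : set (set (n.-tuple T)) :=
  [set box B | B in [set B : 'I_n -> set T | forall i, measurable (B i)]].

Arguments boxes n : clear implicits.

Lemma measurable_box n (B : 'I_n -> set T) :
  (forall i, measurable (B i)) -> measurable (box B).
Proof.
move=> mB; rewrite (_ : box B = \bigcap_(i in [set: 'I_n]) ((@tnth n T)^~ i @^-1` B i)).
  apply: fin_bigcap_measurable; first exact: finite_finset.
  by move=> i _; rewrite -[X in measurable X]setTI; apply: measurable_tnth.
by apply/seteqP; split => t /= h i; [move=> _; exact: h|exact: h].
Qed.

Lemma measurable_boxes n : @measurable _ (n.-tuple T) = <<s boxes n >>.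
Proof.
apply/seteqP; split; last first.
  apply: smallest_sub; first exact: sigma_algebra_measurable.
  by move=> _ [B mB <-]; exact: measurable_box.
apply: smallest_sub; first exact: smallest_sigma_algebra.
move=> A; rewrite -bigcup_seq => -[i /= _ [B mB <-]].
apply: sub_sigma_algebra.
exists (fun j => if j == i then B else setT) => [j|]; first by case: ifP.
apply/seteqP; split => t /=.
  by move=> h; split => //; have := h i; rewrite eqxx.
by move=> [_ Bt] j; case: eqP => [->|].
Qed.

Lemma boxes_setI n : setI_closed (boxes n).
Proof.
move=> _ _ [A mA <-] [B mB <-]; exists (fun i => A i `&` B i).
  by move=> i; exact: measurableI.
apply/seteqP; split => t /=; first by move=> h; split => i; case: (h i).
by move=> [h1 h2] i; split.
Qed.

Lemma prod_measure_box n (B : 'I_n -> set T) : (forall i, measurable (B i)) ->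
  pm n (box B) = (\prod_(i < n) m (B i))%E.
Proof.
elim: n B => [|n ih] B mB.
  rewrite big_ord0 /= diracE mem_set//.
  by move=> [].
rewrite big_ord_recl -ih//=.
rewrite -[LHS]/((m \x prod_measure n (fun=> m))%E (@tcons _ T n @^-1` box B)).
rewrite -product_measure1E//; last exact: measurable_box.
congr (_ _); apply/seteqP; split => -[x t] /=.
  move=> h; split; first by have := h ord0; rewrite (tnth_nth x).
  by move=> i; have := h (lift ord0 i); rewrite !(tnth_nth x).
move=> [Bx Bt] i; case: (unliftP ord0 i) => [j ->|->].
  by have := Bt j; rewrite !(tnth_nth x).
by rewrite (tnth_nth x).
Qed.

Lemma measurable_permute n (s : 'S_n) :
  measurable_fun [set: n.-tuple T] (fun t => permute t s).
Proof.
apply/measurable_fun_tnthP => i.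
rewrite (_ : _ \o _ = fun t => tnth t (s i)); first exact: measurable_tnth.
by apply/funext => t /=; rewrite tnth_mktuple.
Qed.

Lemma permuteM n (t : n.-tuple T) (s1 s2 : 'S_n) :
  permute (permute t s1) s2 = permute t (s2 * s1)%g.
Proof. by apply: eq_from_tnth => i; rewrite !tnth_mktuple permM. Qed.

(** Boxes form a generating pi-system, and a permutation only reorders the factors in the measure of
    a box. *)
Lemma prod_measure_permute n (s : 'S_n) A : measurable A ->
  pushforward (pm n) (fun t => permute t s) A = pm n A.
Proof.
have ms := measurable_permute s.
pose ms_mixin := isMeasurableFun.Build _ _ _ _ _ ms.
pose ps : {mfun (n.-tuple T) >-> (n.-tuple T)} := HB.pack (fun t => permute t s) ms_mixin.
have /sigma_finiteP[K [KT ndK Koo]] := sigma_finiteT m.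
have pushE (B : 'I_n -> set T) : (forall i, measurable (B i)) ->
    pushforward (pm n) ps (box B) = (\prod_(i < n) m (B (s^-1%g i)))%E.
  move=> mB; rewrite /pushforward.
  rewrite (_ : _ @^-1` _ = box (fun i => B (s^-1%g i))); first exact: prod_measure_box.
  apply/seteqP; split => t h i.
    by have := h (s^-1%g i); rewrite tnth_mktuple permKV.
  by have := h (s i); rewrite tnth_mktuple permK.
move=> mA.
apply: (@measure_unique _ _ _ (boxes n) (fun k => box (fun=> K k)) _ _ _ _
   (pushforward (pm n) ps) (pm n)) => //.
- exact: measurable_boxes.
- exact: boxes_setI.
- by move=> k; exists (fun=> K k) => // i; case: (Koo k).
- apply/seteqP; split => // t _.
  have /choice[k hk] (i : 'I_n) : exists k, K k (tnth t i).
    have : (\bigcup_k K k) (tnth t i) by rewrite -KT.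
    by case=> k _ ?; exists k.
  exists (\max_i k i)%N => // i.
  by have := hk i; apply/subsetPset/ndK/leq_bigmax.
- move=> _ [B mB <-]; rewrite [RHS](prod_measure_box mB) [LHS]pushE//.
  rewrite (reindex_inj (@perm_inj _ s))/=.
  by apply: eq_bigr => i _; rewrite permK.
- move=> k; have [mK Kk] := Koo k; rewrite [X in (X < _)%E]pushE//.
  rewrite -ge0_fin_numE; last by apply: prode_ge0.
  by apply: prode_fin_num => i _; rewrite ge0_fin_numE.
Qed.

Lemma ge0_integral_permute n (s : 'S_n) (f : n.-tuple T -> \bar R) :
  measurable_fun [set: n.-tuple T] f -> (forall t, 0 <= f t)%E ->
  (\int[pm n]_t f (permute t s) = \int[pm n]_t f t)%E.
Proof.
move=> mf f0; have ms := measurable_permute s.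
pose ms_mixin := isMeasurableFun.Build _ _ _ _ _ ms.
pose ps : {mfun (n.-tuple T) >-> (n.-tuple T)} := HB.pack (fun t => permute t s) ms_mixin.
transitivity (\int[pushforward (pm n) ps]_t f t)%E.
  by rewrite ge0_integral_pushforward.
by apply: eq_measure_integral => A mA _; exact: prod_measure_permute.
Qed.

Lemma integral_permute n (s : 'S_n) (f : n.-tuple T -> \bar R) :
  measurable_fun [set: n.-tuple T] f ->
  (\int[pm n]_t f (permute t s) = \int[pm n]_t f t)%E.
Proof.
move=> mf; rewrite integralE [RHS]integralE; congr (_ - _)%E.
  rewrite -(ge0_integral_permute s (measurable_funepos mf))//.
  by apply: eq_integral => t _; rewrite !funeposE.
rewrite -(ge0_integral_permute s (measurable_funeneg mf))//.
by apply: eq_integral => t _; rewrite !funenegE.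
Qed.

Lemma Rintegral_permute n (s : 'S_n) (f : n.-tuple T -> R) :
  measurable_fun [set: n.-tuple T] f ->
  \int[pm n]_t f (permute t s) = \int[pm n]_t f t.
Proof.
move=> mf; congr fine; apply: (@integral_permute _ _ (EFin \o f)).
exact/measurable_EFinP.
Qed.

Lemma L2_permute n (s : 'S_n) (f : n.-tuple T -> R) :
  f \in Lfun (pm n) 2%:E -> (fun t => f (permute t s)) \in Lfun (pm n) 2%:E.
Proof.
move=> /L2P[mf f2]; apply/L2P; split.
  by apply: measurableT_comp => //; exact: measurable_permute.
rewrite (@integral_permute _ s (fun t => (f t ^+ 2)%:E))//.
by apply/measurable_EFinP; exact: measurable_funX.
Qed.

End permutation_invariance.

(** * Totality of the polynomials *)

Section dominated.
Context {d} {T : measurableType d} {R : realType}.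
Variable m : {measure set T -> \bar R}.

Lemma L2_le (f g : T -> R) : g \in Lfun m 2%:E -> measurable_fun [set: T] f ->
  (forall x, `|f x| <= `|g x|) -> f \in Lfun m 2%:E.
Proof.
move=> /L2P[mg g2] mf fg; apply/L2P; split => //; apply: le_lt_trans g2.
have mf2 : measurable_fun [set: T] (fun x => (f x ^+ 2)%:E).
  by apply/measurable_EFinP; exact: measurable_funX.
have mg2 : measurable_fun [set: T] (fun x => (g x ^+ 2)%:E).
  by apply/measurable_EFinP; exact: measurable_funX.
apply: ge0_le_integral mf2 mg2 _ => //; first by move=> x _; rewrite lee_fin sqr_ge0.
move=> x _; rewrite lee_fin -[leLHS]real_normK ?num_real//.
by rewrite -[leRHS]real_normK ?num_real// lerXn2r ?nnegrE.
Qed.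

Lemma Rintegral_dominated_eq0 (u : nat -> T -> R) (v g : T -> R) :
  (forall n, measurable_fun [set: T] (u n)) -> measurable_fun [set: T] v ->
  (forall x, u ^~ x @ \oo --> v x) -> (forall n x, `|u n x| <= g x) ->
  m.-integrable [set: T] (EFin \o g) -> (forall n, \int[m]_x u n x = 0) ->
  \int[m]_x v x = 0.
Proof.
move=> mu mv uv ug ig u0.
have iu n : m.-integrable [set: T] (EFin \o u n).
  apply: le_integrable ig => //; first exact/measurable_EFinP.
  move=> x _; rewrite /= lee_fin; apply: (le_trans (ug n x)); exact: ler_norm.
have cuv : {ae m, forall x, setT x -> (u n x)%:E @[n --> \oo] --> (v x)%:E}.
  by apply: aeW => x _; apply/cvg_EFin; [exact: nearW|exact: uv].
have bug : {ae m, forall x n, setT x -> (`|(u n x)%:E| <= (g x)%:E)%E}.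
  by apply: aeW => x n _; rewrite lee_fin.
have [_ _] := @dominated_convergence _ _ _ m setT measurableT
  (fun n => EFin \o u n) (EFin \o v) (EFin \o g)
  (fun n => (measurable_EFinP _ _).2 (mu n)) ((measurable_EFinP _ _).2 mv) cuv ig bug.
rewrite (_ : [sequence _]_n = fun=> 0%E).
  by move=> /cvg_lim; rewrite lim_cst// /Rintegral => <-.
apply/funext => n /=; rewrite -[LHS]fineK ?(integrable_fin_num _ (iu n))//.
by congr EFin; exact: u0.
Qed.

End dominated.

Section exponential_bounds.
Context {R : realType}.
Implicit Types x : R.

Lemma series_exp_coeff_le x n : 0 <= x -> series (exp_coeff x) n <= expR x.
Proof.
move=> x0; apply: nondecreasing_cvgn_le; last exact: is_cvg_series_exp_coeff.
apply: nondecreasing_series => k _ _; exact: exp_coeff_ge0.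
Qed.

Lemma exp_coeff_le x n : 0 <= x -> x ^+ n <= n`!%:R * expR x.
Proof.
move=> x0; rewrite -ler_pdivrMl ?ltr0n ?fact_gt0//.
apply: le_trans (series_exp_coeff_le n.+1 x0).
rewrite /series/= big_nat_recr//= mulrC lerDr sumr_ge0// => k _.
exact: exp_coeff_ge0.
Qed.

End exponential_bounds.

(** * A threshold at 1/2 as a limit of polynomials on [0,1] *)

Section threshold.
Context {R : realType}.
Implicit Types x y r s : R.

Lemma bernoulli_ineq y n : - 1 <= y -> 1 + n%:R * y <= (1 + y) ^+ n.
Proof.
move=> y1; elim: n => [|n ih]; first by rewrite mul0r addr0 expr0.
rewrite exprS -natr1; have n0 : 0 <= n%:R :> R by [].
have := ler_wpM2l (_ : 0 <= 1 + y) ih; have := sqr_ge0 y.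
by move: (n%:R) n0 => a a0 h1 /(_ _) h2; nra.
Qed.

Lemma bernoulli_upper y n : 0 <= y <= 1 -> (1 - y) ^+ n <= (1 + n%:R * y)^-1.
Proof.
move=> /andP[y0 y1]; have p : 0 < 1 + n%:R * y by rewrite ltr_wpDr// mulr_ge0.
rewrite -[leRHS]mul1r ler_pdivlMr//.
apply: (@le_trans _ _ ((1 - y) ^+ n * (1 + y) ^+ n)).
  rewrite ler_wpM2l ?exprn_ge0 ?subr_ge0// bernoulli_ineq//; lra.
by rewrite -exprMn exprn_ile1//; nra.
Qed.

(** 1 - s^n is (1 - s) times the sum of n powers s^k with k < n, each at least s^n. *)
Lemma geometric_slope s n : 0 <= s <= 1 -> (1 - s) * (n%:R * s ^+ n) <= 1 - s ^+ n.
Proof.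
move=> /andP[s0 s1]; elim: n => [|n ih]; first by rewrite mul0r mulr0 expr0 subrr.
have p0 : 0 <= s ^+ n by exact: exprn_ge0.
have p1 : s ^+ n <= 1 by exact: exprn_ile1.
rewrite exprS -natr1; move: (n%:R) (s ^+ n) ih p0 p1 => a p ih p0 p1.
have : s * ((1 - s) * (a * p)) <= s * (1 - p) by rewrite ler_wpM2l.
have : 0 <= (1 - s) * (1 - s * p) by rewrite mulr_ge0 ?subr_ge0//; nra.
nra.
Qed.

Lemma cvg_linear_geometric r : 0 <= r < 1 ->
  (fun n => n%:R * r ^+ n) @ \oo --> (0 : R).
Proof.
(* With r = s^2, the factor n s^n is at most 1/(1 - s), and another s^n remains to tend to 0. *)
move=> /andP[r0 r1]; pose s := Num.sqrt r.
have s0 : 0 <= s by exact: sqrtr_ge0.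
have s1 : s < 1 by rewrite /s -sqrtr1 ltr_sqrt.
have sr : r = s * s by rewrite -expr2 sqr_sqrtr.
apply: (@squeeze_cvgr _ _ _ _ (fun=> 0) (fun n => (1 - s)^-1 * s ^+ n)).
- apply: nearW => n; rewrite mulr_ge0 ?exprn_ge0//= sr exprMn mulrA.
  rewrite ler_wpM2r ?exprn_ge0// -[leRHS]mul1r ler_pdivlMr ?subr_gt0//.
  rewrite mulrC (le_trans (geometric_slope n _)) ?s0 ?(ltW s1)//.
  by rewrite gerBl exprn_ge0.
- exact: cvg_cst.
- rewrite -[X in _ --> X](mulr0 (1 - s)^-1); apply: cvgM; first exact: cvg_cst.
  by apply: cvg_expr; rewrite ger0_norm.
Qed.

(** The exponent N = n 2^n satisfies N x^n = n (2x)^n, which tends to 0 for x < 1/2 and is at least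
    n for x >= 1/2; the two Bernoulli bounds conclude. The exponent 2^n alone would give the limit
    1/e at x = 1/2. *)
Lemma cvg_threshold x : 0 <= x <= 1 ->
  (fun n => (1 - x ^+ n) ^+ (n * 2 ^ n)) @ \oo --> (if x < 2^-1 then 1 else 0 : R).
Proof.
move=> /andP[x0 x1].
have p0 n : 0 <= x ^+ n by exact: exprn_ge0.
have p1 n : x ^+ n <= 1 by exact: exprn_ile1.
have NE n : (n * 2 ^ n)%:R * x ^+ n = n%:R * (2 * x) ^+ n.
  by rewrite natrM natrX -mulrA exprMn.
case: ifPn => [xh|]; [|rewrite -leNgt => xh].
- apply: (@squeeze_cvgr _ _ _ _ (fun n => 1 - n%:R * (2 * x) ^+ n) (fun=> 1)).
  + apply: nearW => n; rewrite exprn_ile1 ?subr_ge0 ?gerBl// andbT -NE.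
    by have := @bernoulli_ineq (- x ^+ n) (n * 2 ^ n); rewrite mulrN lerN2; apply.
  + rewrite -[X in _ --> X]subr0; apply: cvgB; first exact: cvg_cst.
    by apply: cvg_linear_geometric; rewrite mulr_ge0//=; lra.
  + exact: cvg_cst.
- apply: (@squeeze_cvgr _ _ _ _ (fun=> 0) (fun n => n.+1%:R^-1)).
  + apply: nearW => n; rewrite exprn_ge0 ?subr_ge0//=.
    rewrite (le_trans (bernoulli_upper _ _)) ?p0 ?p1// NE lef_pV2 ?posrE//.
      rewrite -natr1 addrC lerD2l ler_peMr// exprn_ege1//; lra.
    by rewrite ltr_wpDr// mulr_ge0// exprn_ge0// mulr_ge0.
  + exact: cvg_cst.
  + exact: cvg_harmonic.
Qed.

End threshold.

Section polynomials_total.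
Context {R : realType}.
Variable m : {measure set R -> \bar R}.
Hypothesis m1 : m [set: R] = 1%E.
Variable C : R.
Hypothesis C0 : 0 < C.
Hypothesis moments : forall n, (0 < n)%N ->
  (\int[m]_s (`|s| ^+ n)%:E <= (C ^+ n * n`!%:R)%:E)%E.

Local Notation T := R (only parsing).
Let t0 := (8 * C)^-1.

Lemma measurable_abs : measurable_fun [set: T] (fun s : T => `|s : R|).
Proof. exact: measurableT_comp. Qed.

Lemma measurable_expR_abs (c : R) :
  measurable_fun [set: T] (fun s : T => expR (c * `|s : R|)).
Proof. by apply: measurableT_comp => //; apply: measurable_funM. Qed.

(** At rate 1/(2C) the moment bound dominates the integrated exponential series by a geometric
    series of ratio 1/2. *)
Lemma expR_abs_integrable :
  (\int[m]_s (expR ((2 * C)^-1 * `|s|))%:E < +oo)%E.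
Proof.
set c := (2 * C)^-1.
have c0 : 0 <= c by rewrite invr_ge0 mulr_ge0// ltW.
have me k : measurable_fun [set: T] (fun s : T => (exp_coeff (c * `|s|) k)%:E).
  apply/measurable_EFinP/measurable_funM => //; apply: measurable_funX.
  by apply: measurable_funM => //; exact: measurable_abs.
have e0 k (s : R) : (0 <= (exp_coeff (c * `|s|) k)%:E)%E.
  by rewrite lee_fin exp_coeff_ge0// mulr_ge0.
rewrite (_ : (\int[m]_s _ =
    \int[m]_s (\sum_(0 <= k <oo) (exp_coeff (c * `|s|) k)%:E))%E); last first.
  apply: eq_integral => s _; apply/esym/cvg_lim => //.
  under eq_fun do rewrite sumEFin.
  by apply/cvg_EFin; [exact: nearW|exact: is_cvg_series_exp_coeff].
rewrite integral_nneseries//.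
apply: (@le_lt_trans _ _ (\sum_(0 <= k <oo) (2 / (2 ^ (k + 1))%:R)%:E)%E).
  apply: lee_nneseries => [k _ _|k _]; first exact: integral_ge0.
  (* The moment bound starts at degree 1; the zeroth term is the total mass. *)
  case: k => [|k].
    under eq_integral do rewrite /exp_coeff /= expr0 divr1.
    by rewrite integral_cst// m1 mule1 lee_fin expn1 divff.
  under eq_integral do rewrite /exp_coeff /= exprMn mulrAC EFinM.
  rewrite ge0_integralZl//; last 2 first.
  - by apply/measurable_EFinP/measurable_funX; exact: measurable_abs.
  - by rewrite lee_fin divr_ge0// exprn_ge0.
  rewrite (le_trans (lee_wpmul2l _ (moments (ltn0Sn k))))//.
    by rewrite lee_fin divr_ge0// exprn_ge0.
  rewrite -EFinM lee_fin mulrACA mulVf ?mulr1; last first.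
    by rewrite pnatr_eq0 -lt0n fact_gt0.
  rewrite -exprMn /c invfM -mulrA mulVf ?gt_eqF// mulr1.
  by rewrite addn1 (expnS 2 k.+1) natrM invfM mulVKf// natrX exprVn.
by have /cvg_lim -> := @cvg_geometric_eseries_half R 2 0; rewrite ?ltry.
Qed.

Lemma expR_abs_L2 : (fun s : T => expR ((4 * C)^-1 * `|s : R|)) \in Lfun m 2%:E.
Proof.
apply/L2P; split; first exact: measurable_expR_abs.
apply: le_lt_trans expR_abs_integrable; rewrite le_eqVlt; apply/orP; left.
apply/eqP/eq_integral => s _; congr EFin.
rewrite expr2 -expRD; congr expR; field.
by rewrite gt_eqF.
Qed.

(* [t0] is chosen so that [|s|^n exp(t0 |s|)] is square integrable. *)
Lemma exp_monomial_L2 n :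
  (fun s : T => `|s : R| ^+ n * expR (t0 * `|s : R|)) \in Lfun m 2%:E.
Proof.
have t0p : 0 < t0 by rewrite invr_gt0 mulr_gt0.
(* The rate 1/(4C) of [expR_abs_L2] is 2 [t0]; one half of it absorbs |s|^n, since (t0 |s|)^n is at
   most n! exp(t0 |s|). *)
pose K := n`!%:R / t0 ^+ n.
have K0 : 0 <= K by rewrite divr_ge0// exprn_ge0// ltW.
have h (s : R) : `|s| ^+ n * expR (t0 * `|s|) <= K * expR ((4 * C)^-1 * `|s|).
  have -> : (4 * C)^-1 * `|s| = t0 * `|s| + t0 * `|s|.
    by rewrite /t0; field; rewrite gt_eqF.
  rewrite expRD mulrA ler_wpM2r ?expR_ge0//.
  rewrite /K mulrAC ler_pdivlMr ?exprn_gt0// mulrC -exprMn.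
  by apply: exp_coeff_le; rewrite mulr_ge0// ltW.
have lK : (fun s : T => K * expR ((4 * C)^-1 * `|s : R|)) \in Lfun m 2%:E.
  exact: (hmemZ (hl2_prehilbert m) K expR_abs_L2).
have e0 (s : R) : 0 <= `|s| ^+ n * expR (t0 * `|s|).
  by rewrite mulr_ge0 ?expR_ge0 ?exprn_ge0.
apply: (L2_le lK) => [|s].
  apply: measurable_funM; last exact: measurable_expR_abs.
  by apply: measurable_funX; exact: measurable_abs.
by rewrite ger0_norm// (le_trans (h s))// ler_norm.
Qed.

Lemma monomial_L2 n : (fun s : T => (s : R) ^+ n) \in Lfun m 2%:E.
Proof.
have t0p : 0 < t0 by rewrite invr_gt0 mulr_gt0.
apply: (L2_le (exp_monomial_L2 n)) => [|s]; first exact: measurable_funX.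
rewrite [leRHS]ger0_norm ?mulr_ge0 ?expR_ge0 ?exprn_ge0//.
rewrite normrX ler_peMr ?exprn_ge0// -expR0 ler_expR mulr_ge0//.
exact: ltW.
Qed.

Definition perp_poly (f : T -> R) : Prop :=
  f \in Lfun m 2%:E /\ forall n, \int[m]_s (f s * (s : R) ^+ n) = 0.

(* If [f] is orthogonal to the polynomials then so is [f] times [sin (t s)] or
   [cos (t s)] for small [t], by expanding in powers. The multipliers form an
   algebra closed under bounded limits, so they contain the indicators of rays,
   and [f] vanishes almost everywhere. *)
Definition multiplier (g : T -> R) : Prop :=
  [/\ measurable_fun [set: T] g, exists M, forall s, `|g s| <= M &
    forall f, perp_poly f -> perp_poly (fun s => f s * g s)].

Lemma L2_mul_bounded (f g : T -> R) : f \in Lfun m 2%:E ->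
  measurable_fun [set: T] g -> (exists M, forall s, `|g s| <= M) ->
  (fun s => f s * g s) \in Lfun m 2%:E.
Proof.
move=> lf mg [M gM].
apply: (L2_le (hmemZ (hl2_prehilbert m) M lf)) => [|s].
  by apply: measurable_funM => //; exact: L2_measurable lf.
rewrite fctE mulrC !normrM ler_wpM2r//.
by rewrite (le_trans (gM s))// ler_norm.
Qed.

Lemma multiplier_lim (g : nat -> T -> R) h M : (forall k, multiplier (g k)) ->
  (forall k s, `|g k s| <= M) -> (forall s, g ^~ s @ \oo --> h s) -> multiplier h.
Proof.
move=> mg gM gh.
have mgk k : measurable_fun [set: T] (g k) by case: (mg k).
have mh : measurable_fun [set: T] h by apply: (measurable_fun_cvg mgk) => s _; exact: gh.
have hM s : `|h s| <= M.
  have cg : `|g k s| @[k --> \oo] --> `|h s| by apply: cvg_norm; exact: gh.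
  rewrite -(cvg_lim _ cg)//; apply: limr_le; first by apply/cvg_ex; exists `|h s|.
  exact: nearW.
split => //; first by exists M.
move=> f [lf f0]; have mf := L2_measurable lf.
split; first by apply: L2_mul_bounded => //; exists M.
move=> n; have mn : measurable_fun [set: T] (fun s : T => (s : R) ^+ n).
  exact: measurable_funX.
apply: (@Rintegral_dominated_eq0 _ _ _ m (fun k s => f s * g k s * (s : R) ^+ n)
   _ (fun s => M * `|f s * (s : R) ^+ n|)).
- by move=> k; apply: measurable_funM => //; exact: measurable_funM.
- by apply: measurable_funM => //; exact: measurable_funM.
- move=> s; apply: cvgM; last exact: cvg_cst.
  by apply: cvgM; [exact: cvg_cst|exact: gh].
- by move=> k s; rewrite mulrAC normrM mulrC ler_wpM2r.
- apply: integrable_RZ; have := integrable_abse (L2_integrable_mul lf (monomial_L2 n)).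
  by [].
- by move=> k; have [_ _ /(_ f (conj lf f0))[_]] := mg k; apply.
Qed.

Lemma multiplier_cst c : multiplier (fun=> c).
Proof.
split; first exact: measurable_cst.
  by exists `|c|.
move=> f [lf f0]; split.
  by apply: L2_mul_bounded => //; exists `|c|.
move=> n; under eq_Rintegral => s _ do rewrite mulrAC.
by rewrite RintegralZr ?f0 ?mul0r//; exact: L2_integrable_mul (monomial_L2 n).
Qed.

Lemma multiplierD g h : multiplier g -> multiplier h ->
  multiplier (fun s => g s + h s).
Proof.
move=> [mg [M gM] gN] [mh [K hK] hN].
have b : exists B, forall s, `|g s + h s| <= B.
  by exists (M + K) => s; rewrite (le_trans (ler_normD _ _))// lerD.
split => //; first exact: measurable_funD.
move=> f Nf; have [lf f0] := Nf; split.
  by apply: L2_mul_bounded => //; exact: measurable_funD.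
move=> n; have [l1 h1] := gN f Nf; have [l2 h2] := hN f Nf.
under eq_Rintegral => s _ do rewrite mulrDr mulrDl.
by rewrite RintegralD ?h1 ?h2 ?addr0//; exact: L2_integrable_mul (monomial_L2 n).
Qed.

(** The definition of a multiplier quantifies over every f orthogonal to the polynomials, so it can
    be used twice in a row. *)
Lemma multiplierM g h : multiplier g -> multiplier h ->
  multiplier (fun s => g s * h s).
Proof.
move=> [mg [M gM] gN] [mh [K hK] hN]; split.
- exact: measurable_funM.
- exists (M * K) => s; rewrite normrM ler_pM//.
- move=> f Nf; have := hN _ (gN f Nf).
  by under eq_fun do rewrite -mulrA.
Qed.

Lemma multiplierX g n : multiplier g -> multiplier (fun s => g s ^+ n).
Proof.
move=> mg; elim: n => [|n ih]; first exact: multiplier_cst.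
by under eq_fun do rewrite exprS; exact: multiplierM.
Qed.

(** The partial sums of the series are polynomials in s, so their integrals against f s^n vanish.
    They are dominated by exp(t0 |s|), and |s|^n exp(t0 |s|) is square integrable, so the integral
    of the limit vanishes too. *)
Lemma multiplier_entire (gam : nat -> R) (h : R -> R) (t : R) :
  (forall k, `|gam k| <= k`!%:R^-1) ->
  (forall x, series (fun k => gam k * x ^+ k) @ \oo --> h x) ->
  measurable_fun [set: T] (h : T -> R) -> (exists M, forall x, `|h x| <= M) ->
  `|t| <= t0 -> multiplier (fun s => h (t * (s : R))).
Proof.
move=> gam1 hser mh [M hM] tt0.
have mht : measurable_fun [set: T] (fun s : T => h (t * (s : R))).
  by apply: measurableT_comp => //; exact: measurable_funM.
split => //; first by exists M.
move=> f [lf f0]; have mf := L2_measurable lf.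
split; first by apply: L2_mul_bounded => //; exists M.
move=> n; have mn k : measurable_fun [set: T] (fun s : T => (s : R) ^+ k).
  exact: measurable_funX.
pose u K (s : T) := series (fun k => gam k * (t * (s : R)) ^+ k) K.
have mu K : measurable_fun [set: T] (u K).
  rewrite /u /series /=; apply: measurable_sum => k.
  by apply: measurable_funM => //; apply: measurable_funX; exact: measurable_funM.
apply: (@Rintegral_dominated_eq0 _ _ _ m (fun K s => f s * u K s * (s : R) ^+ n)
   _ (fun s => `|f s * (`|s : R| ^+ n * expR (t0 * `|s : R|))|)).
- by move=> k; apply: measurable_funM => //; exact: measurable_funM.
- by apply: measurable_funM => //; exact: measurable_funM.
- move=> s; apply: cvgM; last exact: cvg_cst.
  by apply: cvgM; [exact: cvg_cst|exact: hser].
- move=> K s; rewrite -mulrA normrM [leRHS]normrM ler_wpM2l//.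
  rewrite [leRHS]ger0_norm; last by rewrite mulr_ge0 ?expR_ge0 ?exprn_ge0.
  rewrite normrM normrX mulrC ler_wpM2l ?exprn_ge0//.
  apply: le_trans (series_exp_coeff_le K _); last by rewrite mulr_ge0// (le_trans _ tt0).
  rewrite /u /series /= (le_trans (ler_norm_sum _ _ _))//.
  apply: ler_sum => k _; rewrite normrM normrX normrM mulrC.
  rewrite ler_pM ?exprn_ge0 ?mulr_ge0// lerXn2r ?nnegrE ?mulr_ge0//.
    by rewrite (le_trans _ tt0).
  by rewrite ler_wpM2r.
- have := integrable_abse (L2_integrable_mul lf (exp_monomial_L2 n)).
  by [].
- move=> K.
  have -> : (fun s : T => f s * u K s * (s : R) ^+ n) = (fun s : T =>
     \sum_(k < K) (gam k * t ^+ k) * (f s * (s : R) ^+ (k + n))).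
    apply/funext => s; rewrite /u /series /= big_mkord mulr_sumr mulr_suml.
    by apply: eq_bigr => k _; rewrite exprMn exprD; ring.
  have i k : m.-integrable setT (EFin \o (fun s : T => f s * (s : R) ^+ k)).
    exact: L2_integrable_mul (monomial_L2 k).
  have [] : m.-integrable setT (EFin \o (fun s : T =>
      \sum_(k < K) (gam k * t ^+ k) * (f s * (s : R) ^+ (k + n)))) /\
    \int[m]_s (\sum_(k < K) (gam k * t ^+ k) * (f s * (s : R) ^+ (k + n))) = 0.
    elim: K => [|K [ih1 ih2]].
      under eq_fun do rewrite big_ord0.
      split; first exact: integrable0.
      by rewrite Rintegral_cst// mul0r.
    under eq_fun do rewrite big_ord_recr /=.
    split; first by apply: integrable_RD => //; exact: integrable_RZ.
    by rewrite RintegralD ?ih2 ?add0r ?RintegralZl ?f0 ?mulr0//; exact: integrable_RZ.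
  by [].
Qed.

Lemma multiplier_threshold g : multiplier g -> (forall s, 0 <= g s <= 1) ->
  multiplier (fun s => if g s < 2^-1 then 1 else 0).
Proof.
move=> mg g01.
apply: (@multiplier_lim (fun n s => (1 - g s ^+ n) ^+ (n * 2 ^ n)) _ 1).
- move=> n; apply: multiplierX; apply: multiplierD; first exact: multiplier_cst.
  under eq_fun do rewrite -mulN1r.
  by apply: multiplierM; [exact: multiplier_cst|exact: multiplierX].
- move=> n s; have /andP[g0 g1] := g01 s.
  have h0 : 0 <= 1 - g s ^+ n by rewrite subr_ge0 exprn_ile1.
  by rewrite normrX ger0_norm// exprn_ile1// gerBl exprn_ge0.
- by move=> s; exact: cvg_threshold.
Qed.

Lemma multiplier_sin t : `|t| <= t0 -> multiplier (fun s => sin (t * (s : R))).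
Proof.
move=> tt0; apply: (@multiplier_entire
  (fun k => (odd k)%:R * (-1) ^+ k.-1./2 * (k`!%:R)^-1)) => //.
- move=> k; rewrite !normrM normrX normrN normr1 expr1n mulr1 normfV.
  by rewrite !normr_nat ler_piMl ?invr_ge0// lern1 leq_b1.
- move=> x; have := @is_cvg_series_sin_coeff R x.
  by rewrite sin_coeffE sin.unlock -sin_coeffE.
- by apply: continuous_measurable_fun; exact: continuous_sin.
- by exists 1 => x; exact: sin_max.
Qed.

Lemma multiplier_cos t : `|t| <= t0 -> multiplier (fun s => cos (t * (s : R))).
Proof.
move=> tt0; apply: (@multiplier_entire
  (fun k => (~~ odd k)%:R * (-1) ^+ k./2 * (k`!%:R)^-1)) => //.
- move=> k; rewrite !normrM normrX normrN normr1 expr1n mulr1 normfV.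
  by rewrite !normr_nat ler_piMl ?invr_ge0// lern1 leq_b1.
- move=> x; have := @is_cvg_series_cos_coeff R x.
  by rewrite cos_coeffE cos.unlock -cos_coeffE.
- by apply: continuous_measurable_fun; exact: continuous_cos.
- by exists 1 => x; exact: cos_max.
Qed.

Lemma multiplier_sin_pos t a : `|t| <= t0 ->
  multiplier (fun s => if 0 < sin (t * ((s : R) - a)) then 1 else 0).
Proof.
move=> tt0.
(* This is (1 - sin(t(s - a)))/2, expanded so that only sines and cosines of t s occur; it lies in
   [0,1] and is below 1/2 exactly when the sine is positive. *)
pose g (s : T) := 2^-1 + (- (2^-1 * cos (t * a)) * sin (t * (s : R)) +
  (2^-1 * sin (t * a)) * cos (t * (s : R))).
have gE s : g s = (1 - sin (t * ((s : R) - a))) / 2.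
  by rewrite /g mulrBr sinB; ring.
have mg : multiplier g.
  apply: multiplierD; first exact: multiplier_cst.
  apply: multiplierD; apply: multiplierM; try exact: multiplier_cst.
    exact: multiplier_sin.
  exact: multiplier_cos.
have := multiplier_threshold mg.
have -> : (fun s => if g s < 2^-1 then 1 else 0) =
    (fun s : T => if 0 < sin (t * ((s : R) - a)) then 1 else 0 : R).
  apply/funext => s; rewrite gE; congr (if _ then _ else _).
  by rewrite ltr_pdivrMr// mulVf// gtrBl.
apply => s; rewrite gE; have := sin_le1 (t * ((s : R) - a)).
by have := sin_geN1 (t * ((s : R) - a)); lra.
Qed.

(** For fixed s and small t > 0, |t(s - a)| is less than 1 < pi, so sin(t(s - a)) has the sign of s
    - a. *)
Lemma multiplier_ray (a : R) : multiplier (fun s => if a < (s : R) then 1 else 0).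
Proof.
have t0p : 0 < t0 by rewrite invr_gt0 mulr_gt0.
pose t k := t0 / k.+1%:R.
have tp k : 0 < t k by rewrite divr_gt0.
apply: (@multiplier_lim
  (fun k s => if 0 < sin (t k * ((s : R) - a)) then 1 else 0) _ 1).
- move=> k; apply: multiplier_sin_pos; rewrite ger0_norm ?(ltW (tp k))//.
  by rewrite ler_pdivrMr// ler_peMr ?ler1n// ltW.
- by move=> k s; case: ifP; rewrite ?normr1 ?normr0.
- move=> s; have [N hN] : exists N, t0 * `|(s : R) - a| < N%:R.
    by exists (Num.truncn (t0 * `|(s : R) - a|)).+1; exact: truncnS_gt.
  apply: (@cvg_near_cst _ _ _ _ _); exists N => // k /= Nk.
  have h : t k * `|(s : R) - a| < 1.
    rewrite /t mulrAC ltr_pdivrMr// mul1r (lt_le_trans hN)// ler_nat.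
    exact: leq_trans Nk _.
  have p2 : (2 : R) <= pi := pi_ge2 R.
  have [as_|sa] := ltP a (s : R).
    rewrite sin_gt0_pi// mulr_gt0 ?subr_gt0//=.
    by rewrite ger0_norm in h; [lra|rewrite subr_ge0 ltW].
  rewrite ifF//; apply/negbTE; rewrite -leNgt -oppr_ge0 -sinN -mulrN opprB.
  apply: sin_ge0_pi; rewrite mulr_ge0 ?subr_ge0 ?(ltW (tp k))//=.
  by rewrite distrC ger0_norm in h; [lra|rewrite subr_ge0].
Qed.

Theorem polynomials_total (f : T -> R) : f \in Lfun m 2%:E ->
  (forall n, \int[m]_s (f s * (s : R) ^+ n) = 0) -> f = (fun=> 0) %[ae m].
Proof.
move=> lf f0.
have l1 : (fun=> 1) \in Lfun m 2%:E.
  by have := monomial_L2 0; under eq_fun do rewrite expr0.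
have i1 : m.-integrable setT (EFin \o f).
  by have := L2_integrable_mul lf l1; under eq_fun do rewrite mulr1.
apply: (@ae_eq0_pi_system _ _ _ m (@RGenOInfty.G R) (fun k => `]- k%:R,
  +oo[%classic)) => //.
- exact: RGenOInfty.measurableE.
- move=> _ _ [x ->] [y ->]; exists (Num.max x y).
  apply/seteqP; split => z /=; rewrite !in_itv/= !andbT gt_max.
    by move=> [-> ->].
  by move=> /andP.
- by move=> k; exists (- k%:R).
- apply/seteqP; split => // z _; exists (Num.truncn `|z : R|).+1 => //=.
  rewrite in_itv/= andbT ltrNl (le_lt_trans _ (truncnS_gt _))//.
  by rewrite -normrN ler_norm.
- move=> _ [x ->]; have [_ _ /(_ f (conj lf f0))[_ /(_ 0%N)]] := multiplier_ray x.
  move=> h; rewrite integral_mkcond -[LHS]fineK.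
    rewrite -[RHS]/(0%:E) -h; congr EFin; congr fine; apply: eq_integral => s _.
    rewrite patchE expr0 mulr1; case: ifPn => [/set_mem|]/=; rewrite ?in_itv/= ?andbT.
      by move=> ->; rewrite mulr1.
    move=> /negP; rewrite inE/= in_itv/= andbT => /negP/negbTE ->.
    by rewrite mulr0.
  apply: integrable_fin_num => //.
  by apply/(integrable_mkcond _ _).1 => //; exact: integrableS i1.
Qed.

End polynomials_total.

(** * Orthogonal polynomials of one measure *)

Section one_fiber.
Context {R : realType}.
Variable m : {measure set R -> \bar R}.
Hypothesis m1 : m [set: R] = 1%E.
Hypothesis ml2 : forall n, (fun s : R => (s : R) ^+ n) \in Lfun m 2%:E.
Variables (q : nat -> {poly R}) (a b : nat -> R).
Hypothesis mo : monic_orthogonal m q a b.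
Local Notation T := R (only parsing).
Local Notation P n := (forall k, (msupport m #= `I_k)%card -> (n < k)%N).

Lemma poly_L2 (p : {poly R}) : (fun s : T => p.[s : R]) \in Lfun m 2%:E.
Proof.
have pH := hl2_prehilbert m.
have -> : (fun s : T => p.[s : R]) = \sum_(i < size p) p`_i *: (fun s : T => (s
  : R) ^+ i).
  by apply/funext => s; rewrite horner_coef fct_sumE.
elim/big_ind: _ => [|f g|i _]; first exact: (hmem0 pH).
  exact: (hmemD pH).
by apply: (hmemZ pH); exact: ml2.
Qed.

Definition pdot (p r : {poly R}) : R := \int[m]_s (p.[s] * r.[s]).

Lemma poly_integrable_mul (p r : {poly R}) :
  m.-integrable [set: T] (EFin \o (fun s : T => p.[s : R] * r.[s : R])).
Proof. by apply: L2_integrable_mul; exact: poly_L2. Qed.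

Lemma pdotDl p p' r : pdot (p + p') r = pdot p r + pdot p' r.
Proof.
rewrite /pdot -RintegralD//; try exact: poly_integrable_mul.
by apply: eq_Rintegral => s _; rewrite hornerD mulrDl.
Qed.

Lemma pdotZl c p r : pdot (c *: p) r = c * pdot p r.
Proof.
rewrite /pdot -RintegralZl//; last exact: poly_integrable_mul.
by apply: eq_Rintegral => s _; rewrite hornerZ mulrA.
Qed.

Lemma pdot0l r : pdot 0 r = 0.
Proof. by rewrite -[0](scale0r 0) pdotZl mul0r. Qed.

Lemma pdotBl p p' r : pdot (p - p') r = pdot p r - pdot p' r.
Proof. by rewrite pdotDl -scaleN1r pdotZl mulN1r. Qed.

Lemma pdot_suml n (c : 'I_n -> R) (p : 'I_n -> {poly R}) r :
  pdot (\sum_(j < n) c j *: p j) r = \sum_(j < n) c j * pdot (p j) r.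
Proof.
elim: n c p => [|n ih] c p; first by rewrite !big_ord0 pdot0l.
by rewrite !big_ord_recr/= pdotDl pdotZl ih.
Qed.

Lemma pdot_ae p p' r : {ae m, forall s, p.[s] = p'.[s]} -> pdot p r = pdot p' r.
Proof.
move=> h; congr fine; apply: ae_eq_integral => //.
- by case/integrableP: (poly_integrable_mul p r).
- by case/integrableP: (poly_integrable_mul p' r).
- by move: h; apply: filterS => s /= -> _.
Qed.

(** If the support were empty, each point would have a null open neighborhood; finitely many cover
    each segment, so the total mass would be 0. *)
Lemma msupport_neq0 : msupport m !=set0.
Proof.
apply/set0P/negP => /eqP sup0.
have /choice[U hU] s : exists U, [/\ open U, U s & m U = 0%E].
  have : ~ msupport m s by rewrite sup0.
  move=> /existsNP[U] /not_implyP[oU] /not_implyP[Us] /negP.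
  rewrite -leNgt => mU0; exists U; split=> //.
  by apply/eqP; rewrite eq_le mU0 measure_ge0.
have mU s : measurable (U s) by apply: open_measurable; case: (hU s).
have nseg (k : nat) : m.-negligible (`[- k%:R, k%:R]%classic : set T).
  have := @segment_compact R (- k%:R) k%:R; rewrite compact_cover.
  move=> /(_ R setT U)[s _|s _|D _ hD].
  - by case: (hU s).
  - by exists s => //; case: (hU s).
  - apply: (negligibleS hD); rewrite /cover bigcup_fset.
    elim/big_ind: _ => [|A B nA nB|s _]; first exact: negligible_set0.
      exact: negligibleU.
    by apply/negligibleP => //; case: (hU s).
have : m.-negligible [set: T].
  have -> : [set: T] = \bigcup_k (`[- k%:R, k%:R]%classic : set T).
    apply/esym/seteqP; split => // s _; exists (Num.truncn `|s : R|).+1 => //=.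
    by rewrite in_itv/= -ler_norml ltW// truncnS_gt.
  exact: negligible_bigcup.
move=> /(negligibleP m measurableT) mT0.
by have := etrans (esym m1) mT0; move/eqP; rewrite eqe oner_eq0.
Qed.

Lemma index0_lt : P 0%N.
Proof.
move=> k; case: k => // h; have := msupport_neq0.
by move: h; rewrite II0 card_eq0 => /eqP ->; case.
Qed.

Lemma q0E : q 0 = 1.
Proof.
have [mon sz] := mo_monic mo index0_lt.
have := sz => /eqP/size_poly1P[c c0 qc].
by move: mon; rewrite qc monicE lead_coefC => /eqP ->.
Qed.

Lemma q_orth i j : i <> j -> pdot (q i) (q j) = 0.
Proof. exact: (mo_orth mo). Qed.

Lemma q_eq0 n : ~ P n -> q n = 0.
Proof.
move=> /existsNP[k] /not_implyP[h] /negP; rewrite -leqNgt => kn.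
by have [] := mo_fin mo h kn.
Qed.

Lemma index_ltS n : P n.+1 -> P n.
Proof. by move=> h k /h; exact: ltnW. Qed.

Lemma recE n : {ae m, forall s, ('X * q n).[s] =
  (q n.+1 + b n *: q n + (if n is n'.+1 then a n *: q n' else 0)).[s]}.
Proof.
case: n => [|n].
  apply: filterS (mo_rec0 mo) => s /= h.
  by rewrite !hornerE/= mulrC; rewrite mulrC in h; rewrite h.
apply: filterS (mo_rec mo (ltn0Sn n)) => s /= h.
by rewrite !hornerE/= h.
Qed.

(** Applying the recurrence to either factor of the integral of s q_n q_{n+1} gives |q_{n+1}|^2 =
    a_{n+1} |q_n|^2. *)
Lemma q_norm_pos n : P n -> 0 < pdot (q n) (q n).
Proof.
elim: n => [|n ih] Pn.
  rewrite q0E /pdot; under eq_Rintegral do rewrite !hornerC mulr1.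
  by rewrite Rintegral_cst// m1 mulr1.
have an := mo_pos mo (ltn0Sn n) Pn; have hn := ih (index_ltS Pn).
suff -> : pdot (q n.+1) (q n.+1) = a n.+1 * pdot (q n) (q n) by rewrite mulr_gt0.
have o i j : i != j -> pdot (q i) (q j) = 0 by move=> /eqP; exact: q_orth.
transitivity (pdot ('X * q n) (q n.+1)).
  rewrite (pdot_ae _ (recE n)) !pdotDl pdotZl (o n)//; last by rewrite neq_ltn ltnSn.
  case: n {ih Pn an hn} => [|n]; first by rewrite pdot0l; lra.
  by rewrite pdotZl (o n)//; [lra|rewrite neq_ltn ltnS leqnSn].
transitivity (pdot ('X * q n.+1) (q n)).
  by apply: eq_Rintegral => s _; rewrite !hornerE /=; ring.
rewrite (pdot_ae _ (recE n.+1)) !pdotDl !pdotZl (o n.+2)//.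
  by rewrite (o n.+1)// ?neq_ltn ?ltnSn ?orbT//; lra.
by rewrite neq_ltn ltnS leqnSn orbT.
Qed.

(** Only almost everywhere: when the support is finite the q_j vanish from some degree on, and
    higher monomials are combinations of the others only on the support. *)
Lemma q_span n : exists c : 'I_n.+1 -> R,
  {ae m, forall s, s ^+ n = (\sum_(j < n.+1) c j *: q j).[s]}.
Proof.
elim: n => [|n [c hc]].
  exists (fun=> 1); apply: aeW => s.
  by rewrite big_ord1 scale1r q0E hornerC expr0.
(* Extension by zero, so that the shifted coefficients below need no boundary cases. *)
pose c' (i : nat) : R := if insub i is Some j then c j else 0.
have c'E (j : 'I_n.+1) : c' j = c j by rewrite /c' valK.
(* The coefficient of q_i in s times the sum of the c_j q_j, by the recurrence. *)
pose e (i : nat) := (if i is i'.+1 then c' i' else 0) + b i * c' i + a i.+1 * c' i.+1.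
exists (fun j => e j).
have h : {ae m, forall s, forall j, ('X * q j).[s] =
    (q j.+1 + b j *: q j + (if j is j'.+1 then a j *: q j' else 0)).[s]}.
  by apply: ae_foralln => j; exact: recE.
apply: filterS2 h hc => s h hc.
rewrite exprS hc horner_sum mulr_sumr.
transitivity (\sum_(j < n.+1) c' j * ('X * q j).[s]).
  by apply: eq_bigr => j _; rewrite !hornerE/= c'E; ring.
under eq_bigr do rewrite h.
have c'n : c' n.+1 = 0 by rewrite /c' insubF// ltnn.
have c'n2 : c' n.+2 = 0 by rewrite /c' insubF// ltnNge leqnSn.
rewrite horner_sum.
under [RHS]eq_bigr => j _ do rewrite hornerZ /e !mulrDl.
rewrite !big_split/=.
under eq_bigr => j _ do rewrite !hornerD !mulrDr.
rewrite !big_split/=; congr (_ + _ + _).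
- by rewrite [RHS]big_ord_recl/= mul0r add0r.
- rewrite [RHS]big_ord_recr/= c'n mulr0 mul0r addr0.
  by apply: eq_bigr => j _; rewrite hornerZ; ring.
- rewrite [RHS]big_ord_recr/= c'n2 mulr0 mul0r addr0.
  rewrite [RHS]big_ord_recr/= c'n mulr0 mul0r addr0.
  rewrite big_ord_recl/= horner0 mulr0 add0r.
  by apply: eq_bigr => j _; rewrite hornerZ; ring.
Qed.

(** A formula for q_n in terms of integrals of lower polynomials, from which measurability in x can
    be read off. Where q_j = 0 the quotient is 0/0 = 0. *)
Definition gram_schmidt n : {poly R} :=
  'X^n - \sum_(j < n) (pdot 'X^n (q j) / pdot (q j) (q j)) *: q j.

Lemma q_basis n (p : {poly R}) : (forall j, (j < n)%N -> P j) -> (size p <= n)%N ->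
  exists c : 'I_n -> R, p = \sum_(j < n) c j *: q j.
Proof.
elim: n p => [|n ih] p Pj szp.
  by exists (fun=> 0); move: szp; rewrite leqn0 size_poly_eq0 big_ord0 => /eqP.
have [mon sz] := mo_monic mo (Pj n (ltnSn n)).
have [||c hc] := ih (p - p`_n *: q n).
- by move=> j jn; apply: Pj; exact: ltnW.
- apply/leq_sizeP => j nj; rewrite coefB coefZ.
  move: nj; rewrite leq_eqVlt => /predU1P[<-|nj].
    have -> : (q n)`_n = 1.
      by move: mon; rewrite monicE lead_coefE sz => /eqP.
    by rewrite mulr1 subrr.
  have qj : (q n)`_j = 0 by rewrite nth_default// sz.
  by rewrite qj (nth_default _ (leq_trans szp nj)) mulr0 subr0.
exists (fun j => if unlift ord_max j is Some i then c i else p`_n).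
rewrite big_ord_recr/= unlift_none -[LHS](subrK (p`_n *: q n)) hc.
congr (_ + _); apply: eq_bigr => j _.
have -> : widen_ord (leqnSn n) j = lift ord_max j.
  by apply: val_inj; rewrite /= /bump leqNgt ltn_ord.
by rewrite liftK.
Qed.

(** Both sides are monic of degree n and orthogonal to the lower q_j, so the difference has degree
    below n and is orthogonal to a basis of the space it lies in. *)
Lemma q_gram_schmidt n : P n -> q n = gram_schmidt n.
Proof.
move=> Pn; have Pj j : (j <= n)%N -> P j.
  by move=> jn k /Pn; exact: leq_ltn_trans.
have hj j : (j <= n)%N -> pdot (q j) (q j) != 0.
  by move=> /Pj /q_norm_pos /gt_eqF ->.
have [mon sz] := mo_monic mo Pn.
apply/eqP; rewrite -subr_eq0; apply/eqP.
set r := q n - _.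
have rorth (i : 'I_n) : pdot r (q i) = 0.
  rewrite /r /gram_schmidt !pdotBl pdot_suml (@q_orth n i); last by move=> E;
    have := ltn_ord i; rewrite -E ltnn.
  rewrite (bigD1 i)//= big1 ?addr0; last first.
    move=> j /eqP ji; rewrite (@q_orth j i) ?mulr0// => E; apply: ji; exact: val_inj.
  by rewrite divfK ?subrr// hj// ltnW.
have [||c hc] := @q_basis n r.
- by move=> j jn; apply: Pj; exact: ltnW.
- apply/leq_sizeP => j nj.
  rewrite /r /gram_schmidt !coefB coefXn coef_sum.
  rewrite big1 ?subr0; last first.
    move=> i _; have [_ szi] := mo_monic mo (Pj i (ltnW (ltn_ord i))).
    by rewrite coefZ nth_default ?mulr0// szi (leq_trans _ nj).
  move: nj; rewrite leq_eqVlt => /predU1P[<-|nj].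
    rewrite eqxx; have -> : (q n)`_n = 1.
      by move: mon; rewrite monicE lead_coefE sz => /eqP.
    by rewrite subrr.
  by rewrite gtn_eqF// nth_default ?subr0// sz.
rewrite hc big1// => i _.
have := rorth i; rewrite hc pdot_suml (bigD1 i)//= big1 ?addr0; last first.
  move=> j /eqP ji; rewrite (@q_orth j i) ?mulr0// => E; apply: ji; exact: val_inj.
move/eqP; rewrite mulf_eq0 (negbTE (hj i (ltnW (ltn_ord i)))) orbF => /eqP ->.
by rewrite scale0r.
Qed.

(** Since q_n = 0, [q_span] makes X^n almost everywhere a combination of lower q_j, hence equal to
    its own projection on them. *)
Lemma gram_schmidt_null n : ~ P n -> pdot (gram_schmidt n) (gram_schmidt n) = 0.
Proof.
move=> nPn; have [c hc] := q_span n.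
have qn0 : q n = 0 by exact: q_eq0.
have hX : {ae m, forall s, ('X^n).[s] = (\sum_(j < n) c (widen_ord (leqnSn n)
  j) *: q j).[s]}.
  apply: filterS hc => s /=; rewrite hornerXn => ->.
  by rewrite big_ord_recr/= qn0 scaler0 addr0.
suff h0 : {ae m, forall s, (gram_schmidt n).[s] = (0 : {poly R}).[s]}.
  by rewrite (pdot_ae _ h0) pdot0l.
apply: filterS hX => s hX; rewrite /gram_schmidt hornerD hX -hornerD.
rewrite -sumrB big1 ?horner0// => j _; apply/eqP; rewrite subr_eq0; apply/eqP.
have [Pj|/q_eq0 ->] := pselect (P j); last by rewrite !scaler0.
congr (_ *: _).
have hj : pdot (q j) (q j) != 0 by rewrite gt_eqF// q_norm_pos.
have hX' : {ae m, forall s, ('X^n).[s] = (\sum_(j < n) c (widen_ord (leqnSn n)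
  j) *: q j).[s]}.
  apply: filterS hc => s' /=; rewrite hornerXn => ->.
  by rewrite big_ord_recr/= qn0 scaler0 addr0.
rewrite (pdot_ae _ hX') pdot_suml (bigD1 j)//= big1 ?addr0 ?mulfK//.
move=> i /eqP ij; rewrite (@q_orth i j) ?mulr0// => E; apply: ij; exact: val_inj.
Qed.

(** The condition on the number of support points becomes a condition on an integral, which is
    measurable in x. *)
Lemma q_formula n : q n = if pdot (gram_schmidt n) (gram_schmidt n) == 0 then 0
  else gram_schmidt n.
Proof.
have [Pn|nPn] := pselect (P n); last by rewrite gram_schmidt_null// eqxx q_eq0.
by rewrite -q_gram_schmidt// gt_eqF// q_norm_pos.
Qed.

Lemma q_total (f : T -> R) :
  (forall g : T -> R, g \in Lfun m 2%:E ->
    (forall n, \int[m]_s (g s * (s : R) ^+ n) = 0) -> g = (fun=> 0) %[ae m]) ->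
  f \in Lfun m 2%:E -> (forall n, \int[m]_s (f s * (q n).[s]) = 0) ->
  f = (fun=> 0) %[ae m].
Proof.
move=> tot lf f0; apply: tot => // n; have [c hc] := q_span n.
have i p : m.-integrable setT (EFin \o (fun s : T => f s * p.[s : R])).
  by apply: L2_integrable_mul => //; exact: poly_L2.
transitivity (\int[m]_s (f s * (\sum_(j < n.+1) c j *: q j).[s])).
  congr fine; apply: ae_eq_integral => //.
  - by have := L2_integrable_mul lf (ml2 n) => /integrableP[].
  - by case/integrableP: (i (\sum_(j < n.+1) c j *: q j)).
  - by apply: filterS hc => s hs _; rewrite /= hs.
suff h k (d : 'I_k -> R) : \int[m]_s (f s * (\sum_(j < k) d j *: q j).[s]) = 0.
  exact: h.
elim: k d => [|k ih] d.
  rewrite big_ord0; under eq_Rintegral do rewrite horner0 mulr0.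
  by rewrite Rintegral_cst// mul0r.
rewrite big_ord_recr/=.
under eq_Rintegral do rewrite hornerD mulrDr.
rewrite RintegralD// ih add0r.
under eq_Rintegral do rewrite hornerZ mulrCA.
by rewrite RintegralZl// f0 mulr0.
Qed.

End one_fiber.

Lemma measurable_inv (R : realType) : measurable_fun [set: R] (fun x : R => x^-1).
Proof.
have m0 : measurable [set 0 : R] by exact: measurable_set1.
have -> : [set: R] = ~` [set 0] `|` [set 0] by rewrite setUC setUv.
apply/measurable_funU => //; first exact: measurableC.
split; last exact: measurable_fun_set1.
apply: open_continuous_measurable_fun.
  by apply: closed_openC; exact: closed_eq.
by move=> x /set_mem /= /eqP x0; apply: continuousV.
Qed.

(** * The one-particle space *)

Section one_particle.
Context {R : realType} {d : nat}.
Local Notation Rd := (euclid R d).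
Local Notation X := (euclid R d * R)%type.
Variable sigma : R.-pker Rd ~> R.
Hypothesis sigma_moments : moment_bound sigma.
Variables (q : nat -> Rd -> {poly R}) (a b : nat -> Rd -> R).
Hypothesis q_orthogonal : forall x,
  monic_orthogonal (sigma x) (fun n => q n x) (fun n => a n x) (fun n => b n x).
Local Notation nu := (base_measure sigma).

Lemma sigma1 x : sigma x [set: R] = 1%E.
Proof. exact: prob_kernel. Qed.

(** The moment bound is local in x; applied to a single point it supplies the constant of that
    fibre. *)
Lemma bounded_borel_set1 (x : Rd) : bounded_borel [set x].
Proof.
split; last by rewrite image_set1; exact/compact_bounded/compact_set1.
rewrite (_ : [set x] = box (fun i => [set tnth x i])).
  by apply: measurable_box => i; exact: measurable_set1.
apply/seteqP; split => y /=; first by move=> ->.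
by move=> h; apply: eq_from_tnth => i; exact: h.
Qed.

Lemma sigma_monomial_L2 x n : (fun s : R => s ^+ n) \in Lfun (sigma x) 2%:E.
Proof.
have [C C0 hC] := sigma_moments (bounded_borel_set1 x).
by apply: (monomial_L2 (sigma1 x) C0) => k k0; exact: hC.
Qed.

Lemma sigma_polynomials_total x (f : R -> R) : f \in Lfun (sigma x) 2%:E ->
  (forall n, \int[sigma x]_s (f s * s ^+ n) = 0) -> f = (fun=> 0) %[ae (sigma x)].
Proof.
have [C C0 hC] := sigma_moments (bounded_borel_set1 x).
by apply: (polynomials_total (sigma1 x) C0) => k k0; exact: hC.
Qed.

Lemma measurable_Rintegral_kernel (f : X -> R) : measurable_fun [set: X] f ->
  measurable_fun [set: Rd] (fun x => \int[sigma x]_s f (x, s)).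
Proof.
move=> mf; apply: measurableT_comp => //.
apply: (@measurable_integral_kernel _ _ _ _ _ _ (EFin \o f)).
exact/measurable_EFinP.
Qed.

Definition qval n (z : X) : R := (q n z.1).[z.2].

(** By strong induction: the Gram-Schmidt coefficients are quotients of fibre integrals of lower
    polynomials, and the test of [q_formula] is on a fibre integral as well. *)
Lemma measurable_qval n : measurable_fun [set: X] (qval n).
Proof.
elim/ltn_ind: n => n ih.
have mfst (g : Rd -> R) : measurable_fun [set: Rd] g ->
    measurable_fun [set: X] (fun z => g z.1).
  by move=> mg; exact: measurableT_comp.
have mX k : measurable_fun [set: X] (fun z : X => z.2 ^+ k).
  by apply: measurable_funX.
pose cf j x : R := pdot (sigma x) 'X^n (q j x) / pdot (sigma x) (q j x) (q j x).
have mcf j : (j < n)%N -> measurable_fun [set: Rd] (cf j).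
  move=> jn; apply: measurable_funM; last (apply: (measurableT_comp (@measurable_inv R))).
    rewrite (_ : (fun x => _) = (fun x => \int[sigma x]_s ((x, s).2 ^+ n * qval
      j (x, s)))).
      apply: (measurable_Rintegral_kernel (f := fun z => z.2 ^+ n * qval j z)).
      by apply: measurable_funM => //; exact: ih.
    by apply/funext => x; apply: eq_Rintegral => s _; rewrite hornerXn.
  apply: (measurable_Rintegral_kernel (f := fun z => qval j z * qval j z)).
  by apply: measurable_funM; exact: ih.
pose G (z : X) : R := z.2 ^+ n - \sum_(j < n) cf j z.1 * qval j z.
have mG : measurable_fun [set: X] G.
  apply: measurable_funB => //; apply: measurable_sum => j.
  by apply: measurable_funM; [apply: mfst; exact: mcf|exact: ih].
have GE z : G z = (gram_schmidt (sigma z.1) (fun n => q n z.1) n).[z.2].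
  rewrite /gram_schmidt hornerD hornerN hornerXn horner_sum; congr (_ - _).
  by apply: eq_bigr => j _; rewrite hornerZ.
pose N x := \int[sigma x]_s (G (x, s) * G (x, s)).
have mN : measurable_fun [set: Rd] N.
  apply: (measurable_Rintegral_kernel (f := fun z => G z * G z)).
  exact: measurable_funM.
have -> : qval n = fun z => if N z.1 == 0 then 0 else G z.
  apply/funext => z; rewrite /qval.
  rewrite (q_formula (sigma1 z.1) (sigma_monomial_L2 z.1) (q_orthogonal z.1)).
  rewrite (_ : pdot _ _ _ = N z.1).
    by case: ifP => _; rewrite ?horner0// GE.
  by apply: eq_Rintegral => s _; rewrite !GE.
apply: measurable_fun_ifT => //.
apply: (measurable_fun_bool true).
rewrite setTI (_ : _ @^-1` _ = (fun z : X => N z.1) @^-1` [set 0]).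
  by rewrite -[X in measurable X]setTI; apply: mfst.
by apply/seteqP; split => z /= /eqP.
Qed.

Lemma measurable_q_norm n :
  measurable_fun [set: Rd] (fun x => \int[sigma x]_s ((q n x).[s] ^+ 2)).
Proof.
apply: (measurable_Rintegral_kernel (f := fun z => qval n z ^+ 2)).
by apply: measurable_funX; exact: measurable_qval.
Qed.

Lemma q_norm_EFin n x : (\int[sigma x]_s ((q n x).[s] ^+ 2)%:E =
  (\int[sigma x]_s ((q n x).[s] ^+ 2))%:E)%E.
Proof.
have lq := poly_L2 (sigma_monomial_L2 x) (q n x).
by rewrite fineK//; exact: integrable_fin_num (Lfun2_integrable_sqr lq).
Qed.

Lemma ge0_integral_rho n (f : Rd -> \bar R) : measurable_fun [set: Rd] f ->
  (forall x, 0 <= f x)%E ->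
  (\int[rho sigma q n]_x f x = \int[nu]_z (f z.1 * (qval n z ^+ 2)%:E))%E.
Proof.
move=> mf f0.
have mq2 : measurable_fun [set: X] (fun z => (qval n z ^+ 2)%:E).
  by apply/measurable_EFinP/measurable_funX; exact: measurable_qval.
have q20 z : (0 <= (qval n z ^+ 2)%:E)%E by rewrite lee_fin sqr_ge0.
have mfst (g : Rd -> \bar R) : measurable_fun [set: Rd] g ->
    measurable_fun [set: X] (fun z => g z.1 * (qval n z ^+ 2)%:E)%E.
  by move=> mg; apply: emeasurable_funM => //; exact: measurableT_comp.
symmetry; apply: (@ge0_integral_ext _ _ _ (rho sigma q n)
  (fun f => \int[nu]_z (f z.1 * (qval n z ^+ 2)%:E))%E) => //.
- move=> A mA; rewrite /base_measure ge0_integral_kernel; last 2 first.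
  + apply: (mfst (fun x => (\1_A x)%:E)).
    by apply/measurable_EFinP; exact: measurable_indic.
  + by move=> z; rewrite mule_ge0.
  rewrite [RHS]integral_mkcond; apply: eq_integral => x _.
  have mqx : measurable_fun [set: R] (fun s => (qval n (x, s) ^+ 2)%:E).
    exact: measurable_kernel_section mq2.
  rewrite /= ge0_integralZl// ?lee_fin// q_norm_EFin patchE indicE.
  case: ifP => _; last by rewrite mul0e.
  (* Measurability of the norm of q_n rules out the default density 0. *)
  rewrite mul1e /density_fun; case: asboolP => [_|/(_ (measurable_q_norm n))//].
  by rewrite ger0_norm//; apply: Rintegral_ge0 => s _; exact: sqr_ge0.
- move=> c g c0 mg g0.
  rewrite -ge0_integralZl// ?lee_fin//; last 2 first.
  + exact: mfst.
  + by move=> z _; rewrite mule_ge0.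
  by apply: eq_integral => z _; rewrite muleA.
- move=> g h mg mh g0 h0; rewrite -ge0_integralD//; last 4 first.
  + by move=> z _; rewrite mule_ge0.
  + exact: mfst.
  + by move=> z _; rewrite mule_ge0.
  + exact: mfst.
  by apply: eq_integral => z _; rewrite ge0_muleDl.
- move=> g mg g0 ndg; rewrite -monotone_convergence//; last 3 first.
  + by move=> k; exact: mfst.
  + by move=> k z _; rewrite mule_ge0.
  + by move=> z _ k l kl; rewrite lee_wpmul2r// ndg.
  apply: eq_integral => z _; rewrite muleC -limeMl//.
    by congr (limn _); apply/funext => k; rewrite muleC.
  by apply: ereal_nondecreasing_is_cvgn => k l kl; exact: ndg.
Qed.

End one_particle.

Section n_particles.
Context {R : realType} {d : nat}.
Local Notation Rd := (euclid R d).
Local Notation X := (euclid R d * R)%type.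
Variable sigma : R.-pker Rd ~> R.
Hypothesis sigma_moments : moment_bound sigma.
Variables (q : nat -> Rd -> {poly R}) (a b : nat -> Rd -> R).
Hypothesis q_orthogonal : forall x,
  monic_orthogonal (sigma x) (fun n => q n x) (fun n => a n x) (fun n => b n x).
Local Notation nu := (base_measure sigma).
Local Notation rhoc c := (fun j => rho sigma q (c j)).

Let mq := measurable_qval sigma_moments q_orthogonal.
Let rhoE := ge0_integral_rho sigma_moments q_orthogonal.

Definition color_fun n (f : Rd -> R) (z : X) : R := f z.1 * qval q n z.

Lemma color_fun_L2 n f : f \in Lfun (rho sigma q n) 2%:E ->
  color_fun n f \in Lfun nu 2%:E.
Proof.
move=> /L2P[mf f2]; apply/L2P; split.
  by apply: measurable_funM; [exact: measurableT_comp|exact: mq].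
apply: le_lt_trans f2; rewrite rhoE; last 2 first.
- by apply/measurable_EFinP; exact: measurable_funX.
- by move=> x; rewrite lee_fin sqr_ge0.
rewrite le_eqVlt; apply/orP; left; apply/eqP; apply: eq_integral => z _.
by rewrite -EFinM exprMn.
Qed.

(** F is tested against f_n q^(n), where f_n = G_n / h_n is the Fourier coefficient of F(x,.) along
    q^(n). The pairing is the integral of G_n^2 / h_n, so almost every fibre of F is orthogonal to
    all q^(n) and vanishes by [q_total]. *)
Lemma one_particle_total : total nu
  [set e | exists n f, f \in Lfun (rho sigma q n) 2%:E /\ e = color_fun n f].
Proof.
move=> F lF F0; have [mF F2] := (L2P _ _).1 lF.
have mF2 : measurable_fun [set: X] (fun z => (F z ^+ 2)%:E).
  by apply/measurable_EFinP; exact: measurable_funX.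
have F20 z : (0 <= (F z ^+ 2)%:E)%E by rewrite lee_fin sqr_ge0.
pose S x := (\int[sigma x]_s (F (x, s) ^+ 2)%:E)%E.
have S0 x : (0 <= S x)%E by apply: integral_ge0.
have mS : measurable_fun [set: Rd] S.
  exact: (@measurable_integral_kernel _ _ _ _ _ _ (fun z => (F z ^+ 2)%:E)).
have intS : (\int[lebesgue_euclid]_x S x < +oo)%E.
  by move: F2; rewrite /base_measure ge0_integral_kernel.
have aeS : {ae lebesgue_euclid, forall x, (S x < +oo)%E}.
  have iS : (@lebesgue_euclid R d).-integrable setT S.
    apply/integrableP; split => //.
    by under eq_integral do rewrite gee0_abs//.
  have := integrable_ae measurableT iS.
  by apply: filterS => x /(_ Logic.I); rewrite ge0_fin_numE.
have mFx x : measurable_fun [set: R] (fun s => F (x, s)).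
  by apply: measurableT_comp => //; exact: measurable_pair1.
have lFx x : (S x < +oo)%E -> (fun s => F (x, s)) \in Lfun (sigma x) 2%:E.
  by move=> Sx; apply/L2P.
have lq n x := poly_L2 (sigma_monomial_L2 sigma_moments x) (q n x).
pose G n x := \int[sigma x]_s (F (x, s) * (q n x).[s]).
pose h n x := \int[sigma x]_s ((q n x).[s] ^+ 2).
have h0 n x : 0 <= h n x by apply: Rintegral_ge0 => s _; exact: sqr_ge0.
have mG n : measurable_fun [set: Rd] (G n).
  apply: (@measurable_Rintegral_kernel _ _ sigma (fun z => F z * qval q n z)).
  by apply: measurable_funM => //; exact: mq.
have mh n : measurable_fun [set: Rd] (h n).
  exact: (measurable_q_norm sigma_moments q_orthogonal).
have CS n x : (S x < +oo)%E -> G n x ^+ 2 <= fine (S x) * h n x.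
  move=> Sx; have := hdot_CS (hl2_prehilbert (sigma x)) (lFx x Sx) (lq n x).
  by rewrite L2_hnorm2 /hnorm2 /= /h; under [X in _ * X]eq_Rintegral do rewrite -expr2.
(* Where h_n(x) = 0 this is 0; there G_n(x) = 0 too, by Cauchy-Schwarz, if S(x) is finite. *)
pose f n x := G n x / h n x.
have mf n : measurable_fun [set: Rd] (f n).
  by apply: measurable_funM => //; exact: (measurableT_comp (@measurable_inv R)).
(* Bessel's inequality for one coefficient; it puts f_n in L^2(rho_n). *)
have fh n x : (S x < +oo)%E -> f n x ^+ 2 * h n x <= fine (S x).
  move=> Sx; rewrite /f; have [->|hn] := eqVneq (h n x) 0.
    by rewrite mulr0 fine_ge0.
  have hp : 0 < h n x by rewrite lt_neqAle eq_sym hn h0.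
  have -> : (G n x / h n x) ^+ 2 * h n x = G n x ^+ 2 / h n x by field.
  by rewrite ler_pdivrMr// CS.
have lf n : f n \in Lfun (rho sigma q n) 2%:E.
  apply/L2P; split => //; rewrite rhoE; last 2 first.
  - by apply/measurable_EFinP; exact: measurable_funX.
  - by move=> x; rewrite lee_fin sqr_ge0.
  apply: le_lt_trans intS; rewrite /base_measure ge0_integral_kernel; last 2 first.
  - apply: emeasurable_funM; apply/measurable_EFinP/measurable_funX.
      exact: measurableT_comp.
    exact: mq.
  - by move=> z; rewrite mule_ge0// lee_fin sqr_ge0.
  have mq2 x : measurable_fun [set: R] (fun s => (qval q n (x, s) ^+ 2)%:E).
    have := (measurable_EFinP _ _).2 (measurable_funX 2 (mq n)).
    exact: measurable_kernel_section.
  have E x : (\int[sigma x]_s ((f n x ^+ 2)%:E * (qval q n (x, s) ^+ 2)%:E) =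
      (f n x ^+ 2 * h n x)%:E)%E.
    rewrite ge0_integralZl ?lee_fin ?sqr_ge0//; last first.
      by move=> s _; rewrite lee_fin sqr_ge0.
    by rewrite (q_norm_EFin sigma_moments) EFinM.
  under eq_integral => x _ do rewrite E.
  apply: ge0_le_integral => //.
  - by move=> x _; rewrite lee_fin mulr_ge0// sqr_ge0.
  - by apply/measurable_EFinP/measurable_funM => //; exact: measurable_funX.
  move=> x _; have [Sx|] := ltP (S x) +oo%E.
    by rewrite -[S x]fineK ?lee_fin ?fh// ge0_fin_numE.
  by rewrite leye_eq => /eqP ->; rewrite leey.
have G0 n : {ae lebesgue_euclid, forall x, G n x = 0}.
  have le : color_fun n (f n) \in Lfun nu 2%:E by exact: color_fun_L2.
  have iF := L2_integrable_mul lF le.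
  have : (\int[nu]_z (F z * color_fun n (f n) z)%:E = 0)%E.
    rewrite -[LHS]fineK; last exact: integrable_fin_num iF.
    congr EFin; apply: F0; exists n, (f n); split => //; exact: lf.
  rewrite /base_measure integral_kernel//.
  have E : {ae lebesgue_euclid, forall x, setT x ->
      (\int[sigma x]_s (F (x, s) * color_fun n (f n) (x, s))%:E =
       (f n x ^+ 2 * h n x)%:E)%E}.
    move: aeS; apply: filterS => x Sx _.
    have i := L2_integrable_mul (lFx x Sx) (lq n x).
    transitivity (\int[sigma x]_s ((f n x)%:E * (F (x, s) * (q n x).[s])%:E))%E.
      by apply: eq_integral => s _; rewrite -EFinM /color_fun /qval /= mulrCA.
    rewrite integralZl// -[X in (_ * X)%E]fineK ?(integrable_fin_num _ i)// -EFinM.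
    congr EFin; rewrite -[fine _]/(G n x).
    have [hn|hn] := eqVneq (h n x) 0; last first.
      have -> : G n x = f n x * h n x by rewrite /f divfK.
      by rewrite mulrA -expr2.
    have := CS n x Sx; rewrite hn !mulr0 => G2.
    have -> : G n x = 0 by apply/eqP; rewrite -sqrf_eq0 eq_le G2 sqr_ge0.
    by rewrite mulr0.
  have mfh : measurable_fun [set: Rd] (fun x => (f n x ^+ 2 * h n x)%:E).
    by apply/measurable_EFinP/measurable_funM => //; exact: measurable_funX.
  rewrite (ae_eq_integral (fun x => (f n x ^+ 2 * h n x)%:E))//; last first.
    apply: (@measurable_integral_kernel _ _ _ _ _ _
      (fun z => (F z * color_fun n (f n) z)%:E)).
    apply/measurable_EFinP/measurable_funM => //.
    exact: L2_measurable le.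
  move=> I0; have := (@ae_eq_integral_abs _ _ _ lebesgue_euclid _ measurableT _ mfh).1.
  have -> : (\int[lebesgue_euclid]_x `|(f n x ^+ 2 * h n x)%:E| = 0)%E.
    rewrite -[RHS]I0; apply: eq_integral => x _.
    by rewrite gee0_abs// lee_fin mulr_ge0// sqr_ge0.
  move=> /(_ erefl); move: aeS; apply: filterS2 => x Sx /(_ Logic.I) [] /eqP.
  have := CS n x Sx; rewrite mulf_eq0 sqrf_eq0 /f mulf_eq0 invr_eq0.
  move=> hcs /orP[/orP[/eqP//|/eqP hn]|/eqP hn].
    move: hcs; rewrite hn mulr0 => hcs.
    by apply/eqP; rewrite -sqrf_eq0 eq_le hcs sqr_ge0.
  move: hcs; rewrite hn mulr0 => hcs.
  by apply/eqP; rewrite -sqrf_eq0 eq_le hcs sqr_ge0.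
have S00 : {ae lebesgue_euclid, forall x, [set: Rd] x -> S x = 0%E}.
  have {}G0 := ae_foralln G0.
  move: aeS G0; apply: filterS2 => x Sx Gx _.
  have Fx0 := q_total (sigma1 sigma x) (sigma_monomial_L2 sigma_moments x)
    (q_orthogonal x) (@sigma_polynomials_total _ _ _ sigma_moments x) (lFx x Sx) Gx.
  have H := (L2_hnorm2_eq0 (lFx x Sx)).2 Fx0.
  by have := L2_hnorm2E (lFx x Sx); rewrite H => E; rewrite [LHS](esym E).
apply: (L2_hnorm2_eq0 lF).1; apply/eqP; rewrite -eqe L2_hnorm2E//; apply/eqP.
rewrite /base_measure ge0_integral_kernel//.
by rewrite (ae_eq_integral (cst 0%E))// integral0.
Qed.

End n_particles.

(** * Tensors colored by degrees *)

Section colored_tensors.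
Context {R : realType} {d : nat}.
Local Notation Rd := (euclid R d).
Local Notation X := (euclid R d * R)%type.
Variable sigma : R.-pker Rd ~> R.
Hypothesis sigma_moments : moment_bound sigma.
Variables (q : nat -> Rd -> {poly R}) (a b : nat -> Rd -> R).
Hypothesis q_orthogonal : forall x,
  monic_orthogonal (sigma x) (fun n => q n x) (fun n => a n x) (fun n => b n x).
Local Notation nu := (base_measure sigma).
Local Notation nuP n := (prod_measure n (fun=> base_measure sigma)).
Local Notation rhoP n c := (prod_measure n (fun j => rho sigma q (c j))).

Let mq := measurable_qval sigma_moments q_orthogonal.
Let rhoE := ge0_integral_rho sigma_moments q_orthogonal.

Definition positions n (t : n.-tuple X) : n.-tuple Rd :=
  [tuple (tnth t j).1 | j < n].

Definition qprod n (c : nat -> nat) (t : n.-tuple X) : R :=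
  \prod_(j < n) qval q (c j) (tnth t j).

Definition colored n (c : nat -> nat) (f : n.-tuple Rd -> R) (t : n.-tuple X) : R :=
  f (positions t) * qprod c t.

Lemma positions_cons n (z : X) (t : n.-tuple X) :
  positions (tcons (z, t)) = tcons (z.1, positions t).
Proof.
apply: eq_from_tnth => i; case: (unliftP ord0 i) => [j ->|->].
  by rewrite tnth_mktuple /tcons !tnthS tnth_mktuple.
by rewrite tnth_mktuple.
Qed.

Lemma qprod_cons n c (z : X) (t : n.-tuple X) :
  qprod c (tcons (z, t)) = qval q (c 0) z * qprod (fun j => c j.+1) t.
Proof.
rewrite /qprod big_ord_recl; congr (_ * _).
by apply: eq_bigr => j _; rewrite /tcons tnthS.
Qed.

Lemma measurable_positions n : measurable_fun [set: n.-tuple X] (@positions n).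
Proof.
apply/measurable_fun_tnthP => i.
rewrite (_ : _ \o _ = fun t : n.-tuple X => (tnth t i).1).
  by apply: (measurableT_comp measurable_fst); exact: measurable_tnth.
by apply/funext => t /=; rewrite tnth_mktuple.
Qed.

Lemma measurable_qprod n c : measurable_fun [set: n.-tuple X] (@qprod n c).
Proof.
apply: measurable_prod => j _.
by apply: (measurableT_comp (mq (c j))); exact: measurable_tnth.
Qed.

Lemma measurable_colored n c (f : n.-tuple Rd -> R) :
  measurable_fun [set: n.-tuple Rd] f -> measurable_fun [set: n.-tuple X] (colored c f).
Proof.
move=> mf; apply: measurable_funM; last exact: measurable_qprod.
by apply: (measurableT_comp mf); exact: measurable_positions.
Qed.

Lemma ge0_integral_colored n c (f : n.-tuple Rd -> \bar R) :
  measurable_fun [set: n.-tuple Rd] f -> (forall y, 0 <= f y)%E ->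
  (\int[rhoP n c]_y f y = \int[nuP n]_t (f (positions t) * (qprod c t ^+ 2)%:E))%E.
Proof.
elim: n c f => [|n ih] c f mf f0.
  have mR : measurable_fun [set: 0.-tuple X]
      (fun t => f (positions t) * (qprod c t ^+ 2)%:E)%E.
    apply: emeasurable_funM.
      by apply: (measurableT_comp mf); exact: measurable_positions.
    by apply/measurable_EFinP/measurable_funX; exact: measurable_qprod.
  rewrite /= !integral_dirac//= !diracT !mul1e /qprod big_ord0 expr1n mule1.
  by congr (f _); rewrite [RHS]tuple0.
have mR : measurable_fun [set: n.+1.-tuple X]
    (fun t => f (positions t) * (qprod c t ^+ 2)%:E)%E.
  apply: emeasurable_funM.
    by apply: (measurableT_comp mf); exact: measurable_positions.
  by apply/measurable_EFinP/measurable_funX; exact: measurable_qprod.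
pose c' j := c j.+1.
rewrite [LHS](ge0_integral_cons _ _ mf f0).
rewrite [RHS](ge0_integral_cons _ _ mR); last first.
  by move=> t; rewrite mule_ge0// lee_fin sqr_ge0.
have mt := @measurable_tcons _ Rd n.
have mfx (x : Rd) : measurable_fun [set: n.-tuple Rd] (fun y => f (tcons (x, y))).
  apply: (measurableT_comp mf); apply: (measurableT_comp mt).
  exact: measurable_pair1.
rewrite rhoE; last 2 first.
- exact: (@measurable_fun_fubini_tonelli_F _ _ _ _ _ (rhoP n c') (f \o @tcons _ Rd n)
    (measurableT_comp mf mt) (fun=> f0 _)).
- by move=> x; exact: integral_ge0.
apply: eq_integral => z _; rewrite (ih c')// muleC -ge0_integralZl//.
- by apply: eq_integral => t _; rewrite positions_cons qprod_cons exprMn EFinM muleCA.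
- apply: emeasurable_funM.
    by apply: (measurableT_comp (mfx z.1)); exact: measurable_positions.
  by apply/measurable_EFinP/measurable_funX; exact: measurable_qprod.
- by move=> t _; rewrite mule_ge0// lee_fin sqr_ge0.
- by rewrite lee_fin sqr_ge0.
Qed.

Lemma colored_sqr n c (f : n.-tuple Rd -> R) : measurable_fun [set: n.-tuple Rd] f ->
  (\int[nuP n]_t (colored c f t ^+ 2)%:E = \int[rhoP n c]_y (f y ^+ 2)%:E)%E.
Proof.
move=> mf; rewrite ge0_integral_colored.
- by apply: eq_integral => t _; rewrite -EFinM exprMn.
- by apply/measurable_EFinP; exact: measurable_funX.
- by move=> y; rewrite lee_fin sqr_ge0.
Qed.

Lemma colored_L2 n c (f : n.-tuple Rd -> R) : measurable_fun [set: n.-tuple Rd] f ->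
  colored c f \in Lfun (nuP n) 2%:E <-> f \in Lfun (rhoP n c) 2%:E.
Proof.
move=> mf; split => /L2P[_ f2]; apply/L2P; split => //.
- by rewrite -colored_sqr.
- exact: measurable_colored.
- by rewrite colored_sqr.
Qed.

Lemma colored_lin n c k (f g : n.-tuple Rd -> R) :
  colored c (k *: f + g) = k *: colored c f + colored c g.
Proof.
apply/funext => t; rewrite /colored.
have -> : (k *: f + g) (positions t) = k * f (positions t) + g (positions t) by [].
by rewrite mulrDl -mulrA.
Qed.

Lemma colored_hnorm2 n c (f : hl2 (rhoP n c)) :
  measurable_fun [set: n.-tuple Rd] f ->
  hnorm2 (colored c f : hl2 (nuP n)) = hnorm2 f.
Proof. by move=> mf; rewrite !L2_hnorm2 colored_sqr. Qed.

(** Polarization of [colored_hnorm2]. *)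
Lemma colored_dot n c (f g : hl2 (rhoP n c)) : hmem _ f -> hmem _ g ->
  hdot (hl2 (nuP n)) (colored c f) (colored c g) = hdot _ f g.
Proof.
move=> lf lg; have mf := L2_measurable lf; have mg := L2_measurable lg.
have pG := hl2_prehilbert (rhoP n c); have pF := hl2_prehilbert (nuP n).
have ljf : hmem (hl2 (nuP n)) (colored c f) by apply/(colored_L2 c mf).
have ljg : hmem (hl2 (nuP n)) (colored c g) by apply/(colored_L2 c mg).
have := hnorm2D pF ljf ljg; have := hnorm2D pG lf lg.
have -> : colored c f + colored c g = colored c (f + g).
  by have := colored_lin c 1 f g; rewrite !scale1r.
rewrite !colored_hnorm2//; last exact: measurable_funD.
lra.
Qed.

(** The function [g] is arbitrary so that the induction can absorb the factors of the first
    coordinate into it; integrability is assumed because Fubini is used in either order. *)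
Lemma colored_orthogonal n (c c' : nat -> nat) (g : n.-tuple Rd -> R) :
  (exists2 j, (j < n)%N & c j <> c' j) ->
  (nuP n).-integrable [set: n.-tuple X]
    (fun t => (g (positions t) * (qprod c t * qprod c' t))%:E) ->
  (\int[nuP n]_t (g (positions t) * (qprod c t * qprod c' t))%:E = 0)%E.
Proof.
elim: n c c' g => [|n ih] c c' g [j jn cj] ig; first by [].
have e z t : g (positions (tcons (z, t))) *
   (qprod c (tcons (z, t)) * qprod c' (tcons (z, t))) =
   (g (tcons (z.1, positions t)) * (qval q (c 0) z * qval q (c' 0) z)) *
   (qprod (fun j => c j.+1) t * qprod (fun j => c' j.+1) t).
  by rewrite positions_cons !qprod_cons; ring.
have i2 := integrable_cons ig.
rewrite [LHS](integral_cons ig).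
(* If the first colors agree, they differ later: the first coordinate is frozen and the tail
   integrates to 0 by induction. Otherwise the tail is frozen, and the integral over s in the first
   coordinate vanishes by orthogonality of the polynomials. *)
have [c0|c0] := eqVneq (c 0%N) (c' 0%N).
  rewrite -(integral12_prod_meas1 i2) /fubini_F.
  rewrite (ae_eq_integral (cst 0%E))//; first exact: integral0.
    exact: (measurable_fubini_F i2).
  have := ae_integrable1 i2; apply: filterS => z iz _ /=.
  rewrite (eq_integral (fun t => ((g (tcons (z.1, positions t)) *
    (qval q (c 0) z * qval q (c' 0) z)) *
    (qprod (fun j => c j.+1) t * qprod (fun j => c' j.+1) t))%:E)); last first.
    by move=> t _; congr EFin; exact: e.
  apply: (ih (fun j => c j.+1) (fun j => c' j.+1)
    (fun y => g (tcons (z.1, y)) * (qval q (c 0) z * qval q (c' 0) z))).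
    by case: j jn cj => // j jn cj; exists j.
  by apply: (eq_integrable _ _ _ _ iz) => // t _; congr EFin; exact: e.
rewrite -(integral21_prod_meas1 i2) /fubini_G.
rewrite (ae_eq_integral (cst 0%E))//; first exact: integral0.
  exact: (measurable_fubini_G i2).
have := ae_integrable2 i2; apply: filterS => t it _ /=.
rewrite /base_measure integral_kernel//; apply: integral0_eq => x _.
set K := g (tcons (x, positions t)) *
  (qprod (fun j => c j.+1) t * qprod (fun j => c' j.+1) t).
have ip := poly_integrable_mul (sigma_monomial_L2 sigma_moments x)
  (q (c 0%N) x) (q (c' 0%N) x).
rewrite (eq_integral (fun s => K%:E * ((q (c 0%N) x).[s] * (q (c' 0%N) x).[s])%:E)%E).
  rewrite integralZl// -[X in (_ * X)%E]fineK; last exact: integrable_fin_num.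
  by rewrite [fine _](mo_orth (q_orthogonal x) (elimN eqP c0)) mule0.
by move=> s _; rewrite -EFinM; congr EFin; rewrite [LHS]e /K /qval /=; ring.
Qed.

Definition colored_tensors n : set (n.-tuple X -> R) :=
  [set e | exists c f, f \in Lfun (rhoP n c) 2%:E /\ e = colored c f].

Lemma colored_total n : total (nuP n) (@colored_tensors n).
Proof.
elim: n => [|n ih].
  (* The space of 0-tuples is one point of mass 1, so orthogonality to the constant 1 is enough. *)
  move=> F lF F0.
  have mF := L2_measurable lF.
  have l1 : (fun=> 1) \in Lfun (rhoP 0 id) 2%:E.
    apply/L2P; split; first exact: measurable_cst.
    by rewrite expr1n integral_cst//= diracT mule1 ltry.
  have := F0 _ (ex_intro _ id (ex_intro _ _ (conj l1 erefl))).
  rewrite /Rintegral integral_dirac//=; last first.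
    apply/measurable_EFinP/measurable_funM => //.
    by apply: measurable_colored; exact: measurable_cst.
  rewrite indicT mul1r /colored /qprod big_ord0 !mulr1 => F00.
  by apply: aeW => t _; rewrite -[RHS]F00; congr (F _); rewrite [LHS]tuple0.
have sub m E E' : E `<=` E' -> total (nuP m) E -> total (nuP m) E'.
  by move=> EE' tE F lF F0; apply: tE => // e Ee; apply: F0; exact: EE'.
apply: sub (total_cons _ _ (one_particle_total sigma_moments q_orthogonal) ih).
- move=> _ [_ [_ [[i [f [lf ->]]] [c [g [lg ->]]] ->]]].
  exists (fun j => if j is j'.+1 then c j' else i).
  exists (fun y => f (thead y) * g [tuple of behead y]); split.
    exact: L2_tensor_cons.
  apply/funext => t; rewrite /color_fun /colored.
  have -> : t = tcons (thead t, [tuple of behead t]).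
    by rewrite [LHS]tuple_eta; exact: val_inj.
  rewrite positions_cons qprod_cons /= !theadE.
  set t' := [tuple of behead t].
  have -> : [tuple of behead (tcons (thead t, t'))] = t' by exact: val_inj.
  have -> : [tuple of behead (tcons ((thead t).1, positions t'))] = positions t'.
    exact: val_inj.
  by ring.
- by move=> _ [i [f [lf ->]]]; exact: (color_fun_L2 sigma_moments q_orthogonal lf).
- by move=> _ [c [g [lg ->]]]; apply/(colored_L2 c (L2_measurable lg)).
Qed.

End colored_tensors.

(** * Permutations preserving a coloring *)

Section color_permutations.
Local Open Scope nat_scope.

Lemma lift_perm_surj n (i : 'I_n.+1) (s : 'S_n.+1) :
  exists s', s = lift_perm i (s i) s'.
Proof.
have ex k : {k' | s (lift i k) = lift (s i) k'}.
  have : s i != s (lift i k) by rewrite (inj_eq perm_inj) neq_lift.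
  by move=> /unlift_some[k' ? _]; exists k'.
pose f k := sval (ex k); have fE k : s (lift i k) = lift (s i) (f k) by rewrite
  /f; case: (ex k).
have injf : injective f.
  by move=> k k' ff; apply: (@lift_inj _ i); apply: (@perm_inj _ s); rewrite !fE ff.
exists (perm injf); apply/permP => k; case: (unliftP i k) => [k'|] ->.
  by rewrite lift_perm_lift permE fE.
by rewrite lift_perm_id.
Qed.

Lemma lift_perm_inj n (i j : 'I_n.+1) : injective (lift_perm i j).
Proof.
move=> s s' ss'; apply/permP => k; apply: (@lift_inj _ j).
by rewrite -!(lift_perm_lift i) ss'.
Qed.

Definition color_perms n (c c' : 'I_n -> nat) : {set 'S_n} :=
  finset (fun s : 'S_n => [forall j, c' (s j) == c j]).

(** Two colorings are needed for the induction: sending position 0 to k removes different positions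
    from the source and the target, and what remains is a pair of colorings with equal counts. [K]
    bounds the colors so that the product is finite. *)
Lemma card_color_perms n (c c' : 'I_n -> nat) (K : nat) : (forall j, c j < K) ->
  (forall i, \sum_(j < n) (c j == i) = \sum_(j < n) (c' j == i)) ->
  #|color_perms c c'| = \prod_(i < K) (\sum_(j < n) (c j == i))`!.
Proof.
elim: n c c' => [|n ih] c c' cK cc'.
  rewrite big1 => [|i _]; last by rewrite big_ord0.
  rewrite (_ : color_perms c c' = finset predT) ?cardsT ?card_Sn//.
  by apply/setP => s; rewrite !inE; apply/forallP => -[].
pose e i := \sum_(j < n) (c (lift ord0 j) == i).
have cE i : \sum_(j < n.+1) (c j == i) = (c ord0 == i) + e i by rewrite big_ord_recl.
rewrite -sum1_card (partition_big (fun s : 'S_n.+1 => s ord0) predT)//=.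
have fiber k : \sum_(s in color_perms c c' | s ord0 == k) 1 =
    (c' k == c ord0) * \prod_(i < K) (e i)`!.
  have [ck|ck] := eqVneq (c' k) (c ord0); last first.
    rewrite big_pred0 // => s; apply/negbTE/negP => /andP[].
    by rewrite inE => /forallP/(_ ord0)/eqP cs /eqP sk; rewrite -cs sk eqxx in ck.
  rewrite mul1n -(ih (fun j => c (lift ord0 j)) (fun j => c' (lift k j))).
  - rewrite -(card_imset _ (@lift_perm_inj n ord0 k)) -sum1_card; apply: eq_bigl => s.
    apply/andP/imsetP => [[]|[s' + ->]].
      rewrite inE => /forallP cs /eqP sk; have [s' sE] := lift_perm_surj ord0 s.
      exists s'; last by rewrite sE sk.
      rewrite inE; apply/forallP => j; have := cs (lift ord0 j).
      by rewrite sE lift_perm_lift sk.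
    rewrite !inE => /forallP cs; split; last by rewrite lift_perm_id.
    apply/forallP => j; case: (unliftP ord0 j) => [j'|] ->.
      by rewrite lift_perm_lift; exact: cs.
    by rewrite lift_perm_id ck.
  - by move=> j; exact: cK.
  - move=> i; have := cc' i; rewrite cE (bigD1_ord k)//= ck.
    by move/addnI.
(* The admissible images k of position 0 number one more than the remaining positions of the same
   color, which completes that color's factorial. *)
rewrite (eq_bigr _ (fun k _ => fiber k)) -big_distrl /= -cc' cE eqxx add1n.
rewrite (bigD1 (Ordinal (cK ord0)))//= [RHS](bigD1 (Ordinal (cK ord0)))//=.
rewrite cE eqxx add1n factS mulnA; congr (_ * _).
apply: eq_bigr => i ic0; rewrite cE [_ == _ :> nat](_ : _ = false)//.
by apply/eqP => ci; move/eqP: ic0; apply; exact: val_inj.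
Qed.

Lemma sum_color alpha i : \sum_(j < deg alpha) (color alpha j == i) = alpha i.
Proof.
rewrite -count_colors -sum1_count (big_nth 0) big_mkord [RHS]big_mkcond.
by apply: eq_bigr => j _; rewrite /color /=; case: eqP.
Qed.

Lemma card_block_perms alpha :
  #|color_perms (fun j : 'I_(deg alpha) => color alpha j) (fun j => color alpha j)| =
  mfact alpha.
Proof.
have [K aK] : exists K, forall i, i \in finsupp alpha -> i < K.
  exists (\max_(i <- finsupp alpha) i).+1 => i ia; rewrite ltnS; exact:
    (@leq_bigmax_seq _ _ xpredT id).
rewrite (@card_color_perms _ _ _ K)//; last first.
  move=> j; apply: aK; rewrite mem_finsupp -count_colors -lt0n -has_count.
  by rewrite has_pred1 mem_nth.
under eq_bigr => i _ do rewrite sum_color.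
rewrite -(big_mkord xpredT (fun i => (alpha i)`!)) /index_iota subn0.
rewrite (bigID (fun i => i \in finsupp alpha))/= [X in _ * X]big1 ?muln1; last first.
  by move=> i ia; rewrite fsfun_dflt.
rewrite -big_filter; apply: perm_big; apply: uniq_perm.
- exact: filter_uniq (iota_uniq _ _).
- exact: fset_uniq.
- move=> i; rewrite mem_filter mem_iota /=.
  by have [/aK ->|] := boolP (i \in finsupp alpha).
Qed.

Lemma perm_eq_colors n (c c' : nat -> nat) (s : 'S_n) :
  (forall j : 'I_n, c (s j) = c' j) -> perm_eq (mkseq c n) (mkseq c' n).
Proof.
move=> cs; rewrite /mkseq -val_enum_ord.
have -> : map c' (map val (enum 'I_n)) = map c (map val (map s (enum 'I_n))).
  by rewrite -!map_comp; apply: eq_map => j /=; rewrite cs.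
do 2 apply: perm_map; rewrite perm_sym; apply: uniq_perm; rewrite ?enum_uniq//.
  by rewrite map_inj_uniq ?enum_uniq//; exact: perm_inj.
move=> j; rewrite mem_enum inE; apply/mapP; exists (s^-1 j)%g; rewrite ?mem_enum//.
by rewrite permKV.
Qed.

Lemma color_permutation n (c c' : nat -> nat) :
  perm_eq (mkseq c n) (mkseq c' n) ->
  exists s : 'S_n, forall j : 'I_n, c (s j) = c' j.
Proof.
have szE (b : nat -> nat) : size (mkseq b n) == n by rewrite size_mkseq.
rewrite perm_sym => /(@tuple_permP _ _ (Tuple (szE c')) (Tuple (szE c)))[s cs].
exists s => j; have /(congr1 (nth 0 ^~ j)) := cs.
rewrite nth_mkseq// => ->.
rewrite (nth_map j) ?size_enum_ord// nth_ord_enum (tnth_nth 0) /= nth_mkseq//.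
Qed.

Lemma mkseq_color alpha : mkseq (color alpha) (deg alpha) = colors alpha.
Proof. exact: mkseq_nth. Qed.

Lemma colors_inj alpha beta : perm_eq (colors alpha) (colors beta) -> alpha = beta.
Proof.
move=> /seq.permP ab; apply/fsfunP => i.
by rewrite -!count_colors ab.
Qed.

Definition color_index (n : nat) (c : nat -> nat) : multi_index :=
  [fsfun i in (seq_fset tt (mkseq c n)) => count_mem i (mkseq c n)].

Lemma colors_color_index n c : perm_eq (colors (color_index n c)) (mkseq c n).
Proof.
apply/allP => i _ /=; rewrite count_colors /color_index fsfunE seq_fsetE.
by case: ifPn => // ci; rewrite (count_memPn ci).
Qed.

Lemma deg_color_index n c : deg (color_index n c) = n.
Proof. by rewrite /deg (perm_size (colors_color_index n c)) size_mkseq. Qed.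

End color_permutations.

(** * Symmetrization *)

Section symmetrization.
Context {d} {T : measurableType d} {R : realType}.
Variable m : {sigma_finite_measure set T -> \bar R}.
Local Notation mP n := (prod_measure n (fun=> m)).

Lemma symmetrizeE n (f : n.-tuple T -> R) :
  symmetrize f = (n`!%:R)^-1 *: \sum_(s : 'S_n) (fun t => f (permute t s)).
Proof.
apply/funext => t; rewrite /symmetrize.
have -> h : ((n`!%:R)^-1 *: h : n.-tuple T -> R) t = (n`!%:R)^-1 * h t by [].
by rewrite fct_sumE.
Qed.

Lemma symmetrize_lin n k (f g : n.-tuple T -> R) :
  symmetrize (k *: f + g) = k *: symmetrize f + symmetrize g.
Proof.
apply/funext => t.
have -> : (k *: symmetrize f + symmetrize g) t = k * symmetrize f t +
  symmetrize g t by [].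
rewrite /symmetrize [k * _]mulrCA -mulrDr; congr (_ * _).
by rewrite mulr_sumr -big_split; apply: eq_bigr.
Qed.

Lemma symmetrize_permute n (f : n.-tuple T -> R) t s :
  symmetrize f (permute t s) = symmetrize f t.
Proof.
rewrite /symmetrize; congr (_ * _).
rewrite [RHS](reindex_inj (mulIg s)) /=.
by apply: eq_bigr => s' _; rewrite permuteM.
Qed.

Lemma symmetrize_L2 n (f : n.-tuple T -> R) :
  f \in Lfun (mP n) 2%:E -> symmetrize f \in Lfun (mP n) 2%:E.
Proof.
move=> lf; rewrite symmetrizeE; have pH := hl2_prehilbert (mP n).
by apply: (hmemZ pH); apply: (hmem_sum pH) => s; exact: L2_permute.
Qed.

Lemma hdot_permute n (s : 'S_n) (f g : hl2 (mP n)) : hmem _ f -> hmem _ g ->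
  hdot (hl2 (mP n)) (fun t => f (permute t s)) g =
  hdot (hl2 (mP n)) f (fun t => g (permute t s^-1)).
Proof.
move=> lf lg; have lgs := L2_permute s^-1 lg.
rewrite /= -[RHS](Rintegral_permute m s); last first.
  by apply: measurable_funM; [exact: L2_measurable lf|exact: L2_measurable lgs].
apply: eq_Rintegral => t _; rewrite permuteM mulVg; congr (_ * g _).
by apply: eq_from_tnth => i; rewrite tnth_mktuple perm1.
Qed.

Lemma hdot_symmetrize n (f g : hl2 (mP n)) : hmem _ f -> hmem _ g ->
  hdot (hl2 (mP n)) (symmetrize f) g =
  (n`!%:R)^-1 * \sum_(s : 'S_n) hdot (hl2 (mP n)) (fun t => f (permute t s)) g.
Proof.
move=> lf lg; rewrite symmetrizeE; have pH := hl2_prehilbert (mP n).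
have lfs s : hmem (hl2 (mP n)) (fun t => f (permute t s)) by exact: L2_permute.
by rewrite (hdotZl pH) ?(hdot_suml pH)//; exact: (hmem_sum pH).
Qed.

Lemma hdot_permute_invariant n (s : 'S_n) (f g : hl2 (mP n)) : hmem _ f -> hmem _ g ->
  ae_invariant (mP n) (fun=> True) g ->
  hdot (hl2 (mP n)) (fun t => f (permute t s)) g = hdot (hl2 (mP n)) f g.
Proof.
move=> lf lg ig; rewrite hdot_permute//; have pH := hl2_prehilbert (mP n).
have lgs : hmem (hl2 (mP n)) (fun t => g (permute t s^-1)) by exact: L2_permute.
apply: (heq_dotr pH) => //; split=> //; apply: (L2_ae_eq lgs lg).2; exact: ig.
Qed.

(** Each permutation is moved onto [g], which it fixes, so the average is over equal terms. *)
Lemma hdot_symmetrize_invariant n (f g : hl2 (mP n)) : hmem _ f -> hmem _ g ->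
  ae_invariant (mP n) (fun=> True) g ->
  hdot (hl2 (mP n)) (symmetrize f) g = hdot (hl2 (mP n)) f g.
Proof.
move=> lf lg ig; rewrite hdot_symmetrize//.
rewrite (eq_bigr (fun=> hdot (hl2 (mP n)) f g)); last first.
  by move=> s _; exact: hdot_permute_invariant.
rewrite sumr_const card_Sn -[X in _ * X]mulr_natl mulrA mulVf ?mul1r//.
Qed.

End symmetrization.

(** Stated for any measure on tuples that the permutations in [G] preserve in the L^2 sense, to
    serve both the powers of [nu] and the products of different [rho], where only block permutations
    act isometrically. *)
Lemma ae_invariant_hilbert {d} {T : measurableType d} {R : realType} n
    (m : {measure set (n.-tuple T) -> \bar R}) (G : 'S_n -> Prop) :
  (forall s (f : hl2 m), G s -> hmem _ f ->
     hmem (hl2 m) (fun t => f (permute t s)) /\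
     hnorm2 ((fun t => f (permute t s)) : hl2 m) = hnorm2 f) ->
  hilbert (hsub (H := hl2 m) (ae_invariant m G)).
Proof.
move=> iso; have hH := hl2_hilbert m; have pH : prehilbert (hl2 m) := hH.
apply: hsub_hilbert => //.
- by move=> s _; exact: aeW.
- move=> c u v lu lv iu iv s Gs; have := iu s Gs; have := iv s Gs.
  apply: filterS2 => t vt ut _.
  have E (f : hl2 m) x : (c *: u + v) x = c * u x + v x by [].
  by rewrite /= !E//= (ut I) (vt I).
- move=> u l lu iu [ll ul] s Gs.
  have perm_mem (f : hl2 m) : hmem _ f -> hmem (hl2 m) (fun t => f (permute t s)).
    by move=> lf; case: (iso s f Gs lf).
  apply: (L2_ae_eq (perm_mem l ll) ll).1; apply/eqP; rewrite eq_le.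
  apply/andP; split; last first.
    by apply: (hdot_ge0 pH); apply: (hmemB pH) => //; exact: perm_mem.
  apply/ler_addgt0Pl => e e0; rewrite addr0.
  (* Two uses of the quadratic triangle inequality cost the factors 2 and 4; the middle term
     vanishes by invariance of [u N]. *)
  have e6 : 0 < e / 6 by rewrite divr_gt0.
  have [N hN] := ul _ e6; have h0 := hN N (leqnn N).
  have ls := perm_mem _ (lu N); have lls := perm_mem _ ll.
  have h1 := hnorm2_tri pH lls ls ll; have h2 := hnorm2_tri pH ls (lu N) ll.
  have h3 := (L2_ae_eq ls (lu N)).2 (iu N s Gs).
  have [_ h4] := iso s (l - u N) Gs (hmemB pH ll (lu N)).
  have h5 := hnorm2_sym pH ll (lu N).
  have h6 : hnorm2 ((fun t => l (permute t s)) - (fun t => u N (permute t s)) : hl2 m) =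
    hnorm2 (u N - l) by rewrite -h5 -h4.
  lra.
Qed.

Section symmetrized_colored_tensors.
Context {R : realType} {d : nat}.
Local Notation Rd := (euclid R d).
Local Notation X := (euclid R d * R)%type.
Variable sigma : R.-pker Rd ~> R.
Hypothesis sigma_moments : moment_bound sigma.
Variables (q : nat -> Rd -> {poly R}) (a b : nat -> Rd -> R).
Hypothesis q_orthogonal : forall x,
  monic_orthogonal (sigma x) (fun n => q n x) (fun n => a n x) (fun n => b n x).
Local Notation nu := (base_measure sigma).
Local Notation nuP n := (prod_measure n (fun=> base_measure sigma)).
Local Notation rhoP n c := (prod_measure n (fun j => rho sigma q (c j))).

(** Colorings are functions on all of [nat]; positions from [n] on get the dummy color 0. *)
Definition permute_color n (s : 'S_n) (c : nat -> nat) (k : nat) : nat :=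
  if insub k is Some j then c (s^-1 j)%g else 0.

Lemma permute_colorE n (s : 'S_n) c (j : 'I_n) :
  permute_color s c j = c (s^-1 j)%g.
Proof. by rewrite /permute_color valK. Qed.

Lemma qprod_eq n (c c' : nat -> nat) (t : n.-tuple X) : (forall j : 'I_n, c j = c' j) ->
  qprod q c t = qprod q c' t.
Proof. by move=> cc'; apply: eq_bigr => j _; rewrite cc'. Qed.

Lemma colored_permute n (s : 'S_n) c (f : n.-tuple Rd -> R) (t : n.-tuple X) :
  colored q c f (permute t s) =
  colored q (permute_color s c) (fun y => f (permute y s)) t.
Proof.
rewrite /colored; congr (f _ * _).
  by apply: eq_from_tnth => j; rewrite !tnth_mktuple.
rewrite /qprod [RHS](reindex_inj (@perm_inj _ s)).
by apply: eq_bigr => j _; rewrite permute_colorE permK tnth_mktuple.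
Qed.

Lemma colored_permute_color n (s : 'S_n) (c c' : nat -> nat) (f : n.-tuple Rd -> R) :
  (forall j : 'I_n, c' (s j) = c j) ->
  (fun t : n.-tuple X => colored q c f (permute t s)) =
  colored q c' (fun y => f (permute y s)).
Proof.
move=> cs; apply/funext => t; rewrite colored_permute /colored; congr (_ * _).
by apply: qprod_eq => j; rewrite permute_colorE -cs permKV.
Qed.

Let coloredL n c (f : n.-tuple Rd -> R) (mf : measurable_fun setT f) :=
  colored_L2 sigma_moments q_orthogonal c mf.

Lemma colored_mem n c (f : hl2 (rhoP n c)) : hmem _ f ->
  hmem (hl2 (nuP n)) (colored q c f).
Proof. by move=> lf; apply/(coloredL c (L2_measurable lf)). Qed.

(** The permutation changes the product of the [rho] measures, so the claim is transported through
    [colored] to the power of [nu], where it acts isometrically. *)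
Lemma L2_permute_color n (s : 'S_n) (c c' : nat -> nat) (f : n.-tuple Rd -> R) :
  (forall j : 'I_n, c' (s j) = c j) -> f \in Lfun (rhoP n c) 2%:E ->
  (fun y => f (permute y s)) \in Lfun (rhoP n c') 2%:E.
Proof.
move=> cs lf; have mf := L2_measurable lf.
have mfs : measurable_fun [set: n.-tuple Rd] (fun y => f (permute y s)).
  by apply: (measurableT_comp mf); exact: measurable_permute.
apply/(coloredL c' mfs); rewrite -(colored_permute_color _ cs).
by apply: L2_permute; exact: colored_mem.
Qed.

Lemma hnorm2_permute_color n (s : 'S_n) (c : nat -> nat) (f : hl2 (rhoP n c)) :
  (forall j : 'I_n, c (s j) = c j) -> hmem _ f ->
  hnorm2 ((fun y => f (permute y s)) : hl2 (rhoP n c)) = hnorm2 f.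
Proof.
move=> cs lf; have mf := L2_measurable lf; have lfs := L2_permute_color cs lf.
rewrite -(colored_hnorm2 sigma_moments q_orthogonal)//; last exact: L2_measurable lfs.
rewrite -(colored_permute_color f cs) -[RHS](colored_hnorm2 sigma_moments q_orthogonal)//.
rewrite !L2_hnorm2 (ge0_integral_permute _ s (f := fun t => (colored q c f t ^+ 2)%:E))//.
- apply/measurable_EFinP/measurable_funX.
  exact: (measurable_colored sigma_moments q_orthogonal).
- by move=> t; rewrite lee_fin sqr_ge0.
Qed.

Lemma colored_dot_eq0 n (c c' : nat -> nat) (f : hl2 (rhoP n c)) (g : hl2 (rhoP n c')) :
  hmem _ f -> hmem _ g -> (exists j : 'I_n, c j <> c' j) ->
  hdot (hl2 (nuP n)) (colored q c f) (colored q c' g) = 0.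
Proof.
move=> lf lg [j cj].
have E t : colored q c f t * colored q c' g t =
    (f \* g) (positions t) * (qprod q c t * qprod q c' t).
  by rewrite /colored /=; ring.
have ifg := L2_integrable_mul (colored_mem lf) (colored_mem lg).
rewrite /= /Rintegral; under eq_integral do rewrite E.
rewrite (colored_orthogonal sigma_moments q_orthogonal)//; first by exists j.
by apply: eq_integrable ifg => // t _ /=; rewrite E.
Qed.

Lemma symmetrize_colored_dot_eq0 n (c c' : nat -> nat) (f : hl2 (rhoP n c)) (g
  : hl2 (rhoP n c')) :
  hmem _ f -> hmem _ g -> ~~ perm_eq (mkseq c n) (mkseq c' n) ->
  hdot (hl2 (nuP n)) (symmetrize (colored q c f)) (symmetrize (colored q c' g)) = 0.
Proof.
move=> lf lg cc'; have lcf := colored_mem lf; have lcg := colored_mem lg.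
rewrite hdot_symmetrize_invariant//; last 2 first.
- exact: symmetrize_L2.
- by move=> s _; apply: aeW => t _; rewrite symmetrize_permute.
rewrite (hdotC (hl2_prehilbert _))//; last exact: symmetrize_L2.
rewrite hdot_symmetrize// big1 ?mulr0// => s _.
have cs (j : 'I_n) : permute_color s c' (s j) = c' j by rewrite permute_colorE permK.
transitivity (hdot (hl2 (nuP n))
    (colored q (permute_color s c') (fun y => g (permute y s))) (colored q c f)).
  by congr (hdot _ _ _); exact: colored_permute_color.
apply: (colored_dot_eq0 (L2_permute_color cs lg) lf).
(* If the permuted coloring agreed with [c] everywhere, [c] would be a rearrangement of [c']. *)
apply: contrapT => /forallNP ncc; move/negP: cc'; apply.
rewrite perm_sym; apply: (@perm_eq_colors _ _ _ s^-1%g) => j.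
by have /contrapT <- := ncc j; rewrite permute_colorE.
Qed.

Lemma hnorm2_symmetrize_colored n (c : nat -> nat) (f : hl2 (rhoP n c)) : hmem _ f ->
  ae_invariant (rhoP n c) (fun s : 'S_n => forall j : 'I_n, c (s j) = c j) f ->
  n`!%:R * hnorm2 (symmetrize (colored q c f) : hl2 (nuP n)) =
  #|color_perms (fun j : 'I_n => c j) (fun j => c j)|%:R * hnorm2 f.
Proof.
move=> lf invf; have lcf := colored_mem lf; have pH := hl2_prehilbert (nuP n).
rewrite /hnorm2 hdot_symmetrize_invariant//; last 2 first.
- exact: symmetrize_L2.
- by move=> s _; apply: aeW => t _; rewrite symmetrize_permute.
rewrite (hdotC pH)//; last exact: symmetrize_L2.
rewrite hdot_symmetrize// mulrA divff ?mul1r; last by rewrite pnatr_eq0 -lt0n fact_gt0.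
set C := color_perms _ _.
rewrite (eq_bigr (fun s => if s \in C then hnorm2 f else 0)).
  by rewrite -big_mkcond sumr_const mulr_natl.
move=> s _; case: ifPn; rewrite inE.
  move=> /forallP cs; have {}cs (j : 'I_n) : c (s j) = c j by exact/eqP.
  have lfs := L2_permute_color cs lf.
  transitivity (hdot (hl2 (nuP n)) (colored q c (fun y => f (permute y s)))
    (colored q c f)).
    by congr (hdot _ _ _); exact: colored_permute_color.
  rewrite (colored_dot sigma_moments q_orthogonal)//.
  apply: (heq_dotl (hl2_prehilbert _)) => //; split => //.
  by apply: (L2_ae_eq lfs lf).2; exact: invf.
move=> /forallPn[j cj].
have cs (i : 'I_n) : permute_color s c (s i) = c i by rewrite permute_colorE permK.
transitivity (hdot (hl2 (nuP n))
    (colored q (permute_color s c) (fun y => f (permute y s))) (colored q c f)).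
  by congr (hdot _ _ _); exact: colored_permute_color.
apply: (colored_dot_eq0 (L2_permute_color cs lf) lf).
by exists (s j); rewrite cs => /eqP; rewrite eq_sym (negbTE cj).
Qed.

End symmetrized_colored_tensors.

(** * The unitary operator *)

Section unitary_operators.
Context {R : realType}.
Implicit Types H K L : hspace R.

(** Preservation of norms is enough, by polarization, and a trivial orthogonal complement of the
    range gives surjectivity. *)
Lemma unitary_isometry H K (U : H -> K) : hilbert H -> prehilbert K ->
  (forall u, hmem H u -> hmem K (U u)) ->
  (forall (c : R) u v, hmem H u -> hmem H v ->
     heq (U (c *: u + v)) (c *: U u + U v)) ->
  (forall u, hmem H u -> hnorm2 (U u) = hnorm2 u) ->
  (forall w, hmem K w -> (forall u, hmem H u -> hdot K w (U u) = 0) ->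
     hnorm2 w = 0) ->
  unitary U.
Proof.
move=> hH pK Um Ul Un Ut; have pH : prehilbert H := hH.
have Ud u v : hmem H u -> hmem H v -> hdot K (U u) (U v) = hdot H u v.
  move=> mu mv; have := Ul 1 u v mu mv; rewrite !scale1r => UD.
  have [mUD mD _] := UD; have := hnorm2D pH mu mv.
  rewrite -Un; last exact: (hmemD pH).
  rewrite /hnorm2 (heq_dotl pK UD mUD) (heq_dotr pK UD mD) -/(hnorm2 _).
  rewrite (hnorm2D pK (Um _ mu) (Um _ mv)) !Un//.
  by rewrite -/(hnorm2 u) -/(hnorm2 v); lra.
by split => //; exact: isometry_surjective.
Qed.

Lemma unitary_heq H K (U : H -> K) u v : prehilbert H -> prehilbert K ->
  unitary U -> heq u v -> heq (U u) (U v).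
Proof.
move=> pH pK [Um _ Ud _] [mu mv uv]; split; [exact: Um|exact: Um|].
have mUu := Um _ mu; have mUv := Um _ mv.
by rewrite (hnorm2B pK)// /hnorm2 !Ud// -/(hnorm2 u) -/(hnorm2 v) -(hnorm2B pH).
Qed.

Lemma unitary_comp H K L (U : H -> K) (V : K -> L) : prehilbert K -> prehilbert L ->
  unitary U -> unitary V -> unitary (V \o U).
Proof.
move=> pK pL uU uV; have [Um Ul Ud Us] := uU; have [Vm Vl Vd Vs] := uV; split.
- by move=> u mu /=; apply/Vm/Um.
- move=> c u v mu mv /=.
  apply: (heq_trans pL (unitary_heq pK pL uV (Ul c u v mu mv))).
  by apply: Vl; exact: Um.
- by move=> u v mu mv /=; rewrite Vd ?Ud//; exact: Um.
- move=> w mw; have [v mv vw] := Vs w mw; have [u mu uv] := Us v mv.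
  by exists u => //; apply: (heq_trans pL (unitary_heq pK pL uV uv) vw).
Qed.

End unitary_operators.

(** * The isometry Sym J and the orthogonal complement of its range *)

Section extended_fock_isometry.
Context {R : realType} {d : nat}.
Local Notation Rd := (euclid R d).
Local Notation X := (euclid R d * R)%type.
Variable sigma : R.-pker Rd ~> R.
Hypothesis sigma_moments : moment_bound sigma.
Variables (q : nat -> Rd -> {poly R}) (a b : nat -> Rd -> R).
Hypothesis q_orthogonal : forall x,
  monic_orthogonal (sigma x) (fun n => q n x) (fun n => a n x) (fun n => b n x).
Local Notation nu := (base_measure sigma).
Local Notation nuP n := (prod_measure n (fun=> base_measure sigma)).
Local Notation rhoP n c := (prod_measure n (fun j => rho sigma q (c j))).
Local Notation Gat := (Gspace_at (rho sigma q)).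
Local Notation G := (Gspace (rho sigma q)).
Local Notation level := (fock_level nu).

Lemma fock_level_hilbert n : hilbert (level n).
Proof.
apply: hscale_hilbert; first by rewrite ltr0n fact_gt0.
apply: ae_invariant_hilbert => s f _ lf; split; first exact: L2_permute.
have mf := L2_measurable lf.
rewrite !L2_hnorm2 (ge0_integral_permute _ s (f := fun t => (f t ^+ 2)%:E))//.
- by apply/measurable_EFinP/measurable_funX.
- by move=> t; rewrite lee_fin sqr_ge0.
Qed.

Lemma fock_level_dot n (u v : n.-tuple X -> R) :
  hdot (level n) u v = n`!%:R * hdot (hl2 (nuP n)) u v.
Proof. by []. Qed.

Lemma fock_hilbert : hilbert (fock nu).
Proof. by apply: hilbert_sum_hilbert; exact: fock_level_hilbert. Qed.

Lemma Gspace_at_hilbert alpha : hilbert (Gat alpha).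
Proof.
apply: hscale_hilbert.
  by rewrite ltr0n /mfact; apply: prodn_gt0 => i; rewrite fact_gt0.
apply: ae_invariant_hilbert => s f bs lf; split.
  exact: (L2_permute_color sigma_moments q_orthogonal bs lf).
exact: (hnorm2_permute_color sigma_moments q_orthogonal bs lf).
Qed.

Lemma Gspace_hilbert : hilbert G.
Proof. by apply: hilbert_sum_hilbert; exact: Gspace_at_hilbert. Qed.

Definition sym_colored n c (f : n.-tuple Rd -> R) : fock nu :=
  hin level n (symmetrize (colored q c f)).

Lemma symmetrize_colored_mem n c (f : hl2 (rhoP n c)) : hmem _ f ->
  hmem (level n) (symmetrize (colored q c f)).
Proof.
move=> lf; split.
  by apply: symmetrize_L2; exact: (colored_mem sigma_moments q_orthogonal).
by move=> s _; apply: aeW => t _; rewrite symmetrize_permute.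
Qed.

Lemma sym_colored_mem n c (f : hl2 (rhoP n c)) : hmem _ f ->
  hmem (fock nu) (sym_colored c f).
Proof.
move=> lf; apply: (hin_mem fock_level_hilbert); exact: symmetrize_colored_mem.
Qed.

Lemma sym_colored_lin n c k (f g : n.-tuple Rd -> R) :
  sym_colored c (k *: f + g) = k *: sym_colored c f + sym_colored c g.
Proof. by rewrite /sym_colored colored_lin symmetrize_lin hin_lin. Qed.

Lemma sym_colored_dot_eq0 n m c c' (f : hl2 (rhoP n c)) (g : hl2 (rhoP m c')) :
  hmem _ f -> hmem _ g -> (n = m -> ~~ perm_eq (mkseq c n) (mkseq c' m)) ->
  hdot (fock nu) (sym_colored c f) (sym_colored c' g) = 0.
Proof.
move=> lf lg ncc'; have [mf _] := sym_colored_mem lf.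
rewrite (hdot_hin fock_level_hilbert)// /sym_colored.
have [e|nm] := eqVneq n m; last first.
  rewrite hin_other; last by rewrite eq_sym.
  rewrite (hdot0l (fock_level_hilbert m))//; exact: symmetrize_colored_mem.
have {}ncc' := ncc' e; move: e => /esym e; subst m.
rewrite hin_same fock_level_dot.
by rewrite (symmetrize_colored_dot_eq0 sigma_moments q_orthogonal)// mulr0.
Qed.

Lemma sym_colored_norm alpha (f : Gat alpha) : hmem _ f ->
  hnorm2 (sym_colored (color alpha) f) = hnorm2 f.
Proof.
move=> [lf bf]; rewrite (hnorm2_hin fock_level_hilbert); last first.
  exact: symmetrize_colored_mem.
have := hnorm2_symmetrize_colored sigma_moments q_orthogonal lf bf.
by rewrite card_block_perms.
Qed.

(** Convertible to [Sym_op nu (J_op q f)], but phrased with colorings on [nat] so that unsorted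
    color sequences fit the same notation. *)
Definition chaos (f : G) : fock nu :=
  hsum (fun alpha => sym_colored (color alpha) (f alpha)).

Let family (f : G) alpha : fock nu := sym_colored (color alpha) (f alpha).

Lemma chaos_family f : hmem G f ->
  [/\ forall alpha, hmem (fock nu) (family f alpha),
      forall alpha beta, alpha != beta ->
        hdot (fock nu) (family f alpha) (family f beta) = 0
    & (\esum_(alpha in [set: multi_index]) (hnorm2 (family f alpha))%:E =
       \esum_(alpha in [set: multi_index]) (hnorm2 (f alpha))%:E)%E].
Proof.
move=> [mf _]; split.
- by move=> alpha; have [lf _] := mf alpha; exact: sym_colored_mem.
- move=> alpha beta ab; have [lf _] := mf alpha; have [lg _] := mf beta.
  apply: sym_colored_dot_eq0 => // _; rewrite !mkseq_color.
  by apply: contra ab => /colors_inj ->.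
- by apply: eq_esum => alpha _; rewrite sym_colored_norm.
Qed.

Lemma chaos_sum_to f : hmem G f -> hsum_to (family f) (chaos f).
Proof.
move=> /[dup] -[_ ef] mf; have [m o e] := chaos_family mf.
have := hsum_to_exists fock_hilbert m o; rewrite e => /(_ ef) ex.
exact: (xgetPex 0 ex).
Qed.

Lemma chaos_mem f : hmem G f -> hmem (fock nu) (chaos f).
Proof. by move=> /chaos_sum_to[]. Qed.

Lemma chaos_lin (k : R) f g : hmem G f -> hmem G g ->
  heq (chaos (k *: f + g)) (k *: chaos f + chaos g).
Proof.
move=> mf mg; have pF : prehilbert (fock nu) := fock_hilbert.
have mfg : hmem G (k *: f + g) by apply: (hmemP Gspace_hilbert).
have h1 := chaos_sum_to mfg.
have := hsum_toP pF k (chaos_sum_to mf) (chaos_sum_to mg).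
rewrite (_ : (fun _ => _) = family (k *: f + g)); first exact: (hsum_to_unique pF h1).
by apply/funext => alpha; rewrite -sym_colored_lin.
Qed.

Lemma chaos_norm f : hmem G f -> hnorm2 (chaos f) = hnorm2 f.
Proof.
move=> mf; have [m o e] := chaos_family mf; have [_ ef] := mf.
rewrite (hnorm2_hsum_to fock_hilbert m o _ (chaos_sum_to mf)); last by rewrite e.
by rewrite e (hilbert_sum_norm Gspace_at_hilbert).
Qed.

Section orthogonal_complement.
Variable w : fock nu.
Arguments w : clear implicits.
Hypothesis mw : hmem (fock nu) w.
Hypothesis w0 : forall f, hmem G f -> hdot (fock nu) w (chaos f) = 0.

Let wL2 n : hmem (hl2 (nuP n)) (w n). Proof. by have [h _] := mw; have [] := h n. Qed.
Let winv n : ae_invariant (nuP n) (fun=> True) (w n).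
Proof. by have [h _] := mw; have [] := h n. Qed.

Lemma complement_block_symmetric alpha (f : Gat alpha) : hmem _ f ->
  hdot (hl2 (nuP (deg alpha))) (colored q (color alpha) f) (w (deg alpha)) = 0.
Proof.
move=> mf; have [lf _] := mf; have pF : prehilbert (fock nu) := fock_hilbert.
(* Testing with a vector concentrated at [alpha] isolates one term of the sum that defines
   [chaos]. *)
pose F : G := hin Gat alpha f.
have mF : hmem G F by exact: (hin_mem Gspace_at_hilbert).
have [mfam _ _] := chaos_family mF.
have := w0 mF; rewrite (hdotC pF)//; last exact: chaos_mem.
rewrite (hdot_sum_to pF (chaos_sum_to mF) mw
  (r := hdot (fock nu) (sym_colored (color alpha) f) w)).
  rewrite (hdotC pF)//; last exact: sym_colored_mem.
  have [mw' _] := mw.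
  rewrite (hdot_hin fock_level_hilbert)// fock_level_dot.
  move=> /eqP; rewrite mulf_eq0 pnatr_eq0 gtn_eqF ?fact_gt0// => /eqP.
  have lc := colored_mem sigma_moments q_orthogonal lf.
  rewrite (hdotC (hl2_prehilbert _))//; last exact: symmetrize_L2.
  by rewrite hdot_symmetrize_invariant.
exists [fset alpha]%fset => A; rewrite fsub1set => aA.
rewrite (bigD1_seq alpha) ?fset_uniq//= {1}/family {1}/F hin_same big1 ?addr0//
  => beta ba.
(* The terms with [beta] different from [alpha] have norm zero by the isometry property, which is
   all that the inner product sees. *)
apply: (hdot_null pF) => //.
rewrite sym_colored_norm; last by case: mF.
by rewrite /F hin_other// /hnorm2 (hdot0l (Gspace_at_hilbert _))//;
  exact: (hmem0 (Gspace_at_hilbert _)).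
Qed.

(** The size [n] is kept apart from [deg alpha], because for [alpha = color_index n c] the two are
    equal only propositionally. *)
Lemma complement_sorted alpha n (f : n.-tuple Rd -> R) : deg alpha = n ->
  f \in Lfun (rhoP n (color alpha)) 2%:E ->
  hdot (hl2 (nuP n)) (colored q (color alpha) f) (w n) = 0.
Proof.
move=> e; subst n => lf; set n := deg alpha; set c := color alpha.
pose C := color_perms (fun j : 'I_n => c j) (fun j => c j).
have cC (s : 'S_n) : s \in C -> forall j : 'I_n, c (s j) = c j.
  by rewrite inE => /forallP cs j; exact/eqP.
have pH := hl2_prehilbert (rhoP n c); have pN := hl2_prehilbert (nuP n).
(* Averaging over the block permutations makes [f] block symmetric; this does
   not change the inner product with [w n], which is symmetric. *)
pose F : n.-tuple Rd -> R := \sum_(s in C) (fun y => f (permute y s)).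
have FE y : F y = \sum_(s in C) f (permute y s) by rewrite /F fct_sumE.
have lF : F \in Lfun (rhoP n c) 2%:E.
  rewrite /F big_mkcond; apply: (hmem_sum pH) => s; case: ifPn => [sC|_].
    exact: (L2_permute_color sigma_moments q_orthogonal (cC s sC) lf).
  exact: (hmem0 pH).
have mF : hmem (Gat alpha) F.
  split=> // s bs; have {}bs (j : 'I_n) : c (s j) = c j by exact: bs.
  apply: aeW => y _; rewrite !FE.
  rewrite [RHS](reindex_inj (mulIg s)) /=; apply: eq_big => s' /=.
    rewrite !inE; apply/forallP/forallP => h j; have := h j.
      by rewrite permM bs.
    by rewrite permM bs.
  by move=> _; rewrite permuteM.
have := complement_block_symmetric mF.
have lc : hmem (hl2 (nuP n)) (colored q c f).
  exact: (colored_mem sigma_moments q_orthogonal lf).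
have -> : colored q c F =
    \sum_(s in C) (fun t : n.-tuple X => colored q c f (permute t s)).
  apply/funext => t; rewrite fct_sumE /colored FE mulr_suml.
  apply: eq_bigr => s sC.
  exact: esym (congr1 (@^~ t) (colored_permute_color q f (cC s sC))).
have lcs s : hmem (hl2 (nuP n)) (fun t => colored q c f (permute t s)).
  exact: L2_permute.
rewrite (hdot_suml pN)//.
rewrite (eq_bigr (fun=> hdot (hl2 (nuP n)) (colored q c f) (w n))); last first.
  by move=> s _; exact: hdot_permute_invariant.
(* The multiple is the number of block permutations, a product of factorials, hence nonzero. *)
rewrite sumr_const -mulr_natl => /eqP; rewrite mulf_eq0 pnatr_eq0 => /orP[|/eqP//].
by rewrite card_block_perms -leqn0 leqNgt /mfact prodn_gt0// => i; rewrite fact_gt0.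
Qed.

Lemma complement_eq0 : hnorm2 w = 0.
Proof.
rewrite (hilbert_sum_norm fock_level_hilbert)// esum1// => n _; congr EFin.
rewrite /hnorm2 fock_level_dot.
suff /(L2_hnorm2_eq0 (wL2 n)) : (w n) = (fun=> 0) %[ae nuP n].
  by rewrite /hnorm2 => ->; rewrite mulr0.
apply: (colored_total sigma_moments q_orthogonal (wL2 n)) => _ [c [f [lf ->]]].
have lc := colored_mem sigma_moments q_orthogonal lf.
rewrite [LHS](hdotC (hl2_prehilbert (nuP n)) (wL2 n) lc).
pose alpha := color_index n c; have e : deg alpha = n by exact: deg_color_index.
have [s cs] : exists s : 'S_n, forall j : 'I_n, color alpha (s j) = c j.
  apply: color_permutation; rewrite -{1}e mkseq_color; exact: colors_color_index.
rewrite -(hdot_permute_invariant s)//.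
transitivity (hdot (hl2 (nuP n)) (colored q (color alpha) (fun y => f (permute
  y s))) (w n)).
  by congr (hdot _ _ _); exact: colored_permute_color.
exact: (complement_sorted e (L2_permute_color sigma_moments q_orthogonal cs lf)).
Qed.

End orthogonal_complement.

Lemma chaos_unitary : unitary chaos.
Proof.
apply: unitary_isometry.
- exact: Gspace_hilbert.
- exact: fock_hilbert.
- exact: chaos_mem.
- exact: chaos_lin.
- exact: chaos_norm.
- exact: complement_eq0.
Qed.

End extended_fock_isometry.

Theorem theorem4p2 (R : realType) (d : nat) (d_gt0 : (0 < d)%N)
    (sigma : R.-pker (euclid R d) ~> R)
    (sigma_moments : moment_bound sigma)
    (q : nat -> euclid R d -> {poly R}) (a b : nat -> euclid R d -> R)
    (q_orthogonal : forall x,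
      monic_orthogonal (sigma x) (fun n => q n x) (fun n => a n x) (fun n => b n x))
    (mu : probability (schwartz_dist R d) R)
    (I : fock (base_measure sigma) -> hl2 mu)
    (I_chaos : is_chaos_isomorphism I)
    (a_locally_bounded : forall (n : nat) (L : set (euclid R d)),
      (0 < n)%N -> bounded_borel L -> has_ubound [set a n x | x in L]) :
  unitary (fun f : Gspace (rho sigma q) =>
    I (Sym_op (base_measure sigma) (J_op q f))).
Proof.
have [unitary_I _] := I_chaos.
exact: (unitary_comp (fock_hilbert sigma) (hl2_prehilbert mu)
  (chaos_unitary sigma_moments q_orthogonal) unitary_I).
Qed.
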